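(* Let $G$ be an infinite connected simple vertex-transitive graph with bounded degrees and let $0\le p<p_T(G)$. For $\theta>0$ and $p'\in\{0,p\}$ let $$\Lambda_{p'}(\theta):=\inf_{n\ge1}\frac{\log\widetilde E^{p'}[\exp(\theta U_{n-1})]}{n}\in[0,+\infty].$$ (i) If $G$ is transient, then $$\lim_{\theta\to0,\ \theta>0}\frac{\Lambda_p(\theta)}{\Lambda_0(\theta)}=\frac{c_p}{c_0},\qquad\text{where } c_{p'}:=E^{\mathbb{P}_{p'}}[|C_o|\,P^o(T_{C_o}=+\infty)].$$ (ii) If $G=\mathbb{Z}^d$ (nearest-neighbour graph) with $d=1$ or $d=2$, then $$\lim_{\theta\to0,\ \theta>0}\frac{\Lambda_p(\theta)}{\Lambda_0(\theta)}=1.$$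
   Context: $(S_n)_{n\ge0}$ is the simple random walk on $G$, and $P^x$ is its law started at $x$; $G$ is transient if this walk is transient. $T_A:=\inf\{n\ge1:S_n\in A\}$ for a vertex set $A$ (with $\inf\emptyset=+\infty$). $\mathbb{P}_p$ is the law of Bernoulli bond percolation on $G$ with parameter $p$; $C_x$ is the open cluster of $x$. $p_T(G):=\inf\{p\in[0,1]:E^{\mathbb{P}_p}[|C_o|]=+\infty\}$. $\widetilde E^{p}$ is expectation with respect to $P^o\otimes\mathbb{P}_p$ for any fixed vertex $o$ (values do not depend on $o$). $U_n:=\big|\bigcup_{x\in\{S_0,\dots,S_n\}}C_x\big|$; in particular, for $p=0$, $U_n=|\{S_0,\dots,S_n\}|$ a.s. *)

(* Defs.v *)
From HB Require Import structures.
From mathcomp Require Import all_boot all_order all_algebra finmap.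
From mathcomp Require Import all_classical all_reals all_analysis.

Set Implicit Arguments.
Unset Strict Implicit.
Unset Printing Implicit Defensive.

Import Order.TTheory GRing.Theory Num.Theory.
Import numFieldNormedType.Exports.

Local Open Scope classical_set_scope.
Local Open Scope ring_scope.

(* A simple graph on V is given by its symmetric, irreflexive adjacency       *)
(* relation.                                                                  *)
Section graphs.
Context (V : choiceType) (adj : rel V).

Definition neighbours (x : V) : set V := [set y | adj x y].

Definition degree (x : V) : nat := #|` fset_set (neighbours x)|%fset.

Definition bounded_degrees : Prop :=
  exists D : nat, forall x, finite_set (neighbours x) /\ (degree x <= D)%N.

Definition connected_graph : Prop :=
  forall x y, exists2 s : seq V, path adj x s & last x s = y.

Definition graph_isomorphism (V' : choiceType) (adj' : rel V') (f : V -> V') :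
  Prop := bijective f /\ forall a b, adj' (f a) (f b) = adj a b.

End graphs.

Definition graph_isomorphic (V V' : choiceType) (adj : rel V) (adj' : rel V') :
  Prop := exists f : V -> V', graph_isomorphism adj adj' f.

Definition vertex_transitive (V : choiceType) (adj : rel V) : Prop :=
  forall x y, exists2 f : V -> V, graph_isomorphism adj adj f & f x = y.

Definition Zd_adj (d : nat) : rel 'rV[int]_d :=
  fun x y => \sum_(i < d) `|x ord0 i - y ord0 i| == 1.

Section random_walk.
Context (R : realType) (V : choiceType) (adj : rel V).
Context (dW : measure_display) (W : measurableType dW).
Implicit Types (S : nat -> W -> V) (PW : V -> probability W R).

Definition step_prob (x y : V) : R :=
  if adj x y then (degree adj x)%:R^-1 else 0.

(* For every x, under PW x, S is a simple random walk started at x: the joint *)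
(* law of (S 0, ..., S n) is prescribed for all n.                            *)
Definition is_simple_random_walk S PW : Prop :=
  (forall n v, measurable [set w | S n w = v]) /\
  (forall x n (v : nat -> V),
     PW x [set w | forall i, (i <= n)%N -> S i w = v i] =
     ((v 0%N == x)%:R * \prod_(i < n) step_prob (v i) (v i.+1))%:E).

(* T_A = inf {n >= 1 | S_n \in A}, where the infimum of set0 is +oo.          *)
Definition hitting_time S (A : set V) (w : W) : \bar R :=
  ereal_inf [set n%:R%:E | n in [set n | (1 <= n)%N /\ A (S n w)]].

Definition transient S PW : Prop :=
  forall x, (PW x [set w | (hitting_time S [set x] w < +oo)%E] < 1)%E.

End random_walk.

Section percolation.
Context (R : realType) (V : choiceType) (adj : rel V).
Context (dX : measure_display) (X : measurableType dX).
(* omega w e: the bond e is open in the configuration w. Only the values at   *)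
(* two-element sets of adjacent vertices are relevant.                        *)
Implicit Types (omega : X -> {fset V} -> bool) (P : probability X R).

Definition is_edge (e : {fset V}) : Prop :=
  exists x y, adj x y /\ e = [fset x; y]%fset.

(* The states of the edges are independent, each edge being open with         *)
(* probability q: all the finite-dimensional laws are prescribed.             *)
Definition is_bernoulli_percolation omega (q : R) P : Prop :=
  (forall e, is_edge e -> measurable [set w | omega w e]) /\
  (forall A B : {fset {fset V}},
     (forall e, e \in A -> is_edge e) -> (forall e, e \in B -> is_edge e) ->
     [disjoint A & B]%fset ->
     P [set w | (forall e, e \in A -> omega w e) /\
                (forall e, e \in B -> ~~ omega w e)] =
     (q ^+ #|` A|%fset * (1 - q) ^+ #|` B|%fset)%:E).

Definition open_adj omega (w : X) : rel V :=
  fun x y => adj x y && omega w [fset x; y]%fset.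

Definition cluster omega (w : X) (x : V) : set V :=
  [set y | exists2 s : seq V, path (open_adj omega w) x s & last x s = y].

Definition mean_cluster_size omega P (o : V) : \bar R :=
  (\int[P]_w counting (cluster omega w o))%E.

Definition p_T omega (PX : R -> probability X R) (o : V) : R :=
  inf [set q | 0 <= q <= 1 /\ mean_cluster_size omega (PX q) o = +oo%E].

End percolation.

Section walk_and_percolation.
Context (R : realType) (V : choiceType) (adj : rel V).
Context (dW : measure_display) (W : measurableType dW) (S : nat -> W -> V).
Context (dX : measure_display) (X : measurableType dX).
Context (omega : X -> {fset V} -> bool).
Local Open Scope ereal_scope.

Definition U (n : nat) (z : W * X) : \bar R :=
  counting (\bigcup_(i in [set i | (i <= n)%N]) cluster adj omega z.2 (S i z.1)).

(* Lambda_q(theta), for PWo = P^o and PXq the percolation law of parameter q. *)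
Definition Lambda (PWo : probability W R) (PXq : probability X R) (theta : R) :
  \bar R :=
  ereal_inf [set lne (\int[PWo \x PXq]_z expeR (theta%:E * U n.-1 z)) / n%:R%:E
            | n in [set n | (1 <= n)%N]].

Definition escape_constant
    (PWo : probability W R) (PXq : probability X R) (o : V) : \bar R :=
  \int[PXq]_w (counting (cluster adj omega w o) *
    PWo [set w' | hitting_time R S (cluster adj omega w o) w' = +oo]).

End walk_and_percolation.

(* Main.v *)
Require Import Defs.
From HB Require Import structures.
From mathcomp Require Import all_boot all_order all_algebra finmap.
From mathcomp Require Import all_classical all_reals all_analysis.
From mathcomp Require Import measurable_realfun.
From mathcomp Require Import lra ring zify.
Set Implicit Arguments.
Unset Strict Implicit.
Unset Printing Implicit Defensive.

Import Order.TTheory GRing.Theory Num.Theory.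
Import numFieldNormedType.Exports.
Local Open Scope classical_set_scope.
Local Open Scope ring_scope.

(** By Jensen's inequality, [log E exp (theta U_(n-1)) >= theta E U_(n-1)].  By
    reversal of the walk, [E U_(n-1)] is the sum for [k < n] of the mean number
    [a_k] of vertices of [C_o] that lie in none of the clusters of
    [S_1, ..., S_k]; the [a_k] decrease to [c_p], so [Lambda_p theta >= c_p theta].
    For [p < p_T] the size of a cluster has an exponential moment, hence
    [E exp (theta U_(n-1)) = 1 + theta E U_(n-1) + O(theta^2 n^2)] as long as
    [theta n] is small.  Letting [theta] tend to [0] and then [n] to infinity
    gives [Lambda_p theta ~ c_p theta], which is the transient case.

    On [Z] the clusters met by the walk fill the interval that it spans and leave
    it only at its two ends, and [Lambda_p theta = Lambda_0 theta = ln (cosh theta)]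
    for small [theta].

    On [Z^2] the last exit decomposition gives [a_n <= (1 + o(1)) / G_n] for every
    [p], where the Green function [G_n] of the walk grows like a logarithm.  The
    previous upper bound with [n = theta^(-1 + o(1))] yields
    [Lambda_p theta <= (1 + o(1)) theta / G_n].  For [Lambda_0] a matching lower
    bound comes from Jensen's inequality for a walk with a drift [lam] such that
    [lam^2 = theta^(1 + o(1))]: the entropy costs [lam^2] per step, and each step
    finds a new vertex with probability about [1 / G_(1 / lam^2)].  As [G] varies
    slowly, both bounds have the same leading term. *)

(** * Percolation on a finite list of edges *)

(** The exponential moment comes from exploring clusters in finite models. Edges of a finite list
    are revealed one at a time, and the generating function of the cluster size is submultiplicative
    in the set of sources. For p < p_T the connection probabilities from o are summable, so some
    finite set around o has an outer boundary of which, on average, at most half a vertex is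
    reached. A recursion through this boundary then closes at some argument larger than 1. The
    clusters met by the walk are dependent. Convexity replaces their total size by an average of
    single sizes, each multiplied by the number of clusters; this is why theta n must stay small. On
    the square lattice c_p and c_0 vanish, so the leading constants themselves must agree. Scales
    that differ from 1 / theta by factors 4^j or 4^(2j), with j a small fraction of log (1 / theta),
    change G by a factor close to 1 while the errors of order 4^(-j) remain negligible against 1 /
    G. On Z and Z^2 the inequality Lambda_0 <= Lambda_p is direct, so what remains is an upper bound
    for Lambda_p close to a lower bound for Lambda_0. *)

Section finite_expectation.
Context {R : realType} {E : eqType} (q : R).
Implicit Types (L O : seq E) (F G : seq E -> R).

(* The expectation of F(O), where O lists the open edges among those of L. *)
Fixpoint Exp (L : seq E) (F : seq E -> R) : R :=
  if L is e :: L' then q * Exp L' (fun O => F (e :: O)) + (1 - q) * Exp L' F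
  else F [::].

Lemma Exp_cst L (c : R) : Exp L (fun=> c) = c.
Proof. by elim: L => //= e L ->; ring. Qed.

Lemma ExpD L F G : Exp L (fun O => F O + G O) = Exp L F + Exp L G.
Proof.
elim: L F G => //= e L IH F G.
by rewrite (IH (fun O => F (e :: O)) (fun O => G (e :: O))) IH; ring.
Qed.

Lemma ExpZ L (c : R) F : Exp L (fun O => c * F O) = c * Exp L F.
Proof.
elim: L F => //= e L IH F.
by rewrite (IH (fun O => F (e :: O))) IH; ring.
Qed.

Lemma Exp_sum L (I : Type) (r : seq I) (F : I -> seq E -> R) :
  Exp L (fun O => \sum_(i <- r) F i O) = \sum_(i <- r) Exp L (F i).
Proof.
elim: r => [|i r IH].
  rewrite big_nil -[RHS](Exp_cst L); congr Exp; apply/funext => O.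
  by rewrite big_nil.
rewrite big_cons -IH -ExpD; congr Exp; apply/funext => O.
by rewrite big_cons.
Qed.

Hypotheses (q0 : 0 <= q) (q1 : q <= 1).

Lemma Exp_le L F G : (forall O, {subset O <= L} -> F O <= G O) ->
  Exp L F <= Exp L G.
Proof.
elim: L F G => [|e L IH] F G FG /=; first exact: FG.
have q1' : 0 <= 1 - q by rewrite subr_ge0.
apply: lerD; apply: ler_wpM2l => //; apply: IH => O sOL; apply: FG => x.
  by rewrite !inE => /predU1P[->|/sOL ->]; rewrite ?eqxx ?orbT.
by move=> /sOL xL; rewrite inE xL orbT.
Qed.

Lemma eq_Exp L F G : (forall O, {subset O <= L} -> F O = G O) ->
  Exp L F = Exp L G.
Proof.
by move=> FG; apply/eqP; rewrite eq_le !Exp_le// => O /FG ->.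
Qed.

(** As [F] depends only on the set of open edges, any edge of [L] can be revealed first.
    Explorations choose an edge that touches the current cluster. *)
Lemma Exp_rem L F e : (forall O O', O =i O' -> F O = F O') -> e \in L ->
  Exp L F = q * Exp (rem e L) (fun O => F (e :: O)) + (1 - q) * Exp (rem e L) F.
Proof.
elim: L F => //= e' L IH F Fext; rewrite inE.
have [->|nee'] //= := eqVneq e' e => eL.
rewrite (IH (fun O => F (e' :: O))) ?(IH F)//; last first.
  by move=> O O' OO'; apply: Fext => x; rewrite !inE OO'.
have -> : (fun O => F [:: e', e & O]) = (fun O => F [:: e, e' & O]).
  by apply/funext => O; apply: Fext => x; rewrite !inE orbCA.
ring.
Qed.

End finite_expectation.

(** * Reachability from a list of sources *)

Section reachability.
Context {V : choiceType}.
Implicit Types (r : rel V) (A B : seq V).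

(** Allowing several sources makes unions of clusters and partly explored clusters instances of one
    notion, and inductions follow the last edge of a connection. [reach_path] links a single source
    to the clusters of the statement. *)
Inductive reach r A : V -> Prop :=
| reach_mem x : x \in A -> reach r A x
| reach_step a b : reach r A a -> r a b -> reach r A b.

Lemma reach_path r x y : reach r [:: x] y <->
  exists2 s, path r x s & last x s = y.
Proof.
split.
  elim=> [z|a b _ [s ps ls] rab]; first by rewrite inE => /eqP ->; exists [::].
  by exists (rcons s b); rewrite ?last_rcons// rcons_path ps ls.
case=> s; elim/last_ind: s y => [|s z IH] y /=.
  by move=> _ <-; apply: reach_mem; rewrite inE.
rewrite rcons_path last_rcons => /andP[ps rz] <-.
by apply: reach_step rz; apply: IH.
Qed.

Lemma reach_trans r A B y : (forall x, x \in B -> reach r A x) ->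
  reach r B y -> reach r A y.
Proof. by move=> BA; elim=> [x /BA//|a b _ ra]; apply: reach_step. Qed.

Lemma reach_mono r r' A B y : (forall a b, r a b -> r' a b) ->
  {subset A <= B} -> reach r A y -> reach r' B y.
Proof.
move=> rr' AB; elim=> [x /AB xB|a b _ ra /rr']; first exact: reach_mem.
exact: reach_step.
Qed.

Lemma reach_sub r A B y : {subset A <= B} -> reach r A y -> reach r B y.
Proof. exact: reach_mono. Qed.

Lemma reach_cat r A B y : reach r (A ++ B) y <-> reach r A y \/ reach r B y.
Proof.
split; last first.
  by case; apply: reach_sub => x xA; rewrite mem_cat xA ?orbT.
elim=> [x|a b _ [] ra rab].
- by rewrite mem_cat => /orP[]; [left|right]; apply: reach_mem.
- by left; apply: reach_step rab.
- by right; apply: reach_step rab.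
Qed.

Lemma reach_cons r x A y : reach r (x :: A) y <-> reach r [:: x] y \/ reach r A y.
Proof. exact: (reach_cat r [:: x] A). Qed.

Lemma reach_sym r x y : symmetric r -> reach r [:: x] y -> reach r [:: y] x.
Proof.
move=> rS; elim=> [z|a b _ ra rab].
  by rewrite inE => /eqP ->; apply: reach_mem; rewrite inE.
apply: reach_trans ra => z; rewrite inE => /eqP ->.
by apply: (@reach_step _ _ b a); [apply: reach_mem; rewrite inE | rewrite rS].
Qed.

Lemma reach_nil r y : ~ reach r [::] y.
Proof. by elim=> // x; rewrite in_nil. Qed.

End reachability.

(** * Exploration of clusters and the generating function of their sizes *)

Section exploration.
Context {R : realType} {V : choiceType} (q : R).
Hypotheses (q0 : 0 <= q) (q1 : q <= 1).
Implicit Types (L O : seq {fset V}) (A B D : seq V) (c t : R).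

Definition erel O : rel V := fun a b => [fset a; b]%fset \in O.

(** The finite window [D] is a box when sizes are measured, and the outer boundary of a finite set
    during an exploration. *)
Definition ccount O A D : nat := count (fun y => `[< reach (erel O) A y >]) D.

Lemma ccount_le O O' A A' D :
  (forall y, reach (erel O) A y -> reach (erel O') A' y) ->
  (ccount O A D <= ccount O' A' D)%N.
Proof. by move=> h; apply: sub_count => y /asboolP/h ?; apply/asboolP. Qed.

Lemma eq_ccount O O' A A' D :
  (forall y, reach (erel O) A y <-> reach (erel O') A' y) ->
  ccount O A D = ccount O' A' D.
Proof. by move=> h; apply/eqP; rewrite eqn_leq !ccount_le// => y /h. Qed.

Lemma ccount_ext O O' A D : O =i O' -> ccount O A D = ccount O' A D.
Proof.
by move=> OO'; apply: eq_ccount => y; split; apply: reach_mono => // a b;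
  rewrite /erel OO'.
Qed.

(** Once an edge at a source is known to be open, its other end becomes a source and the edge itself
    can be forgotten. This turns the exploration into a recursion on the pair [L], [A]. *)
Lemma ccount_edge O a y A D : a \in A ->
  ccount ([fset a; y]%fset :: O) A D = ccount O (y :: A) D.
Proof.
move=> aA; apply: eq_ccount => z; split.
  elim=> [x xA|u v _ ru]; first by apply: reach_mem; rewrite inE xA orbT.
  rewrite /erel inE => /predU1P[uv|uv]; last exact: reach_step uv.
  have : v \in [fset a; y]%fset by rewrite -uv !inE eqxx orbT.
  by rewrite !inE => /orP[]/eqP ->; apply: reach_mem;
    rewrite inE ?eqxx// aA orbT.
elim=> [x|u v _ ru uv]; last first.
  by apply: reach_step ru _; rewrite /erel inE orbC; apply/orP; left.
rewrite inE => /predU1P[->|xA]; last exact: reach_mem.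
by apply: (@reach_step _ _ _ a); [exact: reach_mem | rewrite /erel inE eqxx].
Qed.

Lemma ccount_stuck O A D : (forall a y, a \in A -> [fset a; y]%fset \notin O) ->
  ccount O A D = count (mem A) D.
Proof.
move=> st; apply: eq_count => z /=; apply/asboolP/idP; last exact: reach_mem.
by elim=> // a b _ aA; rewrite /erel (negbTE (st _ _ aA)).
Qed.

Lemma ccount_cat O A B D : (ccount O (A ++ B) D <= ccount O A D + ccount O B D)%N.
Proof.
rewrite /ccount -count_predUI; apply: leq_trans (leq_addr _ _).
by apply: sub_count => y /asboolP/reach_cat[] h /=; apply/orP; [left|right];
  apply/asboolP.
Qed.

(** The generating function at [c] of the number of vertices of [D] in the cluster of [A], when only
    edges of [L] may be open. *)
Definition cgen c D L A : R := Exp q L (fun O => c ^+ ccount O A D).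

Lemma cgen_edge c D L A a y : a \in A -> [fset a; y]%fset \in L ->
  cgen c D L A = q * cgen c D (rem [fset a; y]%fset L) (y :: A) +
                 (1 - q) * cgen c D (rem [fset a; y]%fset L) A.
Proof.
move=> aA eL; rewrite /cgen (Exp_rem q _ eL); last first.
  by move=> O O' OO'; rewrite (ccount_ext _ _ OO').
by congr (q * Exp q _ _ + _); apply/funext => O; rewrite ccount_edge.
Qed.

Lemma cgen_ge0 c D L A : 0 <= c -> 0 <= cgen c D L A.
Proof.
by move=> c0; rewrite -(Exp_cst q L 0); apply: Exp_le => // O _; apply: exprn_ge0.
Qed.

Lemma cgen_rem c D L A e : 1 <= c -> e \in L ->
  cgen c D (rem e L) A <= cgen c D L A.
Proof.
move=> c1 eL; rewrite [in leRHS]/cgen (Exp_rem q _ eL); last first.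
  by move=> O O' OO'; rewrite (ccount_ext _ _ OO').
rewrite -/(cgen c D (rem e L) A).
have : cgen c D (rem e L) A <= Exp q (rem e L) (fun O => c ^+ ccount (e :: O) A D).
  apply: Exp_le => // O _; apply: ler_weXn2l => //; apply: ccount_le => y.
  by apply: reach_mono => // a b; rewrite /erel inE orbC => ->.
by move=> /(ler_wpM2l q0); lra.
Qed.

Lemma touchP L A :
  (exists a y, a \in A /\ [fset a; y]%fset \in L) \/
  (forall a y, a \in A -> [fset a; y]%fset \notin L).
Proof.
have [h|h] := pselect (exists a y, a \in A /\ [fset a; y]%fset \in L).
  by left.
by right=> a y aA; apply/negP => eL; apply: h; exists a, y.
Qed.

(* Edges at the cluster of A are revealed one by one: what is left for B is a
   smaller list of edges. *)
Lemma cgen_cat c D L A B : 1 <= c ->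
  cgen c D L (A ++ B) <= cgen c D L A * cgen c D L B.
Proof.
move=> c1; have c0 := le_trans ler01 c1.
elim/ltn_ind: {L}(size L) {-2}L (erefl (size L)) A => n IH L sL A.
have [[a [y [aA eL]]]|st] := touchP L A.
  have lt_n : (size (rem [fset a; y]%fset L) < n)%N.
    by rewrite size_rem// -sL; case: (L) eL.
  rewrite (@cgen_edge _ _ _ (A ++ B) a y)// ?mem_cat ?aA//.
  rewrite (@cgen_edge _ _ _ A a y)//.
  have h1 := IH _ lt_n _ (erefl _) (y :: A).
  have h2 := IH _ lt_n _ (erefl _) A.
  have h3 := cgen_rem D B c1 eL.
  set L' := rem _ L in h1 h2 h3 *.
  have g1 := cgen_ge0 D L' (y :: A) c0; have g2 := cgen_ge0 D L' A c0.
  apply: (@le_trans _ _ ((q * cgen c D L' (y :: A) + (1 - q) * cgen c D L' A) *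
    cgen c D L' B)).
    rewrite [leRHS]mulrDl -!mulrA; apply: lerD; apply: ler_wpM2l => //.
    by rewrite subr_ge0.
  apply: ler_wpM2l => //; apply: addr_ge0; apply: mulr_ge0 => //.
  by rewrite subr_ge0.
(* With no edge left at [A], its cluster is [A] itself and is deterministic, so subadditivity of the
   count suffices. *)
have stO O : {subset O <= L} -> forall a y, a \in A -> [fset a; y]%fset \notin O.
  by move=> sO a y aA; apply: contra (st a y aA) => /sO.
have -> : cgen c D L A = c ^+ count (mem A) D.
  rewrite -[RHS](Exp_cst q L); apply: eq_Exp => // O sO.
  by rewrite ccount_stuck//; apply: stO.
rewrite -ExpZ; apply: Exp_le => // O sO; rewrite -exprD.
apply: ler_weXn2l => //; apply: leq_trans (ccount_cat _ _ _ _) _.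
by rewrite ccount_stuck//; apply: stO.
Qed.

Lemma cgen_seq c t D L A : 1 <= c -> 0 <= t ->
  (forall y, cgen c D L [:: y] <= t) -> cgen c D L A <= t ^+ size A.
Proof.
move=> c1 t0 h; have c0 := le_trans ler01 c1.
elim: A => [|y A IH] /=.
  rewrite expr0 -(Exp_cst q L 1); apply: Exp_le => // O _.
  by rewrite /ccount (@eq_count _ _ pred0) ?count_pred0// => z /=;
    apply/asboolP => /reach_nil.
rewrite exprS; apply: le_trans (cgen_cat D L [:: y] A c1) _.
by apply: ler_pM => //; apply: cgen_ge0.
Qed.

(* The cluster is explored only through edges at the finite set T; the
   exploration stops at vertices of the outer boundary Bd, from which
   independent clusters start in the unexplored edges. *)
Lemma cgen_explore c t D n L A (T Bd : seq V) : 1 <= c -> 1 <= t -> uniq D -> uniq T ->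
  (forall L', (size L' < n)%N -> subseq L' L ->
     forall y, cgen c D L' [:: y] <= t) ->
  (forall a y, a \in T -> [fset a; y]%fset \in L -> y \in T \/ y \in Bd) ->
  (forall a, a \in A -> a \in T \/ a \in Bd) ->
  (size L < n)%N -> cgen c D L A <= c ^+ size T * cgen t Bd L A.
Proof.
move=> c1 t1 uD uT; have c0 := le_trans ler01 c1; have t0 := le_trans ler01 t1.
elim/ltn_ind: {L}(size L) {-2}L (erefl (size L)) A => k IH L sL A ht hT hA.
move=> kn.
have [[a [y [aA eL]]]|st] := touchP L [seq a <- A | a \in T].
  move: aA; rewrite mem_filter => /andP[aT aA].
  have lt_k : (size (rem [fset a; y]%fset L) < k)%N.
    by rewrite size_rem// -sL; case: (L) eL.
  have lt_n := ltn_trans lt_k (eq_ind _ (fun i => (i < n)%N) kn _ sL).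
  have sub := @mem_rem _ [fset a; y]%fset L.
  have ht' : forall L', (size L' < n)%N ->
      subseq L' (rem [fset a; y]%fset L) ->
      forall y0, cgen c D L' [:: y0] <= t.
    by move=> L' ? sL'; apply: ht => //; apply: subseq_trans sL' (rem_subseq _ _).
  have hT' : forall a0 y0, a0 \in T ->
      [fset a0; y0]%fset \in rem [fset a; y]%fset L -> y0 \in T \/ y0 \in Bd.
    by move=> a0 y0 a0T /sub; apply: hT.
  rewrite (@cgen_edge c D _ A a y)// (@cgen_edge t Bd _ A a y)//.
  have h1 : cgen c D (rem [fset a; y]%fset L) (y :: A) <=
     c ^+ size T * cgen t Bd (rem [fset a; y]%fset L) (y :: A).
    apply: (IH _ lt_k _ (erefl _)) => // b; rewrite inE => /predU1P[->|/hA//].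
    exact: hT eL.
  have h2 : cgen c D (rem [fset a; y]%fset L) A <=
     c ^+ size T * cgen t Bd (rem [fset a; y]%fset L) A.
    exact: (IH _ lt_k _ (erefl _)).
  rewrite mulrDr !(mulrCA (c ^+ _)); apply: lerD; apply: ler_wpM2l => //.
  by rewrite subr_ge0.
(* The exploration of [T] has ended: sources in [T] reach nothing further and account for at most
   [size T] vertices in all. The other sources lie in [Bd] by [hA]. *)
set A' := undup [seq a <- A | a \notin T].
apply: (@le_trans _ _ (c ^+ size T * cgen c D L A')).
  rewrite -ExpZ; apply: Exp_le => // O sO; rewrite -exprD.
  apply: ler_weXn2l => //.
  have sub y : reach (erel O) A y ->
      y \in [seq a <- A | a \in T] \/ reach (erel O) A' y.
    elim=> [x xA|a b _ [aA|ra'] ab].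
    - have [xT|xT] := boolP (x \in T); first by left; rewrite mem_filter xT.
      by right; apply: reach_mem; rewrite mem_undup mem_filter xT xA.
    - by have /negP := st _ b aA; case; apply: sO.
    - by right; apply: reach_step ab.
  rewrite /ccount; set P := (fun y => `[< reach (erel O) A' y >]).
  apply: leq_trans (_ : count (predU (mem T) P) D <= _)%N.
    apply: sub_count => y /asboolP/sub [|yA'] /=.
      by rewrite mem_filter => /andP[-> _].
    by apply/orP; right; apply/asboolP.
  apply: leq_trans (leq_addr (count (predI (mem T) P) D) _) _.
  rewrite count_predUI leq_add2r.
  rewrite -size_filter; apply: uniq_leq_size; first exact: filter_uniq.
  by move=> x; rewrite mem_filter => /andP[].
apply: ler_wpM2l; first exact: exprn_ge0.
(* Each source in [A'] costs a factor [t], and [A'] is a duplicate-free list of vertices that are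
   counted as reached in [Bd]. *)
apply: (@le_trans _ _ (t ^+ size A')).
  by apply: cgen_seq => // y; apply: ht => //; rewrite sL.
rewrite -[leLHS](Exp_cst q L); apply: Exp_le => // O sO.
apply: ler_weXn2l => //; rewrite /ccount -size_filter.
apply: uniq_leq_size; first exact: undup_uniq.
move=> x; rewrite mem_undup !mem_filter => /andP[xT xA].
case: (hA _ xA) => [xT'|->]; first by rewrite xT' in xT.
by rewrite andbT; apply/asboolP; apply: reach_mem.
Qed.

Lemma bernoulli_exp_le t (j K : nat) : 1 <= t -> (j <= K)%N ->
  t ^+ j <= 1 + j%:R * ((t - 1) * t ^+ K).
Proof.
move=> t1; have t0 := le_trans ler01 t1.
have tK : 0 <= (t - 1) * t ^+ K by rewrite mulr_ge0 ?exprn_ge0 ?subr_ge0.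
elim: j => [|j IH] jK; first by rewrite expr0 mul0r addr0.
have {IH} := IH (ltnW jK).
have : (t - 1) * t ^+ j <= (t - 1) * t ^+ K.
  by rewrite ler_wpM2l ?subr_ge0// ler_weXn2l// ltnW.
by rewrite -natr1 exprS; lra.
Qed.

(** Induction on the number of edges. The clusters that start on [Bd] live in fewer edges, so each
    has generating function at most [t]. The power [t ^+ j], for [j] reached vertices of [Bd], is
    bounded by an affine function of [j], whose mean is at most one half; the last hypothesis on [c]
    and [t] closes the recursion. *)
Lemma cgen_bounded c t D L (k K : nat) : 1 <= c -> 1 <= t -> uniq D ->
  (forall v, exists T Bd, [/\ v \in T, uniq T, (size T <= k)%N &
     (size Bd <= K)%N] /\
     ((forall L' a y, subseq L' L ->
        a \in T -> [fset a; y]%fset \in L' -> y \in T \/ y \in Bd) /\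
     (forall L', subseq L' L ->
        Exp q L' (fun O => (ccount O [:: v] Bd)%:R) <= 2^-1))) ->
  c ^+ k * (1 + 2^-1 * ((t - 1) * t ^+ K)) <= t ->
  forall y, cgen c D L [:: y] <= t.
Proof.
move=> c1 t1 uD hv ct; have c0 := le_trans ler01 c1.
have t0 := le_trans ler01 t1.
have tK0 : 0 <= (t - 1) * t ^+ K by rewrite mulr_ge0 ?exprn_ge0 ?subr_ge0.
suff main L' : subseq L' L -> forall y, cgen c D L' [:: y] <= t by exact: main.
elim/ltn_ind: {L'}(size L') {-2}L' (erefl (size L')) => n IH L' sL' sub v.
have [T [Bd [[vT uT sT sBd] [hT hE]]]] := hv v.
apply: le_trans (_ : c ^+ size T * cgen t Bd L' [:: v] <= _).
  (* One edge at [v] is revealed before [cgen_explore] applies, so that the remaining list is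
     strictly shorter and the induction hypothesis covers it. *)
  have [[a [y [aA eL]]]|st] := touchP L' [:: v].
    move: aA eL; rewrite inE => /eqP -> eL.
    have lt_n : (size (rem [fset v; y]%fset L') < n)%N.
      by rewrite size_rem// -sL'; case: (L') eL.
    have subr : subseq (rem [fset v; y]%fset L') L' := rem_subseq _ _.
    have vv : v \in [:: v] by rewrite inE.
    rewrite (@cgen_edge c D _ [:: v] v y)// (@cgen_edge t Bd _ [:: v] v y)//.
    have h A : (forall a, a \in A -> a \in T \/ a \in Bd) ->
        cgen c D (rem [fset v; y]%fset L') A <=
        c ^+ size T * cgen t Bd (rem [fset v; y]%fset L') A.
      move=> hA; apply: (@cgen_explore _ _ _ n) => // [L''|b z bT].
        move=> ltn sL''; apply: IH ltn _ (erefl _) _.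
        exact: subseq_trans sL'' (subseq_trans subr sub).
      by apply: hT bT; apply: subseq_trans subr sub.
    rewrite mulrDr !(mulrCA (c ^+ _)); apply: lerD; apply: ler_wpM2l => //.
    - apply: h => b; rewrite !inE => /orP[]/eqP ->; last by left.
      by apply: (hT L' v).
    - by rewrite subr_ge0.
    - by apply: h => b; rewrite !inE => /eqP ->; left.
  have -> : cgen c D L' [:: v] = c ^+ count (mem [:: v]) D.
    rewrite -[RHS](Exp_cst q L'); apply: eq_Exp => // O sO.
    by rewrite ccount_stuck// => a y aA; apply: contra (st a y aA) => /sO.
  have : 1 <= cgen t Bd L' [:: v].
    rewrite -(Exp_cst q L' 1); apply: Exp_le => // O _; exact: exprn_ege1.
  move=> /(ler_wpM2l (exprn_ge0 (size T) c0)); rewrite mulr1; apply: le_trans.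
  apply: ler_weXn2l => //; rewrite -size_filter; apply: uniq_leq_size.
    exact: filter_uniq.
  by move=> x; rewrite mem_filter !inE => /andP[/eqP -> _].
apply: le_trans ct; apply: ler_pM; rewrite ?exprn_ge0 ?cgen_ge0//.
  exact: ler_weXn2l.
apply: le_trans (_ : Exp q L' (fun O => 1 + ((t - 1) * t ^+ K) *
    (ccount O [:: v] Bd)%:R) <= _).
  apply: Exp_le => // O _; rewrite mulrC; apply: bernoulli_exp_le => //.
  exact: leq_trans (count_size _ _) sBd.
rewrite ExpD Exp_cst ExpZ lerD2l mulrC; apply: ler_wpM2r => //.
exact: hE.
Qed.

(** For [t = 1 + e] with [e = 1 / (3 (K + 1))] one has [t ^+ K <= 3 / 2], so the second factor is at
    most [1 + 3 e / 4]. The margin [e / 4] that is left under [t] is spent on [c ^+ k], by means of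
    the reversed Bernoulli inequality [inv_ge]. *)
Lemma exists_exp_constants (k K : nat) : exists c t,
  [/\ 1 < c, 1 <= t & c ^+ k * (1 + 2^-1 * ((t - 1) * t ^+ K)) <= t].
Proof.
have inv_ge (x : R) m : 0 <= x -> x * m%:R < 1 -> (1 + x) ^+ m * (1 - x * m%:R) <= 1.
  move=> x0; elim: m => [|m IH] xm; first by rewrite expr0 mulr0; lra.
  have m0 : 0 <= m%:R :> R by [].
  move: xm; rewrite -natr1 => xm.
  have xm' : x * m%:R < 1 by nra.
  have := IH xm'; apply: le_trans.
  rewrite exprSr -mulrA; apply: ler_wpM2l; first by apply: exprn_ge0; lra.
  have : 0 <= x * x * m%:R by rewrite !mulr_ge0.
  by nra.
pose e : R := (3 * K.+1%:R)^-1.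
have K0 : 0 < K.+1%:R :> R by [].
have e0 : 0 < e by rewrite invr_gt0 mulr_gt0.
have eK : e * K%:R <= 3^-1.
  rewrite /e invfM -mulrA -[leRHS]mulr1; apply: ler_wpM2l; first by lra.
  by rewrite mulrC ler_pdivrMr// mul1r ler_nat.
have tK : (1 + e) ^+ K <= 3 / 2.
  have h : (1 + e) ^+ K * (1 - e * K%:R) <= 1 by apply: inv_ge; lra.
  have : 0 <= (1 + e) ^+ K by apply: exprn_ge0; lra.
  by nra.
pose x : R := e / 4 / (1 + e) / k.+1%:R.
have k0 : 0 < k.+1%:R :> R by [].
have x0 : 0 < x by rewrite /x !divr_gt0//; lra.
have xk : x * k%:R <= e / 4 / (1 + e).
  rewrite /x -[leRHS]mulr1 -[leLHS]mulrA; apply: ler_wpM2l.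
    by rewrite !divr_ge0; lra.
  by rewrite mulrC ler_pdivrMr// mul1r ler_nat.
have e4 : e / 4 / (1 + e) * (1 + e) = e / 4 by rewrite divfK//; lra.
have e41 : e / 4 / (1 + e) < 1 by rewrite ltr_pdivrMr; lra.
exists (1 + x), (1 + e); split; [lra|lra|].
have h : (1 + x) ^+ k * (1 - x * k%:R) <= 1 by apply: inv_ge; lra.
have c0 : 0 <= (1 + x) ^+ k by apply: exprn_ge0; lra.
set c := (1 + x) ^+ k in h c0 *; set T := (1 + e) ^+ K in tK *.
set y := e / 4 / (1 + e) in xk e4 e41.
have h2 : c * (1 - y) <= 1.
  apply: le_trans h; apply: ler_wpM2l => //; lra.
have h3 : c * ((1 - y) * (1 + e)) <= 1 + e.
  by rewrite mulrA -[leRHS]mul1r; apply: ler_wpM2r => //; lra.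
apply: le_trans h3; apply: ler_wpM2l => //.
have : e * T <= e * (3 / 2) by apply: ler_wpM2l => //; lra.
have -> : 1 + e - 1 = e by ring.
lra.
Qed.

End exploration.

(** * Counting on countable vertex sets *)

Section counting_lemmas.
Context {R : realType}.
Local Open Scope ereal_scope.

Lemma counting_seq (V : choiceType) (s : seq V) (A : set V) :
  (forall x, A x <-> x \in s) -> counting A = (size (undup s))%:R%:E :> \bar R.
Proof.
move=> As; have fs : finite_set A.
  by apply/finite_seqP; exists s; apply/seteqP; split=> x /As.
rewrite /counting asboolT//; congr (_%:R%:E).
have -> : fset_set A = [fset x in s]%fset.
  apply/fsetP => x; rewrite in_fset_set// !inE.
  by apply/idP/idP => /[!inE] /As.
by rewrite card_fseq.
Qed.

Lemma counting_image (V V' : choiceType) (f : V -> V') (A : set V) :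
  injective f -> counting (f @` A) = counting A :> \bar R.
Proof.
move=> finj; rewrite /counting.
have eqf : finite_set (f @` A) <-> finite_set A.
  split; last exact: finite_image.
  move=> /(@finite_preimage _ _ _ f) fA.
  apply: sub_finite_set (fA _); last by move=> x y _ _ /finj.
  by move=> x Ax; exists x.
case: (pselect (finite_set A)) => fA; last by rewrite !asboolF// => /eqf.
have fA' : finite_set (f @` A) by exact: finite_image.
rewrite !asboolT// fset_set_image// card_imfset//.
Qed.

Lemma counting_le (V : choiceType) (A B : set V) :
  A `<=` B -> counting A <= counting B :> \bar R.
Proof.
move=> AB; rewrite /counting; case: (pselect (finite_set B)) => fB; last first.
  by rewrite (asboolF fB) leey.
have fA := sub_finite_set AB fB.
by rewrite !asboolT// lee_fin ler_nat fsubset_leq_card// -fset_set_sub.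
Qed.

Lemma counting_ge0 (V : choiceType) (A : set V) : 0 <= counting A :> \bar R.
Proof. by rewrite /counting; case: ifPn; rewrite ?lee_fin// lee_pinfty. Qed.

Lemma counting_nneseries (V : choiceType) (e : nat -> V) (A : set V) :
  bijective e -> counting A = \sum_(k <oo) (\1_A (e k))%:E :> \bar R.
Proof.
case=> g eK gK.
have AE : A = e @` (e @^-1` A).
  by apply/seteqP; split=> [x Ax|_ [x Ax <-]]//; exists (g x); rewrite /= gK.
rewrite {1}AE counting_image; last exact: can_inj eK.
rewrite counting_dirac; apply: eq_eseriesr => k _.
rewrite diracE indicE; congr ((nat_of_bool _)%:R%:E).
Qed.

Lemma countingU (V : choiceType) (A B : set V) (e : nat -> V) : bijective e ->
  A `&` B = set0 -> counting (A `|` B) = counting A + counting B :> \bar R.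
Proof.
move=> eb AB; rewrite !(counting_nneseries _ eb).
rewrite -nneseriesD; try by move=> *; rewrite lee_fin.
apply: eq_eseriesr => k _; rewrite -EFinD !indicE in_setU; congr (_%:E).
have [kA|_] := boolP (e k \in A); last by rewrite add0r.
have [kB|_] := boolP (e k \in B); last by rewrite addr0.
move: kA kB; rewrite !inE => kA kB.
by have : (A `&` B) (e k) by []; rewrite AB.
Qed.

Lemma counting_ge (V : choiceType) (A : set V) (K : nat) :
  K%:R%:E <= counting A :> \bar R ->
  exists2 s : seq V, uniq s /\ size s = K & (forall x, x \in s -> A x).
Proof.
suff main : K%:R%:E <= counting A :> \bar R ->
    exists2 B : {fset V}, (forall x, x \in B -> A x) & (K <= #|` B|)%N.
  move=> /main[B BA KB].
  exists (take K B); last by move=> x /mem_take /BA.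
  by split; [rewrite take_uniq | rewrite size_takel].
rewrite /counting; case: (pselect (finite_set A)) => fA; last first.
  by move=> _; have [B BA KB] := (infinite_set_fsetP A).1 fA K; exists B.
rewrite asboolT// lee_fin ler_nat => KA; exists (fset_set A) => // x.
by rewrite in_fset_set// inE.
Qed.

End counting_lemmas.

Section enumeration.
Context {V : choiceType} {adj : rel V}.
Hypotheses (V_infinite : infinite_set [set: V])
  (G_connected : connected_graph adj) (G_bounded : bounded_degrees adj).

(** The lists [b n] cover the balls around [a], whence countability. The enumeration serves to
    exhaust the graph by finite boxes and to write cardinals as series. *)
Lemma exists_enumeration : exists e : nat -> V, bijective e.
Proof.
have [a _] := infinite_setN0 V_infinite.
have [D hD] := G_bounded.
pose nxt (s : seq V) := s ++ flatten [seq (fset_set (neighbours adj x) : seq V) | x <- s].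
pose b n := iter n nxt [:: a].
have hb y : exists n, y \in b n.
  have [s ps <-] := G_connected a y.
  elim/last_ind: s ps => [|s z IH]; first by exists 0%N; rewrite inE.
  rewrite rcons_path last_rcons => /andP[/IH[n nb] az].
  exists n.+1; rewrite /b iterS mem_cat; apply/orP; right.
  apply/flattenP; exists (fset_set (neighbours adj (last a s)) : seq V).
    exact: map_f.
  by rewrite in_fset_set ?inE//; exact: (hD _).1.
have cV : countable [set: V].
  have -> : [set: V] = \bigcup_(n in [set: nat]) [set x | x \in b n].
    by apply/seteqP; split=> // x _; have [n nb] := hb x; exists n.
  apply: bigcup_countable => // n _.
  by apply: finite_set_countable; apply/finite_seqP; exists (b n).
have /card_bijP[f fb] : ([set: nat] #= [set: V])%card.
  by rewrite card_eq_le (infiniteP _).1.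
exists (fun n => val (f (SigSub (mem_set (I : [set: nat] n))))).
have [g fK gK] := fb.
exists (fun x => val (g (SigSub (mem_set (I : [set: V] x))))) => x.
  by set y := SigSub _; have -> : y = f (SigSub (mem_set (I : [set: nat] x)));
    [exact: val_inj | rewrite fK].
by set y := SigSub _; have -> : y = g (SigSub (mem_set (I : [set: V] x)));
  [exact: val_inj | rewrite gK].
Qed.

End enumeration.

(** * Bernoulli percolation *)

Lemma fset2_inj (V : choiceType) (a b c d : V) :
  [fset a; b]%fset = [fset c; d]%fset -> (a = c /\ b = d) \/ (a = d /\ b = c).
Proof.
move=> h.
have ha : a \in [fset c; d]%fset by rewrite -h !inE eqxx.
have hb : b \in [fset c; d]%fset by rewrite -h !inE eqxx orbT.
have hc : c \in [fset a; b]%fset by rewrite h !inE eqxx.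
have hd : d \in [fset a; b]%fset by rewrite h !inE eqxx orbT.
move: ha hb hc hd; rewrite !inE.
move=> /orP[]/eqP ha /orP[]/eqP hb /orP[]/eqP hc /orP[]/eqP hd; subst; tauto.
Qed.

Definition cluster_of {V : choiceType} (adj : rel V) {dX : measure_display}
    {X : measurableType dX} (omega : X -> {fset V} -> bool) (w : X) (s : seq V) : set V :=
  [set y | reach (open_adj adj omega w) s y].

(** Increasing properties of a cluster that hold in some finite box as soon as they hold at all.
    Their probabilities are increasing limits of the finite expectations [Exp]. *)
Definition finitary {V : Type} (Q : (V -> Prop) -> Prop) : Prop :=
  (forall A B : V -> Prop, (forall y, A y -> B y) -> Q A -> Q B) /\
  (forall A : nat -> V -> Prop, (forall n m y, (n <= m)%N -> A n y -> A m y) ->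
     Q (fun y => exists n, A n y) -> exists n, Q (A n)).

Section boxes.
Context {V : choiceType} (adj : rel V) (e : nat -> V).

Definition box n : seq V := [seq e k | k <- iota 0 n].

Definition box_edges n : seq {fset V} :=
  undup [seq [fset z.1; z.2]%fset | z <- [seq z <- allpairs pair (box n) (box n)
                                              | adj z.1 z.2]].

Lemma box_edgesP n b : reflect
  (exists x y, [/\ x \in box n, y \in box n, adj x y & b = [fset x; y]%fset])
  (b \in box_edges n).
Proof.
rewrite mem_undup; apply: (iffP mapP) => [[[x y]]|[x [y [xn yn xy ->]]]].
  rewrite mem_filter => /andP[/= xy /allpairsP[[x' y'] [/= xn yn [ex ey]]]] ->.
  by exists x, y; split; rewrite ?ex ?ey// -ex -ey.
exists (x, y) => //; rewrite mem_filter/= xy; apply/allpairsP.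
by exists (x, y).
Qed.

End boxes.

Section percolation_law.
Context {R : realType} {V : choiceType} {adj : rel V}.
Context {dX : measure_display} {X : measurableType dX}.
Context {omega : X -> {fset V} -> bool} {q : R} {P : probability X R}.
Hypothesis perc : is_bernoulli_percolation adj omega q P.

Lemma measurable_open b : is_edge adj b ->
  measurable_fun setT (fun w => omega w b).
Proof.
move=> /perc.1 mb; apply: (@measurable_fun_bool _ _ _ _ true).
by rewrite setTI.
Qed.

Lemma measurable_open_edges d (T : measurableType d) (F : seq {fset V} -> T) L :
  (forall b, b \in L -> is_edge adj b) ->
  measurable_fun setT (fun w => F [seq b <- L | omega w b]).
Proof.
elim: L F => [|b L IH] F hL /=; first exact: measurable_cst.
have hL' c : c \in L -> is_edge adj c by move=> cL; apply: hL; rewrite inE cL orbT.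
rewrite (_ : (fun w => _) = (fun w => if omega w b
  then (fun O => F (b :: O)) [seq b <- L | omega w b]
  else F [seq b <- L | omega w b])).
  apply: measurable_fun_ifT; 
    [|exact: (IH (fun O => F (b :: O)) hL')|exact: IH].
  by apply: measurable_open; apply: hL; rewrite inE eqxx.
by apply/funext => w; case: ifP.
Qed.

Definition opened (A B : {fset {fset V}}) : set X :=
  [set w | (forall b, b \in A -> omega w b) /\ (forall b, b \in B -> ~~ omega w b)].

Lemma openedU1l b A B :
  opened (b |` A)%fset B = opened A B `&` [set w | omega w b].
Proof.
apply/seteqP; split=> [w [hA hB]|w [[hA hB] wb]] /=.
  split; last by apply: hA; rewrite !inE eqxx.
  by split=> // c cA; apply: hA; rewrite !inE cA orbT.
by split=> // c; rewrite !inE => /orP[/eqP ->//|/hA].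
Qed.

Lemma openedU1r b A B :
  opened A (b |` B)%fset = opened A B `&` [set w | ~~ omega w b].
Proof.
apply/seteqP; split=> [w [hA hB]|w [[hA hB] wb]] /=.
  split; last by apply: hB; rewrite !inE eqxx.
  by split=> // c cB; apply: hB; rewrite !inE cB orbT.
by split=> // c; rewrite !inE => /orP[/eqP ->//|/hB].
Qed.

Lemma measurable_opened A B : (forall b, b \in A -> is_edge adj b) ->
  (forall b, b \in B -> is_edge adj b) -> measurable (opened A B).
Proof.
move=> hA hB.
rewrite (_ : opened A B = (\bigcap_(b in [set` A]) [set w | omega w b]) `&`
   (\bigcap_(b in [set` B]) ~` [set w | omega w b])).
  apply: measurableI; apply: fin_bigcap_measurable => // b bA.
    exact/perc.1/hA.
  exact/measurableC/perc.1/hB.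
apply/seteqP; split=> w [h1 h2]; split=> b /=; first exact: h1.
- by move=> /h2/negP.
- exact: h1.
- by move=> /h2/negP.
Qed.

(** The accumulators [A] and [B] hold the edges already declared open and closed. They let the
    induction on [L] end at the cylinder probabilities that the hypothesis prescribes. *)
Lemma integral_opened L A B (F : seq {fset V} -> R) :
  uniq L -> (forall b, b \in L -> is_edge adj b) ->
  (forall b, b \in A -> is_edge adj b) ->
  (forall b, b \in B -> is_edge adj b) ->
  [disjoint A & B]%fset -> (forall b, b \in L -> b \notin A /\ b \notin B) ->
  (forall O, 0 <= F O) ->
  (\int[P]_(w in opened A B) (F [seq b <- L | omega w b])%:E =
   (q ^+ #|` A| * (1 - q) ^+ #|` B| * Exp q L F)%:E)%E.
Proof.
elim: L A B F => [|b L IH] A B F uL hL hA hB dAB dL F0 /=.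
  transitivity ((F [::])%:E * P (opened A B))%E.
    exact: (integral_cst P (measurable_opened hA hB)).
  have -> : P (opened A B) = (q ^+ #|` A|%fset * (1 - q) ^+ #|` B|%fset)%:E.
    exact: (perc.2 A B hA hB dAB).
  by rewrite -EFinM mulrC.
have [bA bB] : b \notin A /\ b \notin B by apply: dL; rewrite inE eqxx.
have eb : is_edge adj b by apply: hL; rewrite inE eqxx.
have /andP[bL uL'] := uL.
have hL' c : c \in L -> is_edge adj c by move=> cL; apply: hL; rewrite inE cL orbT.
have hA' c : c \in (b |` A)%fset -> is_edge adj c.
  by rewrite !inE => /orP[/eqP ->//|/hA].
have hB' c : c \in (b |` B)%fset -> is_edge adj c.
  by rewrite !inE => /orP[/eqP ->//|/hB].
have -> : opened A B = opened (b |` A)%fset B `|` opened A (b |` B)%fset.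
  rewrite openedU1l openedU1r -setIUr -[LHS]setIT; congr (_ `&` _).
  by apply/seteqP; split=> // w _ /=; case: (omega w b); [left|right].
rewrite ge0_integral_setU//=.
- rewrite (@eq_integral _ _ _ P (opened (b |` A)%fset B)
    (fun w => (F (b :: [seq b <- L | omega w b]))%:E)); last first.
    by move=> w; rewrite inE openedU1l => -[_ /= ->].
  rewrite [X in (_ + X)%E](@eq_integral _ _ _ P (opened A (b |` B)%fset)
    (fun w => (F [seq b <- L | omega w b])%:E)); last first.
    by move=> w; rewrite inE openedU1r => -[_ /= /negbTE ->].
  rewrite (IH _ _ (fun O => F (b :: O)))//; last 2 first.
  + apply/fdisjointP => c; rewrite !inE => /orP[/eqP ->//|cA].
    by move/fdisjointP : dAB; apply.
  + move=> c cL; have [cA cB] : c \notin A /\ c \notin B.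
      by apply: dL; rewrite inE cL orbT.
    by rewrite !inE (negbTE cA) orbF; split=> //; apply: contraNneq bL => <-.
  rewrite IH//; last 2 first.
  + rewrite fdisjoint_sym; apply/fdisjointP => c.
    rewrite !inE => /orP[/eqP ->//|cB].
    by move: dAB; rewrite fdisjoint_sym => /fdisjointP; apply.
  + move=> c cL; have [cA cB] : c \notin A /\ c \notin B.
      by apply: dL; rewrite inE cL orbT.
    by rewrite !inE (negbTE cB) orbF; split=> //; apply: contraNneq bL => <-.
  rewrite !cardfsU1 bA bB -EFinD !exprS; congr (_%:E).
  ring.
- exact: measurable_opened.
- exact: measurable_opened.
- apply: measurable_funTS.
  exact: (@measurable_open_edges _ _ (fun O => (F O)%:E) (b :: L)).
- by move=> w _; rewrite lee_fin.
- apply/eqP/seteqP; split=> // w [].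
  rewrite openedU1l openedU1r => -[_ /= wb] [_ /=]; by rewrite wb.
Qed.

Lemma integral_open_edges L (F : seq {fset V} -> R) :
  uniq L -> (forall b, b \in L -> is_edge adj b) -> (forall O, 0 <= F O) ->
  (\int[P]_w (F [seq b <- L | omega w b])%:E = (Exp q L F)%:E)%E.
Proof.
move=> uL hL F0.
have H b : b \in (fset0 : {fset {fset V}}) -> is_edge adj b by rewrite inE.
have H' b : b \in L ->
    b \notin (fset0 : {fset {fset V}}) /\ b \notin (fset0 : {fset {fset V}}).
  by rewrite inE.
have <- : opened fset0 fset0 = setT.
  by apply/seteqP; split=> // w _; split=> b; rewrite inE.
rewrite (integral_opened uL hL H H (fdisjoint0X _) H' F0).
by rewrite cardfs0 !expr0 !mul1r.
Qed.

End percolation_law.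

Section percolation_limit.
Context {R : realType} {V : choiceType} {adj : rel V}.
Context {dX : measure_display} {X : measurableType dX}.
Context {omega : X -> {fset V} -> bool} {q : R} {P : probability X R}.
Hypotheses (adj_sym : symmetric adj)
  (perc : is_bernoulli_percolation adj omega q P).
Context {e : nat -> V}.
Hypothesis e_bij : bijective e.
Local Notation E n := (box_edges adj e n).
Local Notation opn w n := [seq b <- E n | omega w b].
Local Notation C := (cluster_of adj omega).

Lemma mem_box k n : (k < n)%N -> e k \in box e n.
Proof. by move=> kn; apply: map_f; rewrite mem_iota. Qed.

Lemma box_uniq n : uniq (box e n).
Proof. by rewrite map_inj_uniq ?iota_uniq//; exact: bij_inj. Qed.

Lemma box_mono n m : (n <= m)%N -> {subset box e n <= box e m}.
Proof.
move=> nm x /mapP[k]; rewrite mem_iota => /andP[_ kn] ->.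
by apply: mem_box; apply: leq_trans nm.
Qed.

Lemma box_cover x : exists n, x \in box e n.
Proof.
by have [g eK gK] := e_bij; exists (g x).+1; rewrite -{1}(gK x) mem_box.
Qed.

Lemma box_edges_mono n m : (n <= m)%N -> {subset E n <= E m}.
Proof.
move=> nm b /box_edgesP[x [y [xn yn xy ->]]]; apply/box_edgesP.
by exists x, y; split=> //; exact: (box_mono nm).
Qed.

Lemma box_edges_adj n a b : [fset a; b]%fset \in E n -> adj a b.
Proof.
by move=> /box_edgesP[x [y [_ _ xy /fset2_inj[[-> ->]//|[-> ->]]]]]; rewrite adj_sym.
Qed.

Lemma box_edges_is_edge n b : b \in E n -> is_edge adj b.
Proof. by move=> /box_edgesP[x [y [_ _ xy ->]]]; exists x, y. Qed.

Lemma erel_opn_mono w n m a b : (n <= m)%N ->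
  erel (opn w n) a b -> erel (opn w m) a b.
Proof.
by move=> nm; rewrite /erel !mem_filter => /andP[-> /(box_edges_mono nm)].
Qed.

Lemma reach_opn w s : C w s = (fun y => exists n, reach (erel (opn w n)) s y).
Proof.
apply/seteqP; split=> y.
  elim=> [x xs|a b _ [n na] /andP[ab wab]]; first by exists 0%N; apply: reach_mem.
  have [i ai] := box_cover a; have [j bj] := box_cover b.
  pose m := maxn n (maxn i j); exists m.
  apply: (@reach_step _ _ _ a).
    by apply: reach_mono na => // c d; apply: erel_opn_mono; exact: leq_maxl.
  rewrite /erel mem_filter wab; apply/box_edgesP; exists a, b; split=> //.
    by apply: box_mono ai; rewrite /m !leq_max leqnn orbT.
  by apply: box_mono bj; rewrite /m !leq_max leqnn !orbT.
move=> [n]; apply: reach_mono => // a b.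
by rewrite /erel mem_filter => /andP[wab /box_edges_adj ab]; rewrite /open_adj ab.
Qed.

Lemma reach_opn_mono w s n m y : (n <= m)%N ->
  reach (erel (opn w n)) s y -> reach (erel (opn w m)) s y.
Proof. by move=> nm; apply: reach_mono => // a b; apply: erel_opn_mono. Qed.

Lemma event_opn_measurable (G : seq {fset V} -> bool) n :
  measurable [set w | G (opn w n)].
Proof.
rewrite -[X in measurable X]setTI.
have mG := measurable_open_edges perc G (@box_edges_is_edge n).
exact: (mG measurableT [set true]).
Qed.

Lemma event_opn (G : seq {fset V} -> bool) n :
  (P [set w | G (opn w n)] = (Exp q (E n) (fun O => (G O)%:R))%:E)%E.
Proof.
rewrite -(integral_open_edges perc _ (@box_edges_is_edge n))//; last first.
  exact: undup_uniq.
rewrite -[X in P X]setIT -integral_indic//; last exact: event_opn_measurable.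
by apply: eq_integral => w _; rewrite indicE mem_setE.
Qed.

(** A cluster is the increasing union of its restrictions to boxes. Besides measurability, this
    expresses the probability through [q] and the graph alone, which yields uniqueness of the law
    and hence invariance under automorphisms. *)
Lemma finitary_event Q s : finitary Q ->
  measurable [set w | Q (C w s)] /\
  (Exp q (E n) (fun O => (`[< Q (reach (erel O) s) >])%:R))%:E @[n --> \oo] -->
    P [set w | Q (C w s)].
Proof.
move=> [Qmono Qfin].
pose F n := [set w | `[< Q (reach (erel (opn w n)) s) >]].
have FU : [set w | Q (C w s)] = \bigcup_n F n.
  apply/seteqP; split=> w /=.
    rewrite reach_opn => /(Qfin (fun n => reach (erel (opn w n)) s))[|n Qn].
      by move=> n m y; exact: reach_opn_mono.
    by exists n => //; apply/asboolP.
  move=> [n _ /asboolP]; apply: Qmono => y ny.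
  by rewrite reach_opn; exists n.
have mF n : measurable (F n).
  exact: (event_opn_measurable (fun O => `[< Q (reach (erel O) s) >])).
have mU : measurable (\bigcup_n F n) by exact: bigcupT_measurable.
split; first by rewrite FU.
rewrite FU; have := @nondecreasing_cvg_mu _ _ _ P F mF mU.
have FE : P \o F = (fun n => (Exp q (E n)
    (fun O => (`[< Q (reach (erel O) s) >])%:R))%:E).
  by apply/funext => n; rewrite /= -event_opn.
rewrite FE; apply => n m nm; apply/subsetPset => w /asboolP Qn; apply/asboolP.
by apply: Qmono Qn => y; exact: reach_opn_mono.
Qed.

Lemma finitary_mem (y : V) : finitary (fun A => A y).
Proof. by split=> [A B|A _ //]; exact. Qed.

(** The event that a connected cluster avoids [s] is not increasing, but it is a difference of two
    finitary events; this is the subtracted one. *)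
Lemma finitary_mem2 (y : V) (s : seq V) :
  finitary (fun A => A y /\ exists2 z, z \in s & A z).
Proof.
split=> [A B AB [Ay [z zs Az]]|A Amono [[n An] [z zs [m Am]]]].
  by split; [exact: AB|exists z => //; exact: AB].
exists (maxn n m); split; first by apply: Amono An; rewrite leq_maxl.
by exists z => //; apply: Amono Am; rewrite leq_maxr.
Qed.

Lemma measurable_reach s y : measurable [set w | C w s y].
Proof. exact: (finitary_event s (finitary_mem y)).1. Qed.

Lemma measurable_counting s :
  measurable_fun setT (fun w => counting (C w s) : \bar R).
Proof.
rewrite (_ : (fun w => _) = (fun w => \sum_(k <oo) (\1_(C w s) (e k))%:E)%E).
  apply: ge0_emeasurable_sum => [k w _ _|k _]; first by rewrite lee_fin.
  apply/measurable_EFinP.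
  rewrite (_ : (fun w => _) = \1_[set w | C w s (e k)]).
    by apply: measurable_indic; exact: measurable_reach.
  by apply/funext => w; rewrite !indicE.
by apply/funext => w; rewrite (counting_nneseries _ e_bij).
Qed.

Lemma integral_counting s :
  (\int[P]_w counting (C w s) = \sum_(k <oo) P [set w | C w s (e k)])%E.
Proof.
transitivity (\int[P]_w \sum_(k <oo) (\1_[set w | C w s (e k)] w)%:E)%E.
  apply: eq_integral => w _; rewrite (counting_nneseries _ e_bij).
  by apply: eq_eseriesr => k _; rewrite !indicE.
rewrite integral_nneseries//.
- apply: eq_eseriesr => k _; rewrite integral_indic// ?setIT//.
  exact: measurable_reach.
- move=> k; apply/measurable_EFinP; apply: measurable_indic.
  exact: measurable_reach.
Qed.

Lemma counting_opn_le w s n :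
  ((ccount (opn w n) s (box e n))%:R%:E <= counting (C w s) :> \bar R)%E.
Proof.
rewrite /ccount -size_filter.
set l := [seq x <- _ | _].
have ul : uniq l by apply/filter_uniq/box_uniq.
rewrite -(undup_id ul) -(@counting_seq _ _ l [set x | x \in l])//.
apply: counting_le => x /=; rewrite mem_filter => /andP[/asboolP rx _].
by rewrite reach_opn; exists n.
Qed.

Lemma counting_opn_ge w s K : (K%:R%:E <= counting (C w s) :> \bar R)%E ->
  exists n, (K <= ccount (opn w n) s (box e n))%N.
Proof.
move=> /counting_ge[l [ul sl] lC].
suff [n hn] : exists n, forall x, x \in l ->
    x \in box e n /\ reach (erel (opn w n)) s x.
  exists n; rewrite -sl /ccount -size_filter; apply: uniq_leq_size => // x xl.
  by have [xn rx] := hn x xl; rewrite mem_filter xn andbT; apply/asboolP.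
move: lC; clear ul sl; elim: l => [|x l IH] lC; first by exists 0%N.
have [n hn] : exists n, forall x, x \in l ->
    x \in box e n /\ reach (erel (opn w n)) s x.
  by apply: IH => z zl; apply: lC; rewrite inE zl orbT.
have [i xi] := box_cover x.
have : C w s x by apply: lC; rewrite inE eqxx.
rewrite reach_opn => -[j xj].
exists (maxn n (maxn i j)) => z; rewrite inE => /predU1P[->|/hn[zn rz]]; split.
- by apply: box_mono xi; rewrite !leq_max leqnn orbT.
- by apply: reach_opn_mono xj; rewrite !leq_max leqnn !orbT.
- by apply: box_mono zn; rewrite leq_maxl.
- by apply: reach_opn_mono rz; rewrite leq_maxl.
Qed.

Lemma ccount_opn_mono w s n m : (n <= m)%N ->
  (ccount (opn w n) s (box e n) <= ccount (opn w m) s (box e m))%N.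
Proof.
move=> nm; rewrite /ccount -!size_filter; apply: uniq_leq_size.
  exact/filter_uniq/box_uniq.
move=> x; rewrite !mem_filter => /andP[/asboolP rx /(box_mono nm) ->].
by rewrite andbT; apply/asboolP; exact: reach_opn_mono rx.
Qed.

Lemma integral_expeR_counting_le (theta t : R) s : 0 <= theta ->
  (forall n, cgen q (expR theta) (box e n) (E n) s <= t) ->
  (\int[P]_w expeR (theta%:E * counting (C w s)) <= t%:E)%E.
Proof.
move=> th0 ht.
pose c := expR theta.
have c1 : 1 <= c by rewrite -expR0 ler_expR.
pose f n w : \bar R := (c ^+ ccount (opn w n) s (box e n))%:E.
have mf n : measurable_fun setT (f n).
  exact: (measurable_open_edges perc
    (fun O => (c ^+ ccount O s (box e n))%:E) (@box_edges_is_edge n)).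
have f0 n w : setT w -> (0 <= f n w)%E.
  by rewrite lee_fin exprn_ge0// (le_trans _ c1).
have fmono w : setT w -> nondecreasing_seq (f^~ w).
  by move=> _ n m nm; rewrite lee_fin ler_weXn2l// ccount_opn_mono.
have fle n : (\int[P]_w f n w <= t%:E)%E.
  rewrite (integral_open_edges perc _ (@box_edges_is_edge n)
    (F := fun O => c ^+ ccount O s (box e n))).
  - by rewrite lee_fin; exact: ht.
  - exact: undup_uniq.
  - by move=> O; rewrite exprn_ge0// (le_trans _ c1).
have expE k : expeR (theta%:E * k%:R%:E) = (c ^+ k)%:E.
  by rewrite -EFinM /= expRM_natr.
have eqf w : expeR (theta%:E * counting (C w s)) = limn (f^~ w).
  have fsup := ereal_nondecreasing_cvgn (fmono w I).
  rewrite (cvg_lim _ fsup)//; apply/eqP; rewrite eq_le; apply/andP; split.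
    have fin K : counting (C w s) = K%:R%:E :> \bar R ->
        (expeR (theta%:E * counting (C w s)) <= ereal_sup (range (f^~ w)))%E.
      move=> NK; have [|n Kn] := @counting_opn_ge w s K; first by rewrite NK.
      apply: (@le_trans _ _ (f n w)); last by apply: ereal_sup_ubound; exists n.
      by rewrite NK expE lee_fin ler_weXn2l.
    have [N|N] := pselect (finite_set (C w s)).
      by apply: fin; rewrite /counting asboolT.
    have Ny : counting (C w s) = +oo%E :> \bar R by rewrite /counting asboolF.
    have fK K : ((c ^+ K)%:E <= ereal_sup (range (f^~ w)))%E.
      have [|n Kn] := @counting_opn_ge w s K; first by rewrite Ny leey.
      apply: (@le_trans _ _ (f n w)); last by apply: ereal_sup_ubound; exists n.
      by rewrite lee_fin ler_weXn2l.
    (* For an infinite cluster [theta = 0] is special, since [0 * +oo = 0]; for positive [theta] the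
       finite-volume values diverge. *)
    have [thE|thN] := eqVneq theta 0.
      by rewrite thE mul0e expeR0; apply: le_trans (fK 0%N); rewrite expr0.
    have {thN} th1 : 0 < theta by rewrite lt_def thN.
    suff -> : ereal_sup (range (f^~ w)) = +oo%E by rewrite leey.
    apply/eqyP => A _; apply: le_trans (fK (Num.bound (A / theta))).
    rewrite lee_fin -expRM_natl; apply: le_trans (expR_ge1Dx _).
    apply: le_trans (_ : A <= theta * (Num.bound (A / theta))%:R) _.
      by rewrite mulrC -ler_pdivrMr// ltW// unstable.ltr_bound.
    by rewrite mulrC ler_wpDl.
  apply: ge_ereal_sup => _ [n _ <-]; rewrite /f -expE lee_expeR.
  by apply: lee_wpmul2l; [rewrite lee_fin|exact: counting_opn_le].
rewrite (eq_integral (fun w => limn (f^~ w))); last by move=> w _.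
have /cvg_lim <-// :=
  @cvg_monotone_convergence _ _ _ P _ measurableT f mf f0 fmono.
apply: lime_le; last exact: nearW.
apply: ereal_nondecreasing_is_cvgn => n m nm.
by apply: ge0_le_integral => // w _; [exact: f0|exact: fmono].
Qed.

End percolation_limit.

Section automorphisms.
Context {R : realType} {V : choiceType} {adj : rel V}.
Context {dX : measure_display} {X : measurableType dX}.
Context {omega : X -> {fset V} -> bool} {q : R} {P : probability X R}.
Hypotheses (adj_sym : symmetric adj)
  (perc : is_bernoulli_percolation adj omega q P).
Context {e : nat -> V}.
Hypothesis e_bij : bijective e.

Lemma finitary_event_unique dX' (X' : measurableType dX')
    (omega' : X' -> {fset V} -> bool) (P' : probability X' R) Q s :
  is_bernoulli_percolation adj omega' q P' -> finitary Q ->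
  P [set w | Q (cluster_of adj omega w s)] =
  P' [set w | Q (cluster_of adj omega' w s)].
Proof.
move=> perc' fQ.
have [_ h] := finitary_event adj_sym perc e_bij s fQ.
have [_ h'] := finitary_event adj_sym perc' e_bij s fQ.
by rewrite -(cvg_lim _ h)// -(cvg_lim _ h').
Qed.

Context {f : V -> V}.
Hypothesis f_aut : graph_isomorphism adj adj f.

(** The configuration seen through the automorphism [f]: it has the same law, and [f] carries its
    clusters onto those of [omega]. Invariance thus reduces to uniqueness of the law. *)
Definition moved (w : X) (b : {fset V}) : bool := omega w (f @` b)%fset.

Let f_inj : injective f. Proof. exact: bij_inj f_aut.1. Qed.

Lemma imfset_pair a b : (f @` [fset a; b])%fset = [fset f a; f b]%fset.
Proof.
apply/fsetP => x; rewrite !inE; apply/imfsetP/orP.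
  by move=> [y /=]; rewrite !inE => /orP[]/eqP -> ->; rewrite eqxx; [left|right].
by move=> []/eqP ->; [exists a|exists b]; rewrite //= !inE eqxx ?orbT.
Qed.

Lemma imfset_inj : injective (fun b : {fset V} => (f @` b)%fset).
Proof.
move=> A B /fsetP AB; apply/fsetP => x; have := AB (f x).
by rewrite !mem_imfset.
Qed.

Lemma moved_percolation : is_bernoulli_percolation adj moved q P.
Proof.
have fe b : is_edge adj b -> is_edge adj (f @` b)%fset.
  move=> [x [y [xy ->]]]; exists (f x), (f y).
  by rewrite imfset_pair f_aut.2.
split=> [b /fe|A B hA hB dAB]; first exact: perc.1.
pose F (b : {fset V}) := (f @` b)%fset.
have hF (D : {fset {fset V}}) : (forall b, b \in D -> is_edge adj b) ->
    forall b, b \in (F @` D)%fset -> is_edge adj b.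
  by move=> hD _ /imfsetP[b /= /hD/fe eb ->].
have dF : [disjoint F @` A & F @` B]%fset.
  apply/fdisjointP => _ /imfsetP[b /= bA ->]; apply/negP.
  move=> /imfsetP[c /= cB /imfset_inj bc].
  by move/fdisjointP : dAB => /(_ _ bA); rewrite bc cB.
have := perc.2 _ _ (hF A hA) (hF B hB) dF.
rewrite !(card_imfset _ _ imfset_inj) => <-; congr (P _).
apply/seteqP; split=> w [h1 h2]; split=> b.
- by move=> /imfsetP[c /= /h1 cA ->].
- by move=> /imfsetP[c /= /h2 cB ->].
- by move=> bA; apply: h1; apply/imfsetP; exists b.
- by move=> bB; apply: h2; apply/imfsetP; exists b.
Qed.

Lemma moved_adj w a b : open_adj adj moved w a b = open_adj adj omega w (f a) (f b).
Proof. by rewrite /open_adj /moved imfset_pair f_aut.2. Qed.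

Lemma cluster_moved w s y :
  cluster_of adj moved w s y <-> cluster_of adj omega w (map f s) (f y).
Proof.
split.
  elim=> [x xs|a b _ ra]; first by apply: reach_mem; exact: map_f.
  by rewrite moved_adj; apply: reach_step.
have [g fK gK] := f_aut.1.
suff main z : cluster_of adj omega w (map f s) z -> cluster_of adj moved w s (g z).
  by move=> /main; rewrite fK.
elim=> [_ /mapP[x xs ->]|a b _ ra ab]; first by rewrite fK; apply: reach_mem.
by apply: reach_step ra _; rewrite moved_adj !gK.
Qed.

Lemma counting_moved w s :
  counting (cluster_of adj moved w s) =
  counting (cluster_of adj omega w (map f s)) :> \bar R.
Proof.
rewrite -(counting_image _ f_inj); congr counting; apply/seteqP; split=> y.
  by move=> [x /cluster_moved ? <-].
have [g fK gK] := f_aut.1.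
by move=> h; exists (g y); rewrite ?gK//; apply/cluster_moved; rewrite gK.
Qed.

Lemma mean_counting_aut s :
  (\int[P]_w counting (cluster_of adj omega w (map f s)) =
   \int[P]_w counting (cluster_of adj omega w s))%E.
Proof.
transitivity (\int[P]_w counting (cluster_of adj moved w s))%E.
  by apply: eq_integral => w _; rewrite counting_moved.
rewrite (integral_counting adj_sym moved_percolation e_bij).
rewrite (integral_counting adj_sym perc e_bij).
apply: eq_eseriesr => k _; apply/esym.
exact: (finitary_event_unique _ moved_percolation (finitary_mem (e k))).
Qed.

Lemma connection_aut x y : P [set w | cluster_of adj omega w [:: f x] (f y)] =
  P [set w | cluster_of adj omega w [:: x] y].
Proof.
rewrite (finitary_event_unique _ moved_percolation (finitary_mem y)).
congr (P _); apply/seteqP; split=> w /= h.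
  exact/(cluster_moved w [:: x] y).
exact/(cluster_moved w [:: x] y).
Qed.

Lemma connection2_aut x y s :
  P [set w | cluster_of adj omega w [:: f x] (f y) /\
     exists2 z, z \in map f s & cluster_of adj omega w [:: f x] z] =
  P [set w | cluster_of adj omega w [:: x] y /\
     exists2 z, z \in s & cluster_of adj omega w [:: x] z].
Proof.
rewrite (finitary_event_unique _ moved_percolation (finitary_mem2 y s)).
congr (P _); apply/seteqP; split=> w /=.
  move=> [xy [_ /mapP[z zs ->] xz]].
  split; first exact/(cluster_moved w [:: x] y).
  by exists z => //; exact/(cluster_moved w [:: x] z).
move=> [xy [z zs xz]]; split; first exact/(cluster_moved w [:: x] y).
by exists (f z); [exact: map_f|exact/(cluster_moved w [:: x] z)].
Qed.

End automorphisms.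

(** * Exponential moments of the cluster size *)

Definition nb {V : choiceType} (adj : rel V) (x : V) : seq V :=
  fset_set (neighbours adj x).

Lemma mem_nb (V : choiceType) (adj : rel V) (x y : V) :
  bounded_degrees adj -> (y \in nb adj x) = adj x y.
Proof.
move=> [D hD]; have [fx _] := hD x; rewrite /nb in_fset_set//.
by rewrite /neighbours mem_setE.
Qed.

Lemma nb_uniq (V : choiceType) (adj : rel V) (x : V) : uniq (nb adj x).
Proof. exact: fset_uniq. Qed.

Lemma ler_sum_uniq_sub {R : realType} {I : eqType} (s t : seq I) (F : I -> R) :
  uniq s -> uniq t -> {subset s <= t} -> (forall i, 0 <= F i) ->
  \sum_(i <- s) F i <= \sum_(i <- t) F i.
Proof.
move=> us ut st F0.
have st' : perm_eq s [seq i <- t | i \in s].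
  apply: uniq_perm => //; first exact: filter_uniq.
  by move=> i; rewrite mem_filter andb_idr// => /st.
rewrite (perm_big _ st') big_filter big_mkcond/=; apply: ler_sum => i _.
by case: ifP.
Qed.

Section exponential_moment.
Context {R : realType} {V : choiceType} {adj : rel V}.
Context {dX : measure_display} {X : measurableType dX}.
Context {omega : X -> {fset V} -> bool} {q : R} {P : probability X R}.
Hypotheses (q0 : 0 <= q) (q1 : q <= 1) (adj_sym : symmetric adj)
  (perc : is_bernoulli_percolation adj omega q P)
  (G_bounded : bounded_degrees adj) (G_transitive : vertex_transitive adj).
Context {e : nat -> V}.
Hypothesis e_bij : bijective e.
Local Notation C := (cluster_of adj omega).

Lemma Exp_reach_le L x y : uniq L -> (forall b, b \in L -> is_edge adj b) ->
  ((Exp q L (fun O => (`[< reach (erel O) [:: x] y >])%:R))%:E <=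
   P [set w | C w [:: x] y])%E.
Proof.
move=> uL hL; rewrite -(integral_open_edges perc uL hL); last first.
  by move=> O; rewrite ler0n.
have mC := measurable_reach adj_sym perc e_bij [:: x] y.
rewrite -[X in (_ <= P X)%E]setIT -integral_indic//.
apply: ge0_le_integral => //.
- exact: (measurable_open_edges perc
    (fun O => ((`[< reach (erel O) [:: x] y >])%:R%:E : \bar R)) hL).
- by apply/measurable_EFinP; apply: measurable_indic.
- move=> w _; rewrite lee_fin indicE ler_nat.
  case: asboolP => // h; rewrite mem_set//=.
  apply: reach_mono h => // a b; rewrite /erel mem_filter => /andP[wab /hL].
  move=> [c [d [cd /fset2_inj[[ec ed]|[ec ed]]]]];
    by rewrite /open_adj wab ec ed ?cd// adj_sym cd.
Qed.

Definition tau x y : R := fine (P [set w | C w [:: x] y]).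

Lemma tauE x y : P [set w | C w [:: x] y] = (tau x y)%:E.
Proof.
rewrite fineK// fin_num_measure//.
exact: (measurable_reach adj_sym perc e_bij).
Qed.

Lemma tau_ge0 x y : 0 <= tau x y.
Proof. by apply: fine_ge0; exact: measure_ge0. Qed.

Lemma tau_aut f x y : graph_isomorphism adj adj f -> tau (f x) (f y) = tau x y.
Proof. by move=> fa; rewrite /tau (connection_aut adj_sym perc e_bij fa). Qed.

Variable o : V.
Hypothesis chi_fin : (\int[P]_w counting (C w [:: o]) < +oo)%E.

Lemma tau_series : (\sum_(k <oo) (tau o (e k))%:E < +oo)%E.
Proof.
move: chi_fin; rewrite (integral_counting adj_sym perc e_bij).
by under eq_eseriesr do rewrite tauE.
Qed.

(** The sum of [tau o y] over all [y] is the mean cluster size, which is finite. *)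
Lemma tau_tail (eps : R) : 0 < eps -> exists N, forall s : seq V, uniq s ->
  (forall y, y \in s -> y \notin box e N) -> \sum_(y <- s) tau o y <= eps.
Proof.
move=> eps0.
have /fine_cvgP[finN] : (\sum_(N <= k <oo) (tau o (e k))%:E @[N --> \oo] --> 0)%E.
  by apply: nneseries_tail_cvg tau_series _ => k _; rewrite lee_fin tau_ge0.
move=> /cvgrPdist_le/(_ _ eps0) hN.
have [N _ /(_ N)] : \forall N \near \oo,
   (\sum_(N <= k <oo) (tau o (e k))%:E <= eps%:E)%E.
  near=> N; have fN : (\sum_(N <= k <oo) (tau o (e k))%:E)%E \is a fin_num.
    by near: N.
  rewrite -(fineK fN) lee_fin; apply: le_trans (ler_norm _) _.
  by rewrite -normrN -[- _]add0r; near: N.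
rewrite /= leqnn => /(_ isT) hle.
exists N => s us sN; rewrite -lee_fin; apply: le_trans hle.
have [M sM] : exists M, {subset s <= box e M}.
  elim: s {us sN} => [|x s [M IH]]; first by exists 0%N.
  have [i xi] := box_cover e_bij x; exists (maxn M i) => z.
  rewrite inE => /predU1P[->|/IH].
    by apply: (box_mono (e := e)) xi; rewrite leq_maxr.
  by apply: (box_mono (e := e)); rewrite leq_maxl.
apply: le_trans (nneseries_lim_ge M _); last first.
  by move=> k _ _; rewrite lee_fin tau_ge0.
rewrite sumEFin lee_fin -(big_map e xpredT (fun y => tau o y)).
apply: ler_sum_uniq_sub => //.
- by rewrite map_inj_uniq ?iota_uniq//; exact: bij_inj.
- move=> y ys; have := sM y ys => /mapP[k kM yE]; rewrite yE map_f//.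
  have := sN y ys; rewrite yE.
  move: kM; rewrite mem_iota mem_index_iota => /andP[_ kM] kN.
  rewrite kM andbT leqNgt; apply: contra kN => kN.
  exact: mem_box.
- exact: tau_ge0.
Unshelve. all: by end_near. Qed.

Lemma exp_moment : exists theta0 t : R, 0 < theta0 /\
  forall x, (\int[P]_w expeR (theta0%:E * counting (C w [:: x])) <= t%:E)%E.
Proof.
have [N0 hN0] := tau_tail (eps := 2^-1) ltac:(lra).
have [i oi] := box_cover e_bij o.
pose N := maxn N0 i.
pose T := box e N.
(* The outer boundary of [T]. The tail of [tau] bounds the mean number of its vertices connected to
   [o] by one half, and automorphisms carry [T] and [Bd] to any other vertex. *)
pose Bd := [seq y <- undup (flatten [seq nb adj x | x <- T]) | y \notin T].
have oT : o \in T by apply: box_mono oi; rewrite leq_maxr.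
have uT : uniq T by exact: box_uniq.
have uBd : uniq Bd by rewrite filter_uniq// undup_uniq.
have sumBd : \sum_(y <- Bd) tau o y <= 2^-1.
  apply: hN0 => // y; rewrite mem_filter => /andP[yT _].
  by apply: contra yT; apply: box_mono; rewrite leq_maxl.
have [c [t [c1 t1 ct]]] := @exists_exp_constants R (size T) (size Bd).
exists (ln c), t; split; first by rewrite ln_gt0.
move=> x; apply: (integral_expeR_counting_le adj_sym perc e_bij).
  by rewrite ltW// ln_gt0.
have cE : expR (ln c) = c by rewrite lnK// posrE; lra.
rewrite cE => n.
apply: (cgen_bounded q0 q1 (k := size T) (K := size Bd)) => //.
- exact: ltW.
- exact: box_uniq.
move=> v; have [f fa fo] := G_transitive o v.
have finj := bij_inj fa.1.
have edgeL L' b : subseq L' (box_edges adj e n) -> b \in L' -> is_edge adj b.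
  by move=> /mem_subseq sL' /sL'; exact: box_edges_is_edge.
exists (map f T), (map f Bd); split.
  by split; [rewrite -fo map_f|rewrite map_inj_uniq|rewrite size_map|rewrite size_map].
split=> [L' a y sL' /mapP[a' a'T ->] eL|L' sL'].
  have ay : adj (f a') y.
    have [c' [d [cd /fset2_inj[[-> ->]//|[-> ->]]]]] := edgeL _ _ sL' eL.
    by rewrite adj_sym.
  have [g fK gK] := fa.1.
  rewrite -(gK y) fa.2 in ay; rewrite -(gK y) !mem_map//.
  have [yT|yT] := boolP (g y \in T); [by left|right].
  rewrite mem_filter yT mem_undup; apply/flattenP; exists (nb adj a').
    exact: map_f.
  by rewrite mem_nb.
have uL' : uniq L' by apply: subseq_uniq sL' _; exact: undup_uniq.
apply: le_trans sumBd.
have -> : (fun O => (ccount O [:: v] (map f Bd))%:R) =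
  (fun O => \sum_(y <- map f Bd) (`[< reach (erel O) [:: v] y >])%:R) :> (_ -> R).
  by apply/funext => O; rewrite -natr_sum /ccount -sum1_count big_mkcond/=.
rewrite Exp_sum big_map; apply: ler_sum => y _.
rewrite -lee_fin -(tau_aut _ _ fa) fo -tauE.
by apply: Exp_reach_le => // b; exact: edgeL.
Qed.

End exponential_moment.

(** * Mean size of a union of clusters *)

Lemma measurable_expeR {R : realType} d (T : measurableType d) (f : T -> \bar R) :
  measurable_fun setT f -> measurable_fun setT (fun x => expeR (f x)).
Proof.
move=> mf; rewrite (_ : (fun x => _) = (fun x => if f x == +oo%E then +oo%E else
  if f x == -oo%E then 0%E else (expR (fine (f x)))%:E)); last first.
  by apply/funext => x; case: (f x).
apply: measurable_fun_ifT; first exact: measurable_fun_eqe.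
  exact: measurable_cst.
apply: measurable_fun_ifT; first exact: measurable_fun_eqe.
  exact: measurable_cst.
apply/measurable_EFinP; apply: measurableT_comp; first exact: measurable_expR.
by apply: measurableT_comp => //; exact: measurable_fine.
Qed.

Lemma integral_probability_cst {R : realType} d (T : measurableType d)
  (P : probability T R) (c : \bar R) : (\int[P]_w c = c)%E.
Proof.
transitivity (c * P setT)%E; first exact: integral_cst.
by rewrite probability_setT mule1.
Qed.

(** The remainder of [expR y] is at most [y ^+ 2 * expR y]. With [z = a * x / 4] the square is
    [16 * th ^+ 2 / a ^+ 2 * z ^+ 2]; both [z ^+ 2] and [expR y] are at most [expR (2 * z)], the
    latter because [th <= a / 2]. *)
Lemma expR_le_quadratic {R : realType} (a th x : R) :
  0 < a -> 0 <= th -> th <= a / 2 -> 0 <= x ->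
  expR (th * x) <= 1 + th * x + 16 * th ^+ 2 / a ^+ 2 * expR (a * x).
Proof.
move=> a0 th0 tha x0; set y := th * x.
have h1 : expR y * (1 - y) <= 1.
  have := expR_ge1Dx (- y); rewrite expRN => /(ler_wpM2l (expR_ge0 y)).
  by rewrite divff// gt_eqF// expR_gt0.
have y0 : 0 <= y by rewrite mulr_ge0.
have h2 : expR y <= 1 + y + y ^+ 2 * expR y.
  have : y * (expR y * (1 - y)) <= y * 1 by apply: ler_wpM2l.
  by rewrite expr2; nra.
apply: le_trans h2 _; rewrite lerD2l.
set z := a * x / 4.
have z0 : 0 <= z by rewrite /z divr_ge0 ?mulr_ge0// ltW.
have h3 : z ^+ 2 <= expR (2 * z).
  rewrite mulrC expRM_natr; apply: lerXn2r; rewrite ?nnegrE ?expR_ge0//.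
  by apply: le_trans (expR_ge1Dx z); rewrite ler_wpDl.
have -> : y ^+ 2 = 16 * th ^+ 2 / a ^+ 2 * z ^+ 2.
  by rewrite /y /z; field; rewrite gt_eqF.
rewrite -mulrA; apply: ler_wpM2l.
  by rewrite divr_ge0 ?mulr_ge0 ?exprn_ge0// ltW.
apply: (@le_trans _ _ (expR (2 * z) * expR (2 * z))).
  apply: ler_pM; rewrite ?exprn_ge0 ?expR_ge0// ler_expR /y /z.
  by have := ler_wpM2r x0 tha; lra.
by rewrite -expRD ler_expR /z; lra.
Qed.

(** Jensen's inequality for the uniform mean, by the tangent of the exponential at [b]. It reduces a
    sum of cluster sizes to single sizes, whatever their dependence. *)
Lemma expR_mean_le {R : realType} (a : R) (s : seq R) : (0 < size s)%N ->
  expR (a / (size s)%:R * \sum_(x <- s) x) <=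
  (size s)%:R^-1 * \sum_(x <- s) expR (a * x).
Proof.
move=> s0; have n0 : 0 < (size s)%:R :> R by rewrite ltr0n.
set b := a / _ * _.
rewrite mulrC ler_pdivlMr//.
have -> : expR b * (size s)%:R = \sum_(x <- s) expR b * (1 + a * x - b).
  rewrite -mulr_sumr; congr (_ * _).
  rewrite big_split/= sumrN big_split/= -mulr_sumr !big_const_seq !count_predT.
  rewrite !iter_addr_0 -[b *+ _]mulr_natr /b mulrAC divfK ?gt_eqF//.
  by rewrite addrK.
apply: ler_sum => x _.
have := expR_ge1Dx (a * x - b); rewrite addrA => /(ler_wpM2l (expR_ge0 b)).
by rewrite -expRD addrCA subrr addr0.
Qed.

Section mean_cluster.
Context {R : realType} {V : choiceType} {adj : rel V}.
Context {dX : measure_display} {X : measurableType dX}.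
Context {omega : X -> {fset V} -> bool} {q : R} {P : probability X R}.
Hypotheses (adj_sym : symmetric adj)
  (perc : is_bernoulli_percolation adj omega q P)
  (G_transitive : vertex_transitive adj).
Context {e : nat -> V}.
Hypothesis e_bij : bijective e.
Local Notation C := (cluster_of adj omega).
Variable o : V.
Hypothesis chi_fin : (\int[P]_w counting (C w [:: o]) < +oo)%E.

Let mcount s := measurable_counting adj_sym perc e_bij s.

Lemma counting_cluster_cons_le w x s :
  (counting (C w (x :: s)) <= counting (C w [:: x]) + counting (C w s) :> \bar R)%E.
Proof.
set D := [set y | C w s y /\ ~ C w [:: x] y].
have -> : C w (x :: s) = C w [:: x] `|` D.
  apply/seteqP; split=> y.
    move=> /reach_cons[xy|sy]; first by left.
    by have [xy|xy] := pselect (C w [:: x] y); [left|right].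
  by move=> [xy|[sy _]]; apply/reach_cons; [left|right].
rewrite (countingU e_bij); last by rewrite -subset0 => y [xy [_ /(_ xy)]].
by apply: leeD2l; apply: counting_le => y [].
Qed.

Lemma mean_counting1 x :
  (\int[P]_w counting (C w [:: x]) = \int[P]_w counting (C w [:: o]))%E.
Proof.
have [f fa <-] := G_transitive o x.
exact: (mean_counting_aut adj_sym perc e_bij fa [:: o]).
Qed.

Lemma mean_counting_fin s : (\int[P]_w counting (C w s) < +oo)%E.
Proof.
elim: s => [|x s IH].
  rewrite (eq_integral (fun=> 0%E)) ?integral0 ?ltry// => w _.
  by rewrite (@counting_seq _ _ [::])//; move=> y; split=> // /reach_nil.
apply: le_lt_trans (_ : (_ <= \int[P]_w (counting (C w [:: x]) + counting (C w s)))%E) _.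
  apply: ge0_le_integral => //.
  - by move=> w _; exact: counting_ge0.
  - by apply: emeasurable_funD; exact: mcount.
  - by move=> w _; exact: counting_cluster_cons_le.
rewrite ge0_integralD//; try by move=> *; exact: counting_ge0.
by rewrite lte_add_pinfty// mean_counting1.
Qed.

Definition mean_size (s : seq V) : R := fine (\int[P]_w counting (C w s))%E.

Lemma mean_sizeE s : (\int[P]_w counting (C w s) = (mean_size s)%:E)%E.
Proof.
rewrite fineK// ge0_fin_numE ?mean_counting_fin//.
by apply: integral_ge0 => w _; exact: counting_ge0.
Qed.

Lemma mean_size_ge0 s : 0 <= mean_size s.
Proof. by apply: fine_ge0; apply: integral_ge0 => w _; exact: counting_ge0. Qed.

Lemma mean_size_aut f s : graph_isomorphism adj adj f ->
  mean_size (map f s) = mean_size s.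
Proof.
by move=> fa; rewrite /mean_size (mean_counting_aut adj_sym perc e_bij fa).
Qed.

Lemma mean_size_ge s : (size (undup s))%:R <= mean_size s.
Proof.
rewrite -lee_fin -mean_sizeE.
apply: le_trans (_ : (_ <= \int[P]_w (size (undup s))%:R%:E)%E) _.
  by rewrite integral_probability_cst.
apply: ge0_le_integral => //.
- move=> w _; rewrite -(@counting_seq _ _ s [set x | x \in s])//.
  by apply: counting_le => y; exact: reach_mem.
Qed.

(** The second condition does not involve [y]: this is the whole cluster of [x] if it avoids [s],
    and empty otherwise. It is what [x] adds to the clusters of [s]. *)
Definition fresh w x (s : seq V) : set V :=
  [set y | C w [:: x] y /\ ~ exists2 z, z \in s & C w [:: x] z].

Lemma cluster_sym w x y : C w [:: x] y -> C w [:: y] x.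
Proof. by apply: reach_sym => a b; rewrite /open_adj adj_sym fsetUC. Qed.

Lemma cluster_trans w x y s : C w s x -> C w [:: x] y -> C w s y.
Proof. by move=> sx; apply: reach_trans => z; rewrite inE => /eqP ->. Qed.

Lemma cluster_mem w s y : C w s y <-> exists2 z, z \in s & C w [:: z] y.
Proof.
split; last by move=> [z zs zy]; apply: cluster_trans zy; exact: reach_mem.
elim=> [x xs|a b _ [z zs za] ab]; first by exists x => //; apply: reach_mem; rewrite inE.
by exists z => //; apply: reach_step ab.
Qed.

Lemma counting_cluster_cons w x s : counting (C w (x :: s)) =
  (counting (C w s) + counting (fresh w x s))%E :> \bar R.
Proof.
rewrite -(countingU e_bij).
  congr counting; apply/seteqP; split=> y.
    move=> /reach_cons[xy|sy]; last by left.
    have [[z zs xz]|nz] := pselect (exists2 z, z \in s & C w [:: x] z).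
      left; apply/cluster_mem; exists z => //.
      by apply: cluster_trans xy; exact: cluster_sym.
    by right.
  by move=> [sy|[xy _]]; apply/reach_cons; [right|left].
rewrite -subset0 => y [/cluster_mem[z zs zy] [xy]]; apply; exists z => //.
by apply: cluster_trans xy _; exact: cluster_sym.
Qed.

Definition rho x y (s : seq V) : R := fine (P [set w | fresh w x s y]).

Lemma fresh_event x y s : [set w | fresh w x s y] = [set w | C w [:: x] y] `\`
  [set w | C w [:: x] y /\ exists2 z, z \in s & C w [:: x] z].
Proof. by apply/seteqP; split=> w /=; rewrite /fresh /=; tauto. Qed.

Lemma measurable_fresh x y s : measurable [set w | fresh w x s y].
Proof.
rewrite fresh_event; apply: measurableD.
  exact: (measurable_reach adj_sym perc e_bij).
exact: (finitary_event adj_sym perc e_bij [:: x] (finitary_mem2 y s)).1.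
Qed.

Lemma rhoE x y s : P [set w | fresh w x s y] = (rho x y s)%:E.
Proof. by rewrite fineK// fin_num_measure//; exact: measurable_fresh. Qed.

Lemma rho_ge0 x y s : 0 <= rho x y s.
Proof. by apply: fine_ge0; exact: measure_ge0. Qed.

Lemma rho_aut f x y s : graph_isomorphism adj adj f ->
  rho (f x) (f y) (map f s) = rho x y s.
Proof.
move=> fa; rewrite /rho !fresh_event.
have mC x' y' : measurable [set w | C w [:: x'] y'].
  exact: (measurable_reach adj_sym perc e_bij).
have mC2 x' y' (s' : seq V) : measurable
    [set w | C w [:: x'] y' /\ exists2 z, z \in s' & C w [:: x'] z].
  exact: (finitary_event adj_sym perc e_bij [:: x'] (finitary_mem2 y' s')).1.
have DE x' y' (s' : seq V) : P ([set w | C w [:: x'] y'] `\`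
    [set w | C w [:: x'] y' /\ exists2 z, z \in s' & C w [:: x'] z]) =
    (P [set w | C w [:: x'] y'] -
     P [set w | C w [:: x'] y' /\ exists2 z, z \in s' & C w [:: x'] z])%E.
  rewrite measureD//; last by rewrite (le_lt_trans (probability_le1 P (mC _ _)))// ltry.
  by rewrite (_ : _ `&` _ = [set w | C w [:: x'] y' /\
    exists2 z, z \in s' & C w [:: x'] z])//; apply/setIidPr => w [].
rewrite !DE (connection_aut adj_sym perc e_bij fa).
by rewrite (connection2_aut adj_sym perc e_bij fa).
Qed.

Lemma rho_nil x y : rho x y [::] = tau (adj := adj) (omega := omega) (P := P) x y.
Proof.
rewrite /rho /tau; congr (fine (P _)); apply/seteqP; split=> w; first by case.
by move=> /= xy; split=> // -[].
Qed.

Lemma measurable_counting_fresh x s :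
  measurable_fun setT (fun w => counting (fresh w x s) : \bar R).
Proof.
rewrite (_ : (fun w => _) = (fun w => \sum_(k <oo) (\1_(fresh w x s) (e k))%:E)%E).
  apply: ge0_emeasurable_sum => [k w _ _|k _]; first by rewrite lee_fin.
  apply/measurable_EFinP.
  rewrite (_ : (fun w => _) = \1_[set w | fresh w x s (e k)]).
    by apply: measurable_indic; exact: measurable_fresh.
  by apply/funext => w; rewrite !indicE.
by apply/funext => w; rewrite (counting_nneseries _ e_bij).
Qed.

Lemma integral_counting_fresh x s :
  (\int[P]_w counting (fresh w x s) = \sum_(k <oo) (rho x (e k) s)%:E)%E.
Proof.
transitivity (\int[P]_w \sum_(k <oo) (\1_[set w | fresh w x s (e k)] w)%:E)%E.
  apply: eq_integral => w _; rewrite (counting_nneseries _ e_bij).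
  by apply: eq_eseriesr => k _; rewrite !indicE.
rewrite integral_nneseries//.
  apply: eq_eseriesr => k _; rewrite -rhoE integral_indic// ?setIT//.
  exact: measurable_fresh.
by move=> k; apply/measurable_EFinP; apply: measurable_indic; exact: measurable_fresh.
Qed.

Definition beta x (s : seq V) : R := mean_size (x :: s) - mean_size s.

Lemma betaE x s : (\int[P]_w counting (fresh w x s) = (beta x s)%:E)%E.
Proof.
have : (\int[P]_w counting (C w (x :: s)) = \int[P]_w counting (C w s) +
    \int[P]_w counting (fresh w x s))%E.
  rewrite -ge0_integralD//; last 3 first.
  - by move=> *; exact: counting_ge0.
  - by move=> *; exact: counting_ge0.
  - exact: measurable_counting_fresh.
  by apply: eq_integral => w _; exact: counting_cluster_cons.
rewrite !mean_sizeE /beta.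
case: (\int[P]_w counting (fresh w x s))%E => //= r.
by rewrite -EFinD => -[->]; rewrite addrAC subrr add0r.
Qed.

Lemma beta_ge0 x s : 0 <= beta x s.
Proof.
by rewrite -lee_fin -betaE; apply: integral_ge0 => w _; exact: counting_ge0.
Qed.

(** Diminishing returns: a larger list leaves less that is fresh. This is what makes the increments
    along the walk decrease. *)
Lemma beta_sub x s s' : {subset s <= s'} -> beta x s' <= beta x s.
Proof.
move=> ss'; rewrite -lee_fin -!betaE; apply: ge0_le_integral => //.
- by move=> *; exact: counting_ge0.
- exact: measurable_counting_fresh.
- exact: measurable_counting_fresh.
- move=> w _; apply: counting_le => y [xy nz]; split=> // -[z zs xz].
  by apply: nz; exists z => //; exact: ss'.
Qed.

Lemma mean_size_nil : mean_size [::] = 0.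
Proof.
rewrite /mean_size (eq_integral (fun=> 0%E)) ?integral0// => w _.
by rewrite (@counting_seq _ _ [::])//; move=> y; split=> // /reach_nil.
Qed.

Lemma exp_counting_ge theta s : 0 <= theta ->
  ((expR (theta * mean_size s))%:E <=
    \int[P]_w expeR (theta%:E * counting (C w s)))%E.
Proof.
move=> th0; set m := theta * mean_size s.
have mexp : measurable_fun setT (fun w => expeR (theta%:E * counting (C w s))).
  by apply: measurable_expeR; apply: measurable_funeM; exact: mcount.
(* The tangent of the exponential at the mean lies below it. Its negative term is moved to the other
   side, so that only nonnegative functions are integrated. *)
have hle : (\int[P]_w ((expR m)%:E + (expR m * theta)%:E * counting (C w s)) <=
    \int[P]_w (expeR (theta%:E * counting (C w s)) + (expR m * m)%:E))%E.
  have m0 : 0 <= m by rewrite mulr_ge0// mean_size_ge0.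
  apply: ge0_le_integral => //.
  - move=> w _; rewrite adde_ge0// ?lee_fin ?expR_ge0//.
    by rewrite mule_ge0 ?counting_ge0// lee_fin mulr_ge0// expR_ge0.
  - by apply: emeasurable_funD => //; apply: measurable_funeM; exact: mcount.
  - by apply: emeasurable_funD.
  - move=> w _; have := counting_ge0 (R := R) (C w s).
    case: (counting (C w s)) => [r| |] // _; last first.
      have [th00|thN] := eqVneq theta 0.
        by rewrite /m th00 !mul0r !mulr0 !mul0e expR0 expeR0.
      have th1 : 0 < theta by rewrite lt_def thN.
      by rewrite [(theta%:E * +oo)%E]gt0_muley ?lte_fin//= leey.
    rewrite -!EFinM -!EFinD /= lee_fin.
    have := expR_ge1Dx (theta * r - m) => /(ler_wpM2l (expR_ge0 m)).
    by rewrite -expRD [m + _]addrC subrK; lra.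
set k := expR m * theta in hle *.
have k0 : 0 <= k by rewrite mulr_ge0 ?expR_ge0.
have kN w : setT w -> (0 <= k%:E * counting (C w s))%E.
  by move=> _; rewrite mule_ge0 ?counting_ge0.
have mk : measurable_fun setT (fun w => k%:E * counting (C w s))%E.
  exact: measurable_funeM.
have N0 w : setT w -> (0 <= counting (C w s) :> \bar R)%E.
  by move=> _; exact: counting_ge0.
have eN w : setT w -> (0 <= expeR (theta%:E * counting (C w s)))%E.
  by move=> _; exact: expeR_ge0.
have m0 : 0 <= m by rewrite mulr_ge0// mean_size_ge0.
have em0 (w : X) : setT w -> (0 <= (expR m)%:E :> \bar R)%E.
  by move=> _; rewrite lee_fin expR_ge0.
have emm0 (w : X) : setT w -> (0 <= (expR m * m)%:E :> \bar R)%E.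
  by move=> _; rewrite lee_fin mulr_ge0 ?expR_ge0.
move: hle; rewrite ge0_integralD// ge0_integralZl_EFin//.
rewrite mean_sizeE integral_probability_cst [in leRHS]ge0_integralD//.
rewrite integral_probability_cst -EFinM -mulrA -/m.
by rewrite leeD2rE.
Qed.

End mean_cluster.

Section exponential_bounds.
Context {R : realType} {V : choiceType} {adj : rel V}.
Context {dX : measure_display} {X : measurableType dX}.
Context {omega : X -> {fset V} -> bool} {q : R} {P : probability X R}.
Hypotheses (adj_sym : symmetric adj)
  (perc : is_bernoulli_percolation adj omega q P)
  (G_transitive : vertex_transitive adj).
Context {e : nat -> V}.
Hypothesis e_bij : bijective e.
Local Notation C := (cluster_of adj omega).
Variable o : V.
Hypothesis chi_fin : (\int[P]_w counting (C w [:: o]) < +oo)%E.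
Local Notation mean_size := (mean_size (adj := adj) (omega := omega) (P := P)).

Lemma counting_cluster_le_sum w s :
  (counting (C w s) <= \sum_(v <- s) counting (C w [:: v]) :> \bar R)%E.
Proof.
elim: s => [|x s IH].
  rewrite big_nil (@counting_seq _ _ [::])//; move=> y; split=> // /reach_nil//.
rewrite big_cons; apply: le_trans (counting_cluster_cons_le e_bij w x s) _.
exact: leeD2l.
Qed.

(** With [n = size s], [expR_le_quadratic] is used at [a / n], which produces [n ^+ 2];
    [expR_mean_le] then restores the exponent [a] for single clusters and gives back a factor
    [n^-1]. *)
Lemma expeR_counting_cluster_le (theta a : R) w s : 0 < theta -> 0 < a ->
  (0 < size s)%N -> theta <= a / (size s)%:R / 2 ->
  (expeR (theta%:E * counting (C w s)) <= 1 + theta%:E * counting (C w s) +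
    (16 * theta ^+ 2 * (size s)%:R / a ^+ 2)%:E *
      \sum_(v <- s) expeR (a%:E * counting (C w [:: v])))%E.
Proof.
move=> th0 a0 s0 tha.
have n0 : 0 < (size s)%:R :> R by rewrite ltr0n.
set n : R := (size s)%:R in n0 tha *; set K := 16 * _ * n / _.
have K0 : 0 < K by rewrite /K divr_gt0 ?mulr_gt0 ?exprn_gt0.
have lhs0 : (0 <= 1 + theta%:E * counting (C w s))%E.
  by rewrite adde_ge0// mule_ge0 ?counting_ge0// lee_fin ltW.
have [fin|] := pselect (forall v, v \in s -> (counting (C w [:: v]) < +oo :> \bar R)%E);
    last first.
  move=> /existsNP[v /not_implyP[vs /negP]]; rewrite -leNgt leye_eq => /eqP Nv.
  suff -> : (\sum_(v <- s) expeR (a%:E * counting (C w [:: v])) = +oo)%E.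
    rewrite gt0_muley ?lte_fin// addey ?leey//.
    by apply: contraTneq lhs0 => ->.
  apply/eqP; rewrite -leye_eq (big_rem v)//= Nv gt0_muley ?lte_fin//=.
  rewrite addye ?leey// gt_eqF// (lt_le_trans (ltNyr 0))//.
  by apply: sume_ge0 => *; exact: expeR_ge0.
pose r v : R := fine (counting (C w [:: v])).
have rE v : v \in s -> counting (C w [:: v]) = (r v)%:E.
  by move=> vs; rewrite fineK// ge0_fin_numE ?counting_ge0// fin.
have Nle := counting_cluster_le_sum w s.
have sE : (\sum_(v <- s) counting (C w [:: v]) = (\sum_(v <- s) r v)%:E)%E.
  by rewrite -sumEFin; apply: eq_big_seq => v /rE.
rewrite sE in Nle.
have Nfin : counting (C w s) \is a @fin_num R.
  by rewrite ge0_fin_numE ?counting_ge0// (le_lt_trans Nle)// ltry.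
have N0 := counting_ge0 (R := R) (C w s).
rewrite -(fineK Nfin) in N0 Nle *.
set N := fine _ in N0 Nle *; rewrite !lee_fin in N0 Nle.
have -> : (\sum_(v <- s) expeR (a%:E * counting (C w [:: v])) =
    (\sum_(v <- s) expR (a * r v))%:E)%E.
  by rewrite -sumEFin; apply: eq_big_seq => v /rE ->.
rewrite -!EFinM -!EFinD lee_fin.
have h1 := expR_le_quadratic (divr_gt0 a0 n0) (ltW th0) tha N0.
apply: le_trans h1 _; rewrite lerD2l.
have h2 := @expR_mean_le _ a (map r s); rewrite size_map !big_map in h2.
have {}h2 := h2 s0.
have h3 : expR (a / n * N) <= n^-1 * \sum_(v <- s) expR (a * r v).
  apply: le_trans h2; rewrite ler_expR; apply: ler_wpM2l => //.
  by rewrite divr_ge0// ltW.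
have -> : K = 16 * theta ^+ 2 / (a / n) ^+ 2 * n^-1.
  by rewrite /K; field; rewrite !gt_eqF.
rewrite -[X in _ <= X]mulrA; apply: ler_wpM2l => //.
have th0' := ltW th0; have a0' := ltW a0; have n0' := ltW n0.
by rewrite divr_ge0 ?mulr_ge0 ?exprn_ge0 ?mulr_ge0 ?invr_ge0.
Qed.

Let mcount s := measurable_counting adj_sym perc e_bij s.

Lemma exp_counting_le (theta a t : R) s : 0 < theta -> 0 < a ->
  (0 < size s)%N -> theta <= a / (size s)%:R / 2 ->
  (forall x, (\int[P]_w expeR (a%:E * counting (C w [:: x])) <= t%:E)%E) ->
  (\int[P]_w expeR (theta%:E * counting (C w s)) <=
    (1 + theta * mean_size s +
     16 * theta ^+ 2 * (size s)%:R ^+ 2 / a ^+ 2 * t)%:E)%E.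
Proof.
move=> th0 a0 s0 tha ht.
set K := 16 * theta ^+ 2 * (size s)%:R / a ^+ 2.
have K0 : 0 <= K by rewrite /K divr_ge0 ?mulr_ge0 ?exprn_ge0// ltW.
have mexp (c : R) s' :
    measurable_fun setT (fun w => expeR (c%:E * counting (C w s'))).
  by apply: measurable_expeR; exact: measurable_funeM.
have e0 (c : R) s' w : (0 <= expeR (c%:E * counting (C w s')))%E.
  exact: expeR_ge0.
have N0 s' w : (0 <= counting (C w s') :> \bar R)%E by exact: counting_ge0.
pose F w := (\sum_(v <- s) expeR (a%:E * counting (C w [:: v])))%E.
have F0 w : (0 <= F w)%E by apply: sume_ge0.
have mF : measurable_fun setT F by apply: emeasurable_sum.
have thN w : (0 <= theta%:E * counting (C w s))%E.
  by rewrite mule_ge0// lee_fin ltW.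
have mthN : measurable_fun setT (fun w => theta%:E * counting (C w s))%E.
  exact: measurable_funeM.
have KF w : (0 <= K%:E * F w)%E by rewrite mule_ge0.
have mKF : measurable_fun setT (fun w => K%:E * F w)%E.
  exact: measurable_funeM.
have h1 w : (0 <= 1 + theta%:E * counting (C w s))%E by rewrite adde_ge0.
have mh1 : measurable_fun setT (fun w => 1 + theta%:E * counting (C w s))%E.
  exact: emeasurable_funD.
apply: le_trans (_ : (_ <= \int[P]_w (1 + theta%:E * counting (C w s) + K%:E * F w))%E) _.
  apply: ge0_le_integral => //; first exact: emeasurable_funD.
  by move=> w _; exact: expeR_counting_cluster_le.
rewrite ge0_integralD// ge0_integralD// ge0_integralZl_EFin//; last exact: ltW.
rewrite ge0_integralZl_EFin// integral_probability_cst.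
rewrite (mean_sizeE adj_sym perc G_transitive e_bij chi_fin).
rewrite ge0_integral_sum// -EFinM -EFinD [X in (_ <= X)%E]EFinD; apply: leeD2l.
have sumle : (\sum_(v <- s) \int[P]_w expeR (a%:E * counting (C w [:: v])) <=
   ((size s)%:R * t)%:E)%E.
  apply: le_trans (_ : (_ <= \sum_(v <- s) t%:E)%E) _; first exact: lee_sum.
  by rewrite sumEFin lee_fin big_const_seq count_predT iter_addr_0 mulr_natl.
apply: le_trans (lee_wpmul2l _ sumle) _; first by rewrite lee_fin.
rewrite -EFinM lee_fin /K; rewrite le_eqVlt; apply/orP; left; apply/eqP; ring.
Qed.

End exponential_bounds.

(** * Percolation with parameter 0 *)

Section no_percolation.
Context {R : realType} {V : choiceType} {adj : rel V}.
Context {dX : measure_display} {X : measurableType dX}.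
Context {omega : X -> {fset V} -> bool} {P : probability X R}.
Hypotheses (adj_sym : symmetric adj)
  (perc : is_bernoulli_percolation adj omega (0 : R) P).
Context {e : nat -> V}.
Hypothesis e_bij : bijective e.
Local Notation C := (cluster_of adj omega).

Lemma Exp0 (E : eqType) (L : seq E) (F : seq E -> R) : Exp 0 L F = F [::].
Proof. by elim: L F => //= b L IH F; rewrite IH mul0r add0r subr0 mul1r. Qed.

Lemma reach_no_edge (s : seq V) y : reach (erel [::]) s y <-> y \in s.
Proof. by split; [elim=> // a b _ _; rewrite /erel inE|exact: reach_mem]. Qed.

Lemma connection0 s y : P [set w | C w s y] = (y \in s)%:R%:E.
Proof.
have [_ h] := finitary_event adj_sym perc e_bij s (finitary_mem y).
rewrite -(cvg_lim _ h)//; under eq_fun do rewrite Exp0.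
rewrite lim_cst//; congr ((nat_of_bool _)%:R%:E).
by apply/asboolP/idP; rewrite reach_no_edge.
Qed.

Lemma mean_size0 s :
  (\int[P]_w counting (C w s) = (size (undup s))%:R%:E)%E.
Proof.
rewrite (integral_counting adj_sym perc e_bij).
rewrite -(@counting_seq _ _ s [set x | x \in s])// (counting_nneseries _ e_bij).
apply: eq_eseriesr => k _; rewrite connection0 indicE.
by congr ((nat_of_bool _)%:R%:E); apply/idP/idP; rewrite inE.
Qed.

Lemma exp_counting0_le (theta : R) s : 0 <= theta ->
  (\int[P]_w expeR (theta%:E * counting (C w s)) <=
   (expR (theta * (size (undup s))%:R))%:E)%E.
Proof.
move=> th0; apply: (integral_expeR_counting_le adj_sym perc e_bij) => // n.
rewrite /cgen Exp0 expRM_natr; apply: ler_weXn2l; first by rewrite -expR0 ler_expR.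
rewrite /ccount -size_filter; apply: uniq_leq_size.
  by apply: filter_uniq; exact: box_uniq.
by move=> y; rewrite mem_filter mem_undup => /andP[/asboolP/reach_no_edge].
Qed.

End no_percolation.

(** * Expectations along a walk *)

Section walk_expectation.
Context {R : realType} {V : choiceType} (adj : rel V).
Implicit Types (K : V -> V -> R) (Phi : seq V -> R).

(* The sum over the n-step paths y_1, ..., y_n from x of Phi [:: y_1; ...; y_n]
   weighted by the product of the K y_i y_(i+1). *)
Fixpoint walkE K n x Phi : R :=
  if n is m.+1 then
    \sum_(y <- nb adj x) K x y * walkE K m y (fun s => Phi (y :: s))
  else Phi [::].

Hypothesis G_bounded : bounded_degrees adj.

Lemma walkED K n x Phi Psi :
  walkE K n x (fun s => Phi s + Psi s) = walkE K n x Phi + walkE K n x Psi.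
Proof.
elim: n x Phi Psi => //= n IH x Phi Psi.
rewrite -big_split; apply: eq_bigr => y _ /=.
by rewrite (IH _ (fun s => Phi (y :: s))) mulrDr.
Qed.

Lemma walkEZ K n x c Phi :
  walkE K n x (fun s => c * Phi s) = c * walkE K n x Phi.
Proof.
elim: n x Phi => //= n IH x Phi.
rewrite mulr_sumr; apply: eq_bigr => y _ /=.
by rewrite (IH _ (fun s => Phi (y :: s))) mulrCA.
Qed.

Lemma walkE_sum K n x (I : Type) (r : seq I) (F : I -> seq V -> R) :
  walkE K n x (fun s => \sum_(i <- r) F i s) = \sum_(i <- r) walkE K n x (F i).
Proof.
elim: r => [|i r IH].
  rewrite big_nil -[RHS](mul0r (walkE K n x (fun=> 1))) -walkEZ; congr walkE.
  by apply/funext => s; rewrite big_nil mul0r.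
by rewrite big_cons -IH -walkED; congr walkE; apply/funext => s; rewrite big_cons.
Qed.

Definition stochastic K : Prop :=
  (forall x y, adj x y -> 0 <= K x y) /\
  (forall x, \sum_(y <- nb adj x) K x y = 1).

Lemma walkE_cst K n x c : stochastic K -> walkE K n x (fun=> c) = c.
Proof.
move=> [_ K1]; elim: n x => //= n IH x.
under eq_bigr do rewrite IH.
by rewrite -mulr_suml K1 mul1r.
Qed.

Lemma walkE_le K n x Phi Psi : (forall x y, adj x y -> 0 <= K x y) ->
  (forall s, size s = n -> path adj x s -> Phi s <= Psi s) ->
  walkE K n x Phi <= walkE K n x Psi.
Proof.
move=> K0; elim: n x Phi Psi => /= [|n IH] x Phi Psi h; first exact: h.
rewrite !big_seq; apply: ler_sum => y; rewrite mem_nb// => xy.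
apply: ler_wpM2l; first exact: K0.
by apply: IH => s sn ps; apply: h; rewrite /= ?sn ?xy.
Qed.

Lemma walkE_ge0 K n x Phi : (forall x y, adj x y -> 0 <= K x y) ->
  (forall s, 0 <= Phi s) -> 0 <= walkE K n x Phi.
Proof.
move=> K0 Phi0; apply: le_trans (walkE_le (Phi := fun=> 0 * 0) K0 _).
  by rewrite walkEZ mul0r.
by move=> s _ _; rewrite mul0r.
Qed.

Lemma walkE_aut K n x Phi (f : V -> V) : graph_isomorphism adj adj f ->
  (forall x y, K (f x) (f y) = K x y) ->
  walkE K n (f x) Phi = walkE K n x (fun s => Phi (map f s)).
Proof.
move=> fa Kf; elim: n x Phi => //= n IH x Phi.
have finj := bij_inj fa.1.
have -> : \sum_(y <- nb adj (f x)) K (f x) y * walkE K n y (fun s => Phi (y :: s))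
   = \sum_(y <- map f (nb adj x)) K (f x) y * walkE K n y (fun s => Phi (y :: s)).
  apply: perm_big; apply: uniq_perm; rewrite ?map_inj_uniq ?nb_uniq// => y.
  have [g fK gK] := fa.1.
  by rewrite -(gK y) mem_map// !mem_nb// fa.2.
by rewrite big_map; apply: eq_bigr => y _; rewrite Kf IH.
Qed.

Lemma walkE_jensen K n x Phi : stochastic K ->
  expR (walkE K n x Phi) <= walkE K n x (fun s => expR (Phi s)).
Proof.
move=> Ks; set a := walkE K n x Phi.
have -> : expR a = walkE K n x (fun s => expR a * (1 - a) + expR a * Phi s).
  by rewrite walkED walkE_cst// (walkEZ K n x (expR a) Phi) -/a; ring.
apply: walkE_le => [|s _ _]; first exact: Ks.1.
have := expR_ge1Dx (Phi s - a) => /(ler_wpM2l (expR_ge0 a)).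
by rewrite -expRD [a + _]addrC subrK; lra.
Qed.

Lemma walkE_split K n m x Phi : walkE K (n + m) x Phi =
  walkE K n x (fun s => walkE K m (last x s) (fun s' => Phi (s ++ s'))).
Proof.
elim: n x Phi => //= n IH x Phi; apply: eq_bigr => y _; congr (_ * _).
exact: IH.
Qed.

End walk_expectation.

Section simple_random_walk.
Context {R : realType} {V : choiceType} {adj : rel V}.
Hypotheses (V_infinite : infinite_set [set: V])
  (G_connected : connected_graph adj) (G_bounded : bounded_degrees adj).
Local Notation K := (step_prob R adj).

Lemma degree_gt0 x : (0 < degree adj x)%N.
Proof.
suff [y xy] : exists y, adj x y.
  have : y \in nb adj x by rewrite mem_nb.
  by rewrite /degree /nb; case: (fset_set _) => -[].
have [y yx] : exists y, y != x.
  apply: contrapT => /forallNP h; apply: V_infinite.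
  apply: (@sub_finite_set _ _ [set x]) => // y _ /=.
  by have /negP := h y; rewrite negbK => /eqP.
have [[|z s] /= ps ls] := G_connected x y; first by rewrite ls eqxx in yx.
by exists z; move: ps => /andP[].
Qed.

Lemma step_prob_stochastic : stochastic adj K.
Proof.
split=> [x y xy|x]; first by rewrite /step_prob xy invr_ge0.
rewrite big_seq (eq_bigr (fun=> (degree adj x)%:R^-1)); last first.
  by move=> y; rewrite mem_nb// /step_prob => ->.
rewrite -big_seq big_const_seq count_predT iter_addr_0.
have -> : size (nb adj x) = degree adj x by [].
rewrite -[X in X = _]mulr_natr mulVf//.
by rewrite pnatr_eq0 -lt0n degree_gt0.
Qed.

Lemma degree_aut (f : V -> V) x : graph_isomorphism adj adj f ->
  degree adj (f x) = degree adj x.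
Proof.
move=> fa; have finj := bij_inj fa.1.
rewrite /degree -[LHS]/(size (nb adj (f x))) -[RHS]/(size (nb adj x)).
rewrite -[RHS](size_map f); apply: perm_size.
apply: uniq_perm; rewrite ?map_inj_uniq ?nb_uniq// => y.
by have [g fK gK] := fa.1; rewrite -(gK y) mem_map// !mem_nb// fa.2.
Qed.

Lemma step_prob_aut (f : V -> V) x y : graph_isomorphism adj adj f ->
  K (f x) (f y) = K x y.
Proof. by move=> fa; rewrite /step_prob fa.2 degree_aut. Qed.

End simple_random_walk.

(** * The law of the random walk expressed by [walkE] *)

Section walk_measurability.
Context {R : realType} {V : choiceType} {e : nat -> V}.
Hypothesis e_bij : bijective e.
Context {d : measure_display} {T : measurableType d} {S : nat -> T -> V}.
Hypothesis mS : forall n v, measurable [set w | S n w = v].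

Definition trajectory m n (w : T) : seq V := [seq S i w | i <- iota m n].

Lemma measurable_trajectory m n (G : seq V -> T -> \bar R) :
  (forall s, measurable_fun setT (G s)) ->
  measurable_fun setT (fun w => G (trajectory m n w) w).
Proof.
elim: n m G => [|n IH] m G mG /=; first exact: mG.
move=> _ B mB; rewrite setTI.
rewrite (_ : _ @^-1` B = \bigcup_k ([set w | S m w = e k] `&`
    ((fun w => G (e k :: trajectory m.+1 n w) w) @^-1` B))).
  apply: bigcupT_measurable => k; apply: measurableI => //.
  rewrite -[X in measurable X]setTI.
  exact: (IH m.+1 (fun s => G (e k :: s))).
have [g eK gK] := e_bij.
apply/seteqP; split=> w /=.
  by move=> Bw; exists (g (S m w)) => //=; rewrite gK.
by move=> [k _ [/= Sk]]; rewrite -Sk.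
Qed.

End walk_measurability.

Section series_on_vertices.
Context {R : realType} {V : choiceType} {e : nat -> V}.
Hypothesis e_bij : bijective e.
Local Open Scope ereal_scope.

Lemma nneseries_finite_support (F : V -> \bar R) (s : seq V) : uniq s ->
  (forall y, y \notin s -> F y = 0) -> \sum_(k <oo) F (e k) = \sum_(y <- s) F y.
Proof.
move=> us Fs.
have [M sM] : exists M, {subset s <= box e M}.
  elim: s {us Fs} => [|x s [M IH]]; first by exists 0%N.
  have [i xi] := box_cover e_bij x; exists (maxn M i) => z.
  rewrite inE => /predU1P[->|/IH].
    by apply: (box_mono (e := e)) xi; rewrite leq_maxr.
  by apply: (box_mono (e := e)); rewrite leq_maxl.
apply: lim_near_cst => //; exists M => // n /= Mn.
rewrite -(big_map e xpredT F) /index_iota subn0 -/(box e n).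
rewrite (bigID (mem s))/= [X in _ + X]big1 ?adde0//.
rewrite -big_filter; apply: perm_big; apply: uniq_perm => //.
  by rewrite filter_uniq// box_uniq.
move=> y; rewrite mem_filter andb_idr// => /sM.
exact: box_mono.
Qed.

End series_on_vertices.

Section walk_law.
Context {R : realType} {V : choiceType} {adj : rel V} {e : nat -> V}.
Hypotheses (G_bounded : bounded_degrees adj) (e_bij : bijective e).
Context {dW : measure_display} {W : measurableType dW} {S : nat -> W -> V}
  {PW : V -> probability W R}.
Hypothesis S_walk : is_simple_random_walk adj S PW.
Local Notation K := (step_prob R adj).
Implicit Types (x y : V) (t : seq V).

Definition history x (t : seq V) : set W :=
  [set w | forall i, (i <= size t)%N -> S i w = nth x (x :: t) i].

Definition history_prob x (t : seq V) : R :=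
  \prod_(i < size t) K (nth x (x :: t) i) (nth x (x :: t) i.+1).

Lemma historyE x t : PW x (history x t) = (history_prob x t)%:E.
Proof. by rewrite /history (S_walk.2 x _ (nth x (x :: t))) /= eqxx mul1r. Qed.

Lemma nth_cons_rcons x t y i : (i <= size t)%N ->
  nth x (x :: rcons t y) i = nth x (x :: t) i.
Proof. by move=> it; rewrite -rcons_cons nth_rcons /= ltnS it. Qed.

Lemma history_rcons x t y :
  history x (rcons t y) = history x t `&` [set w | S (size t).+1 w = y].
Proof.
apply/seteqP; split=> [w h|w [h hy] i].
  split=> [i it|/=].
    by rewrite h ?size_rcons ?(leq_trans it)// nth_cons_rcons.
  by rewrite h ?size_rcons//= nth_rcons ltnn eqxx.
rewrite size_rcons leq_eqVlt => /predU1P[->|it].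
  by rewrite hy /= nth_rcons ltnn eqxx.
by rewrite nth_cons_rcons// h.
Qed.

Lemma history_prob_rcons x t y :
  history_prob x (rcons t y) = history_prob x t * K (last x t) y.
Proof.
rewrite /history_prob size_rcons big_ord_recr /=; congr (_ * K _ _).
- apply: eq_bigr => i _.
  have it := ltn_ord i.
  congr (K _ _); first by rewrite nth_cons_rcons// ltnW.
  by rewrite nth_rcons it.
- by rewrite nth_cons_rcons// (last_nth x).
- by rewrite nth_rcons ltnn eqxx.
Qed.

Lemma measurable_step n v : measurable [set w | S n w = v].
Proof. exact: S_walk.1. Qed.

Lemma measurable_history x t : measurable (history x t).
Proof.
elim/last_ind: t => [|t y IH].
  rewrite (_ : history x [::] = [set w | S 0%N w = x]); first exact: measurable_step.
  apply/seteqP; split=> w /=; first by move=> /(_ 0%N); apply.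
  by move=> S0 i; rewrite leqn0 => /eqP ->.
by rewrite history_rcons; apply: measurableI => //; exact: measurable_step.
Qed.

Lemma measurable_trajectory_fun m n (Phi : seq V -> \bar R) :
  measurable_fun setT (fun w => Phi (trajectory (S := S) m n w)).
Proof.
apply: (measurable_trajectory e_bij measurable_step _ _ (G := fun s _ => Phi s)).
by move=> s; exact: measurable_cst.
Qed.

(** The event is split according to the next position until the prescribed cylinder probabilities
    apply. Vertices that are not neighbours contribute 0, so the series over [V] reduces to the
    finite sum in [walkE]. *)
Lemma integral_history n x t (Phi : seq V -> R) : (forall s, 0 <= Phi s) ->
  (\int[PW x]_(w in history x t)
     (Phi (trajectory (S := S) (size t).+1 n w))%:E =
   (history_prob x t * walkE adj K n (last x t) Phi)%:E)%E.
Proof.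
elim: n t Phi => [|n IH] t Phi Phi0.
  rewrite /=; transitivity ((Phi [::])%:E * PW x (history x t))%E.
    exact: (integral_cst (PW x) (measurable_history x t) (Phi [::])%:E).
  by rewrite historyE -EFinM mulrC.
have hU : history x t = \bigcup_k history x (rcons t (e k)).
  apply/seteqP; split=> w.
    move=> h; have [g eK gK] := e_bij.
    by exists (g (S (size t).+1 w)) => //; rewrite history_rcons; split => //=;
      rewrite gK.
  by move=> [k _]; rewrite history_rcons => -[].
rewrite {1}hU ge0_integral_bigcup//=.
- pose F y := (history_prob x (rcons t y) *
    walkE adj K n y (fun s => Phi (y :: s)))%:E.
  transitivity (\sum_(k <oo) F (e k))%E.
    apply: eq_eseriesr => k _; rewrite /F.
    have := IH (rcons t (e k)) (fun s => Phi (e k :: s)) (fun s => Phi0 _).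
    rewrite last_rcons size_rcons => <-.
    apply: eq_integral => w; rewrite inE => h.
    congr (Phi _)%:E; congr (_ :: _).
    by move: h; rewrite history_rcons => -[].
  rewrite (nneseries_finite_support e_bij (nb_uniq adj (last x t))).
    rewrite sumEFin mulr_sumr; congr (_%:E).
    by apply: eq_bigr => y _; rewrite history_prob_rcons mulrA.
  move=> y; rewrite mem_nb// => /negbTE ny.
  by rewrite /F history_prob_rcons /step_prob ny mulr0 mul0r.
- by move=> k; exact: measurable_history.
- apply: measurable_funTS.
  exact: (measurable_trajectory_fun (size t).+1 n.+1 (fun s => (Phi s)%:E)).
- by move=> w _; rewrite lee_fin.
- apply/trivIsetP => i j _ _ ij; rewrite -subset0 => w [].
  rewrite !history_rcons => -[_ /= ->] [_ /= /(bij_inj e_bij) ji].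
  by rewrite ji eqxx in ij.
Qed.

Lemma walk_integral n x (Phi : seq V -> R) : (forall s, 0 <= Phi s) ->
  (\int[PW x]_w (Phi (trajectory (S := S) 0 n.+1 w))%:E =
   (walkE adj K n x (fun s => Phi (x :: s)))%:E)%E.
Proof.
move=> Phi0.
have mh := measurable_history x [::].
have mPhi : measurable_fun setT
    (fun w => (Phi (trajectory (S := S) 0 n.+1 w))%:E : \bar R).
  exact: (measurable_trajectory_fun 0 n.+1 (fun s => (Phi s)%:E)).
(* Under [PW x] the equality [S 0 = x] holds only almost surely. *)
rewrite (@ge0_negligible_integral _ _ _ (PW x) setT (~` history x [::]))//.
- rewrite setTD setCK.
  have := @integral_history n x [::] (fun s => Phi (x :: s)) (fun s => Phi0 _).
  rewrite /history_prob big_ord0 mul1r /= => <-.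
  apply: eq_integral => w; rewrite inE => h.
  by rewrite /trajectory/= (h 0%N).
- exact: measurableC.
- by move=> w _; rewrite lee_fin.
- transitivity (1 - PW x (history x [::]))%E; first exact: probability_setC.
  by rewrite historyE /history_prob big_ord0 subee.
Qed.

End walk_law.

Section walk_percolation_law.
Context {R : realType} {V : choiceType} {adj : rel V} {e : nat -> V}.
Hypotheses (G_bounded : bounded_degrees adj) (e_bij : bijective e).
Context {dW : measure_display} {W : measurableType dW} {S : nat -> W -> V}
  {PW : V -> probability W R}.
Hypothesis S_walk : is_simple_random_walk adj S PW.
Context {dX : measure_display} {X : measurableType dX}.
Context {omega : X -> {fset V} -> bool} {P : probability X R}.
Local Notation K := (step_prob R adj).
Local Notation C := (cluster_of adj omega).
Local Open Scope ereal_scope.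

Lemma measurable_trajectory_prod m n (G : seq V -> X -> \bar R) :
  (forall s, measurable_fun setT (G s)) ->
  measurable_fun setT (fun z : W * X => G (trajectory (S := S) m n z.1) z.2).
Proof.
move=> mG.
have mS k v : measurable [set z : W * X | S k z.1 = v].
  rewrite -[X in measurable X]setTI.
  have := @measurable_fst _ _ W X.
  move=> /(_ measurableT _ (S_walk.1 k v)).
  by [].
exact: (@measurable_trajectory R V e e_bij _ _ (fun k (z : W * X) => S k z.1)
  mS m n (fun s z => G s z.2)
  (fun s => measurableT_comp (mG s) (@measurable_snd _ _ W X))).
Qed.

Lemma UE n (z : W * X) : U R adj S omega n z =
  counting (C z.2 (trajectory (S := S) 0 n.+1 z.1)).
Proof.
rewrite /U; congr counting; apply/seteqP; split=> y.
  move=> [i /= ni /reach_path h]; apply/cluster_mem; exists (S i z.1) => //.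
  by apply: map_f; rewrite mem_iota.
move=> /cluster_mem[v /mapP[i]]; rewrite mem_iota => /andP[_ ni] -> h.
by exists i => //; exact/reach_path.
Qed.

Lemma fubini_walk_percolation (G : seq V -> X -> \bar R) n x :
  (forall s, measurable_fun setT (G s)) -> (forall s w, 0 <= G s w) ->
  \int[PW x \x P]_z G (trajectory (S := S) 0 n.+1 z.1) z.2 =
  \int[PW x]_w (\int[P]_w' G (trajectory (S := S) 0 n.+1 w) w').
Proof.
move=> mG G0.
rewrite (@fubini_tonelli1 _ _ _ _ _ (PW x) P
  (fun z => G (trajectory (S := S) 0 n.+1 z.1) z.2))//.
exact: measurable_trajectory_prod.
Qed.

Lemma integral_walk_le (G : seq V -> X -> \bar R) (B : seq V -> R) n x :
  (forall s, measurable_fun setT (G s)) -> (forall s w, 0 <= G s w) ->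
  (forall s, (0 <= B s)%R) ->
  (forall s, size s = n.+1 -> \int[P]_w G s w <= (B s)%:E) ->
  \int[PW x \x P]_z G (trajectory (S := S) 0 n.+1 z.1) z.2 <=
  (walkE adj K n x (fun s => B (x :: s)))%:E.
Proof.
move=> mG G0 B0 GB; rewrite fubini_walk_percolation//.
rewrite -(walk_integral G_bounded e_bij S_walk)//.
apply: ge0_le_integral => //.
- by move=> w _; apply: integral_ge0.
- exact: (measurable_trajectory_fun e_bij S_walk 0 n.+1 (fun s => \int[P]_w G s w)).
- exact: (measurable_trajectory_fun e_bij S_walk 0 n.+1 (fun s => (B s)%:E)).
- by move=> w _; apply: GB; rewrite size_map size_iota.
Qed.

Lemma integral_walk_ge (G : seq V -> X -> \bar R) (B : seq V -> R) n x :
  (forall s, measurable_fun setT (G s)) -> (forall s w, 0 <= G s w) ->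
  (forall s, (0 <= B s)%R) ->
  (forall s, size s = n.+1 -> (B s)%:E <= \int[P]_w G s w) ->
  (walkE adj K n x (fun s => B (x :: s)))%:E <=
  \int[PW x \x P]_z G (trajectory (S := S) 0 n.+1 z.1) z.2.
Proof.
move=> mG G0 B0 GB; rewrite fubini_walk_percolation//.
rewrite -(walk_integral G_bounded e_bij S_walk)//.
apply: ge0_le_integral => //.
- by move=> w _; rewrite lee_fin.
- exact: (measurable_trajectory_fun e_bij S_walk 0 n.+1 (fun s => (B s)%:E)).
- exact: (measurable_trajectory_fun e_bij S_walk 0 n.+1 (fun s => \int[P]_w G s w)).
- by move=> w _; apply: GB; rewrite size_map size_iota.
Qed.

End walk_percolation_law.

(** * Bounds on Lambda *)

Section homogeneous_walk.
Context {R : realType} {V : choiceType} {adj : rel V}.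
Hypothesis G_bounded : bounded_degrees adj.
Variables (K : V -> V -> R) (m : seq V -> R) (o : V).
Hypotheses (K_stoch : stochastic adj K) (m_nil : m [::] = 0)
  (K_hom : forall x, exists f, [/\ graph_isomorphism adj adj f,
     forall a b, K (f a) (f b) = K a b, forall s, m (map f s) = m s & f o = x]).

Definition increment n : R := walkE adj K n o (fun s => m (o :: s) - m s).

(** The first vertex is peeled off; what follows is, up to an automorphism, the same walk with one
    step less. Homogeneity takes the place of time reversal, so the drifted walk on the square
    lattice is covered too. *)
Lemma walkE_total n :
  walkE adj K n o (fun s => m (o :: s)) = \sum_(k < n.+1) increment k.
Proof.
elim: n => [|n IH]; first by rewrite big_ord1 /increment /= m_nil subr0.
transitivity (walkE adj K n o (fun s => m (o :: s)) + increment n.+1); last first.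
  by rewrite IH [RHS]big_ord_recr.
have -> : walkE adj K n o (fun s => m (o :: s)) = walkE adj K n.+1 o m.
  rewrite /= -[LHS]mul1r -(K_stoch.2 o) mulr_suml; apply: eq_bigr => y _.
  have [f [fa fK fm <-]] := K_hom y.
  rewrite (@walkE_aut _ _ _ G_bounded K n o _ f fa fK); congr (_ * walkE _ _ _ _ _).
  by apply/funext => s; rewrite -map_cons fm.
rewrite /increment -walkED; congr walkE; apply/funext => s.
by rewrite addrC subrK.
Qed.

Lemma increment_decreasing n n' : (n <= n')%N ->
  (forall s s', m (o :: s ++ s') - m (s ++ s') <= m (o :: s) - m s) ->
  increment n' <= increment n.
Proof.
move=> nn' mm; rewrite -(subnKC nn') /increment walkE_split.
apply: walkE_le; [exact: G_bounded|exact: K_stoch.1|move=> s _ _].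
rewrite -[leRHS](walkE_cst (n' - n) (last o s) _ K_stoch).
by apply: walkE_le; [exact: G_bounded|exact: K_stoch.1|move=> s' _ _; exact: mm].
Qed.

End homogeneous_walk.

Section last_exit.
Context {R : realType} {V : choiceType} {adj : rel V}.
Variables (K : V -> V -> R) (v b : V -> seq V -> R).
Hypotheses (v_cons : forall x y s, v x (y :: s) = v y s + b x (y :: s))
  (v_nil : forall x, v x [::] = b x [::]).

(** [v x s] tells how much the list [x :: s] touches a target and [b x s] is the part of it for
    which [x] is the last vertex to do so. The target is touched by visiting it in the renewal
    equation, and by a cluster containing it in [psi_last_exit]. *)
Lemma walkE_last_exit n x : walkE adj K n x (v x) =
  \sum_(j < n.+1) walkE adj K j x
    (fun s => walkE adj K (n - j) (last x s) (b (last x s))).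
Proof.
elim: n x => [|n IH] x; first by rewrite big_ord1 /= v_nil.
rewrite big_ord_recl subn0 [X in X + _]/= /=.
transitivity (\sum_(y <- nb adj x) (K x y * walkE adj K n y (fun s => b x (y :: s))
    + K x y * walkE adj K n y (v y))).
  apply: eq_bigr => y _; rewrite -mulrDr -walkED; congr (_ * walkE _ _ _ _ _).
  by apply/funext => s; rewrite v_cons addrC.
rewrite big_split /=; congr (_ + _).
under eq_bigr do rewrite IH mulr_sumr.
rewrite exchange_big /=; apply: eq_bigr => j _.
by apply: eq_bigr => y _.
Qed.

End last_exit.

Section Lambda_bounds.
Context {R : realType} {V : choiceType} {adj : rel V} {e : nat -> V}.
Hypotheses (adj_sym : symmetric adj)
  (G_bounded : bounded_degrees adj) (e_bij : bijective e).
Context {dW : measure_display} {W : measurableType dW} {S : nat -> W -> V}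
  {PW : V -> probability W R}.
Hypothesis S_walk : is_simple_random_walk adj S PW.
Context {dX : measure_display} {X : measurableType dX}.
Context {omega : X -> {fset V} -> bool} {q : R} {P : probability X R}.
Hypothesis perc : is_bernoulli_percolation adj omega q P.
Variable o : V.
Local Notation K := (step_prob R adj).
Local Notation C := (cluster_of adj omega).
Local Notation Lambda := (Lambda adj S omega (PW o) P).
Implicit Types (theta : R) (n : nat).

(** The term of index [n.+1] in [Lambda] is the logarithm of this integral divided by [n.+1]. *)
Definition partition_function theta n : \bar R :=
  (\int[PW o \x P]_z expeR (theta%:E * U R adj S omega n z))%E.

Lemma partition_functionE theta n : partition_function theta n =
  (\int[PW o \x P]_z expeR (theta%:E *
     counting (C z.2 (trajectory (S := S) 0 n.+1 z.1))))%E.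
Proof. by apply: eq_integral => z _; rewrite UE. Qed.

Let mG theta s :
  measurable_fun setT (fun w => expeR (theta%:E * counting (C w s))%E).
Proof.
apply: measurable_expeR; apply: measurable_funeM.
exact: (measurable_counting adj_sym perc e_bij).
Qed.

Lemma partition_function_le theta n (B : seq V -> R) : (forall s, 0 <= B s) ->
  (forall s, size s = n.+1 ->
     \int[P]_w expeR (theta%:E * counting (C w s)) <= (B s)%:E)%E ->
  (partition_function theta n <= (walkE adj K n o (fun s => B (o :: s)))%:E)%E.
Proof.
move=> B0 hB; rewrite partition_functionE.
apply: (integral_walk_le G_bounded e_bij S_walk
  (G := fun s w => expeR (theta%:E * counting (C w s))%E)) => //.
by move=> s w; exact: expeR_ge0.
Qed.

Lemma partition_function_ge theta n (B : seq V -> R) : (forall s, 0 <= B s) ->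
  (forall s, size s = n.+1 ->
     (B s)%:E <= \int[P]_w expeR (theta%:E * counting (C w s)))%E ->
  ((walkE adj K n o (fun s => B (o :: s)))%:E <= partition_function theta n)%E.
Proof.
move=> B0 hB; rewrite partition_functionE.
apply: (integral_walk_ge G_bounded e_bij S_walk
  (G := fun s w => expeR (theta%:E * counting (C w s))%E)) => //.
by move=> s w; exact: expeR_ge0.
Qed.

Lemma Lambda_le theta n (B : R) : 0 < B ->
  (partition_function theta n <= B%:E)%E ->
  (Lambda theta <= (ln B / n.+1%:R)%:E)%E.
Proof.
move=> B0 hB.
apply: le_trans (_ : (_ <= lne (partition_function theta n) / n.+1%:R%:E)%E) _.
  by apply: ereal_inf_lbound; exists n.+1.
have n0 : 0 < n.+1%:R :> R by [].
rewrite inver gt_eqF// lee_pdivrMr// -EFinM divfK ?gt_eqF//.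
rewrite -lne_EFin// lee_lne// in_itv/= ?leey ?andbT.
  by apply: integral_ge0 => z _; exact: expeR_ge0.
by rewrite lee_fin ltW.
Qed.

Lemma Lambda_ge theta (c : R) :
  (forall n, (expR (n.+1%:R * c))%:E <= partition_function theta n)%E ->
  (c%:E <= Lambda theta)%E.
Proof.
move=> h; apply: le_ereal_inf_tmp => _ [[//|n] _ <-].
have n0 : 0 < n.+1%:R :> R by [].
rewrite inver gt_eqF// lee_pdivlMr// -EFinM.
have -> : c * n.+1%:R = ln (expR (n.+1%:R * c)) by rewrite expRK mulrC.
rewrite -lne_EFin ?expR_gt0// lee_lne//.
- by rewrite in_itv/= leey andbT lee_fin expR_ge0.
- rewrite in_itv/= leey andbT.
  by apply: integral_ge0 => z _; exact: expeR_ge0.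
Qed.

End Lambda_bounds.

(** * Escape of the walk from the cluster of its starting point *)

Lemma hitting_time_infinite {R : realType} (V : choiceType) dW
    (W : measurableType dW) (S : nat -> W -> V) (A : set V) w :
  hitting_time R S A w = +oo%E <-> forall n, (1 <= n)%N -> ~ A (S n w).
Proof.
rewrite /hitting_time ereal_inf_pinfty; split.
  by move=> h n n1 An; have /= := h n%:R%:E (ex_intro2 _ _ n (conj n1 An) erefl).
by move=> h x [n [n1 An] _]; case: (h n n1 An).
Qed.

Section escape.
Context {R : realType} {V : choiceType} {adj : rel V} {e : nat -> V}.
Hypotheses (adj_sym : symmetric adj) (G_transitive : vertex_transitive adj)
  (G_bounded : bounded_degrees adj) (e_bij : bijective e).
Context {dW : measure_display} {W : measurableType dW} {S : nat -> W -> V}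
  {PW : V -> probability W R}.
Hypothesis S_walk : is_simple_random_walk adj S PW.
Context {dX : measure_display} {X : measurableType dX}.
Context {omega : X -> {fset V} -> bool} {q : R} {P : probability X R}.
Hypothesis perc : is_bernoulli_percolation adj omega q P.
Variable o : V.
Local Notation K := (step_prob R adj).
Local Notation C := (cluster_of adj omega).
Hypothesis chi_fin : (\int[P]_w counting (C w [:: o]) < +oo)%E.
Local Notation fresh := (fresh (adj := adj) (omega := omega)).
Local Notation beta := (beta (adj := adj) (omega := omega) (P := P)).
Local Notation traj n w := (trajectory (S := S) 1 n w).

Let avoid n w : set W := [set w' | ~ exists2 z, z \in traj n w' & C w [:: o] z].

(** [behead] drops the position at time 0, since escape concerns positive times only. *)
Let G (s : seq V) w : \bar R := counting (fresh w o (behead s)).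
Let J (s : seq V) w : \bar R := (\1_[set w | fresh w o (behead s) o] w)%:E.

Lemma cluster_self w : C w [:: o] o.
Proof. by apply: reach_mem; rewrite inE. Qed.

Let mG s : measurable_fun setT (G s).
Proof. exact: (measurable_counting_fresh adj_sym perc e_bij). Qed.

Let mI s : measurable_fun setT (J s).
Proof.
apply/measurable_EFinP; apply: measurable_indic.
exact: (measurable_fresh adj_sym perc e_bij).
Qed.

Let G0 s w : (0 <= G s w)%E. Proof. exact: counting_ge0. Qed.
Let I0 s w : (0 <= J s w)%E. Proof. by rewrite lee_fin. Qed.

Let GE s w : G s w = (counting (C w [:: o]) * J s w)%E.
Proof.
rewrite /G /J indicE.
have [h|h] := pselect (fresh w o (behead s) o).
  rewrite mem_set// mule1; congr counting; apply/seteqP; split=> [y []//|y Cy].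
  by split=> //; exact: h.2.
rewrite memNset// mule0 (@counting_seq _ _ [::])// => y.
by split=> // -[_ h']; case: h; split=> //; exact: cluster_self.
Qed.

Let IE n w w' : J (trajectory (S := S) 0 n.+1 w') w = (\1_(avoid n w) w')%:E.
Proof.
rewrite /J !indicE; congr ((nat_of_bool _)%:R%:E).
apply/idP/idP; rewrite !inE; first by case.
by move=> h; split=> //; exact: cluster_self.
Qed.

Let measurable_avoid n w : measurable (avoid n w).
Proof.
rewrite (_ : avoid n w = (fun w' => J (trajectory (S := S) 0 n.+1 w') w) @^-1` [set 1%E]).
  rewrite -[X in measurable X]setTI.
  by apply: (measurable_trajectory_fun e_bij S_walk 0 n.+1 (fun s => J s w)).
apply/seteqP; split=> w'; rewrite /= IE indicE.
  by move=> h; rewrite mem_set.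
by case: (boolP (w' \in avoid n w)) => [/set_mem//|_ /= /eqP];
  rewrite eqe eq_sym oner_eq0.
Qed.

Let PavoidE n w :
  PW o (avoid n w) = (\int[PW o]_w' J (trajectory (S := S) 0 n.+1 w') w)%E.
Proof.
transitivity (\int[PW o]_w' (\1_(avoid n w) w')%:E)%E.
  by rewrite integral_indic ?setIT.
by apply: eq_integral => w' _; rewrite IE.
Qed.

Let mPavoid n : measurable_fun setT (fun w => PW o (avoid n w)).
Proof.
rewrite (_ : (fun w => _) = fubini_G (PW o)
  (fun z => J (trajectory (S := S) 0 n.+1 z.1) z.2)).
  apply: measurable_fun_fubini_tonelli_G => //.
  exact: (measurable_trajectory_prod e_bij S_walk).
by apply/funext => w; rewrite PavoidE.
Qed.

Let f n w : \bar R := (counting (C w [:: o]) * PW o (avoid n w))%E.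

Let mcount := measurable_counting adj_sym perc e_bij [:: o].

Let mf n : measurable_fun setT (f n).
Proof. exact: emeasurable_funM. Qed.

Let int_f n :
  (\int[P]_w f n w = (walkE adj K n o (fun s => beta o s))%:E)%E.
Proof.
have mGp := measurable_trajectory_prod e_bij S_walk 0 n.+1 mG.
transitivity (\int[P]_w \int[PW o]_w' G (trajectory (S := S) 0 n.+1 w') w)%E.
  apply: eq_integral => w _; rewrite /f PavoidE -ge0_integralZl//.
  - by apply: eq_integral => w' _; rewrite GE.
  - exact: (measurable_trajectory_fun e_bij S_walk 0 n.+1 (fun s => J s w)).
  - exact: counting_ge0.
rewrite -(@fubini_tonelli _ _ _ _ _ (PW o) P _ mGp)//.
transitivity (\int[PW o]_w'
    (beta o (behead (trajectory (S := S) 0 n.+1 w')))%:E)%E.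
  apply: eq_integral => w' _.
  rewrite -(betaE adj_sym perc G_transitive e_bij chi_fin).
  by apply: eq_integral => w _; rewrite /G.
rewrite (walk_integral G_bounded e_bij S_walk n o
  (Phi := fun s => beta o (behead s)))// => s.
exact: (beta_ge0 adj_sym perc G_transitive e_bij chi_fin).
Qed.

Let avoid_infty w :
  [set w' | hitting_time R S (Defs.cluster adj omega w o) w' = +oo%E] =
  \bigcap_n avoid n w.
Proof.
have clE : Defs.cluster adj omega w o = C w [:: o].
  by apply/seteqP; split=> y /reach_path.
rewrite clE; apply/seteqP; split=> w' /=.
  move=> /hitting_time_infinite h n _ [z /mapP[i]].
  by rewrite mem_iota => /andP[i1 _] -> Ci; exact: (h i).
move=> h; apply/hitting_time_infinite => n n1 Cn.
apply: (h n I); exists (S n w') => //; apply: map_f.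
by rewrite mem_iota n1 add1n ltnS leqnn.
Qed.

Let avoid_decr w : nonincreasing_seq (avoid ^~ w).
Proof.
move=> n n' nn'; apply/subsetPset => w' h [z /mapP[i]].
rewrite mem_iota => /andP[i1 ni] -> Ci; apply: h; exists (S i w') => //.
by apply: map_f; rewrite mem_iota i1 (leq_trans ni)// leq_add2l.
Qed.

Let Pavoid_cvg w : PW o (avoid n w) @[n --> \oo] --> PW o (\bigcap_n avoid n w).
Proof.
apply: (nonincreasing_cvg_mu (mu := PW o)) => //.
- by rewrite (le_lt_trans (probability_le1 _ _))// ltry.
- exact: bigcapT_measurable.
Qed.

(** By Fubini the increment of index [n] is the mean of the cluster size times the probability that
    the walk avoids the cluster up to time [n]. The avoidance events decrease to escape, and the
    integrable cluster size dominates. *)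
Lemma escape_constant_cvg :
  (walkE adj K n o (fun s => beta o s))%:E @[n --> \oo] -->
  escape_constant adj S omega (PW o) P o.
Proof.
have clE w : Defs.cluster adj omega w o = C w [:: o].
  by apply/seteqP; split=> y /reach_path.
pose g w := (counting (C w [:: o]) * PW o (\bigcap_n avoid n w))%E.
have -> : escape_constant adj S omega (PW o) P o = (\int[P]_w g w)%E.
  by apply: eq_integral => w _; rewrite /g -avoid_infty -clE.
have mg : measurable_fun setT g.
  apply: emeasurable_funM; first exact: mcount.
  exact: (emeasurable_fun_cvg (fun n w => PW o (avoid n w))).
have c0 w : (0 <= counting (C w [:: o]) :> \bar R)%E by exact: counting_ge0.
have icount : P.-integrable setT (fun w => counting (C w [:: o]) : \bar R).
  apply/integrableP; split; first exact: mcount.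
  by under eq_integral do rewrite gee0_abs//.
have := @dominated_convergence _ _ _ P setT measurableT f g
  (fun w => counting (C w [:: o])) mf mg _ icount _.
case.
- have := integrable_ae measurableT icount; apply: filterS => w /(_ I) fin _.
  exact: cvgeZl.
- apply: aeW => w n _; rewrite gee0_abs ?mule_ge0//.
  by rewrite -[leRHS]mule1; apply: lee_wpmul2l => //; exact: probability_le1.
- by move=> _ _; under eq_fun do rewrite int_f.
Qed.

End escape.

(** * Bounds on [Lambda] by mean increments *)

Section mean_bounds.
Context {R : realType} {V : choiceType} {adj : rel V} {e : nat -> V}.
Hypotheses (adj_sym : symmetric adj)
  (V_infinite : infinite_set [set: V]) (G_connected : connected_graph adj)
  (G_transitive : vertex_transitive adj)
  (G_bounded : bounded_degrees adj) (e_bij : bijective e).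
Context {dW : measure_display} {W : measurableType dW} {S : nat -> W -> V}
  {PW : V -> probability W R}.
Hypothesis S_walk : is_simple_random_walk adj S PW.
Context {dX : measure_display} {X : measurableType dX}.
Context {omega : X -> {fset V} -> bool} {q : R} {P : probability X R}.
Hypotheses (q0 : 0 <= q) (q1 : q <= 1)
  (perc : is_bernoulli_percolation adj omega q P).
Variable o : V.
Local Notation K := (step_prob R adj).
Local Notation C := (cluster_of adj omega).
Hypothesis chi_fin : (\int[P]_w counting (C w [:: o]) < +oo)%E.
Local Notation mean_size := (mean_size (adj := adj) (omega := omega) (P := P)).
Local Notation beta := (beta (adj := adj) (omega := omega) (P := P)).
Local Notation Lambda := (Lambda adj S omega (PW o) P).

Let K_stoch : stochastic adj K.
Proof. exact: step_prob_stochastic. Qed.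

Definition mean_increment n : R := walkE adj K n o (fun s => beta o s).

Let K_hom x : exists f, [/\ graph_isomorphism adj adj f,
  forall a b, K (f a) (f b) = K a b,
  forall s, mean_size (map f s) = mean_size s & f o = x].
Proof.
have [f fa fo] := G_transitive o x; exists f; split=> // [a b|s].
  exact: step_prob_aut.
exact: (mean_size_aut adj_sym perc e_bij).
Qed.

Lemma mean_total n : walkE adj K n o (fun s => mean_size (o :: s)) =
  \sum_(k < n.+1) mean_increment k.
Proof.
exact: (walkE_total G_bounded K_stoch mean_size_nil K_hom).
Qed.

Lemma mean_increment_decr n n' : (n <= n')%N ->
  mean_increment n' <= mean_increment n.
Proof.
move=> nn'; apply: (increment_decreasing G_bounded (m := mean_size) K_stoch) => // s s'.
apply: (beta_sub adj_sym perc G_transitive e_bij chi_fin) => z zs.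
by rewrite mem_cat zs.
Qed.

Lemma mean_increment_ge0 n : 0 <= mean_increment n.
Proof.
apply: walkE_ge0; [exact: G_bounded|exact: K_stoch.1|move=> s].
exact: (beta_ge0 adj_sym perc G_transitive e_bij chi_fin).
Qed.

Lemma mean_increment_le n : mean_increment n <= beta o [::].
Proof. exact: (@mean_increment_decr 0). Qed.

(** Jensen's inequality is applied to the percolation along a fixed path, then to the walk. *)
Lemma Lambda_lower_mean (theta c : R) : 0 <= theta ->
  (forall n, c * n.+1%:R <= \sum_(k < n.+1) mean_increment k) ->
  ((theta * c)%:E <= Lambda theta)%E.
Proof.
move=> th0 hc; apply: Lambda_ge => n.
apply: le_trans (partition_function_ge adj_sym G_bounded e_bij S_walk perc o
  (B := fun s => expR (theta * mean_size s)) _ _); last 2 first.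
- by move=> s; exact: expR_ge0.
- by move=> s _; exact: (exp_counting_ge adj_sym perc G_transitive e_bij chi_fin).
rewrite lee_fin; apply: le_trans (walkE_jensen G_bounded n o _ K_stoch).
by rewrite ler_expR walkEZ mean_total mulrC -mulrA; apply: ler_wpM2l.
Qed.

(** The second-order bound for [n.+1] clusters is averaged over the walk, and [ln (1 + x) <= x]. A
    single [n] suffices because [Lambda] is an infimum. *)
Lemma Lambda_upper_mean (theta a t : R) n : 0 < theta -> 0 < a ->
  theta <= a / n.+1%:R / 2 ->
  (forall x, (\int[P]_w expeR (a%:E * counting (C w [:: x])) <= t%:E)%E) ->
  (Lambda theta <= (theta * ((\sum_(k < n.+1) mean_increment k) / n.+1%:R) +
     16 * theta ^+ 2 * n.+1%:R / a ^+ 2 * t)%:E)%E.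
Proof.
move=> th0 a0 tha ht.
have t0 : 0 <= t.
  rewrite -lee_fin; apply: le_trans (ht o).
  by apply: integral_ge0 => w _; exact: expeR_ge0.
set D := 16 * theta ^+ 2 * n.+1%:R ^+ 2 / a ^+ 2 * t.
have D0 : 0 <= D.
  by rewrite /D mulr_ge0// divr_ge0 ?mulr_ge0 ?exprn_ge0// ltW.
have hB s : 0 <= 1 + theta * mean_size s + D.
  by rewrite !addr_ge0// mulr_ge0 ?mean_size_ge0// ltW.
set u := \sum_(k < n.+1) _.
have u0 : 0 <= u by apply: sumr_ge0 => k _; exact: mean_increment_ge0.
have x0 : 0 <= theta * u + D by rewrite addr_ge0// mulr_ge0// ltW.
apply: le_trans (Lambda_le (n := n) (B := 1 + (theta * u + D)) _ _) _.
- by rewrite ltr_wpDr.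
- apply: le_trans (partition_function_le adj_sym G_bounded e_bij S_walk perc o
    (B := fun s => 1 + theta * mean_size s + D) hB _) _.
    move=> s sn.
    have := exp_counting_le adj_sym perc G_transitive e_bij chi_fin th0 a0
      (s := s) (t := t).
    by rewrite sn; apply.
  rewrite lee_fin walkED walkED !walkE_cst// walkEZ mean_total.
  by rewrite addrA.
- rewrite lee_fin ler_pdivrMr//.
  apply: le_trans (_ : _ <= theta * u + D) _.
    by apply: le_ln1Dx; rewrite (lt_le_trans _ x0)// ltrN10.
  rewrite mulrDl /D -/u; apply: lerD.
    by rewrite -mulrA divfK.
  rewrite le_eqVlt; apply/orP; left; apply/eqP; field.
  by rewrite gt_eqF.
Qed.

Lemma mean_increment_cvg :
  mean_increment n @[n --> \oo] --> fine (escape_constant adj S omega (PW o) P o) /\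
  escape_constant adj S omega (PW o) P o \is a fin_num.
Proof.
have h := escape_constant_cvg adj_sym G_transitive G_bounded e_bij S_walk perc
  chi_fin.
have fin : escape_constant adj S omega (PW o) P o \is a fin_num.
  have ub n : ((mean_increment n)%:E <= (beta o [::])%:E)%E.
    by rewrite lee_fin mean_increment_le.
  have lb n : (0 <= (mean_increment n)%:E)%E.
    by rewrite lee_fin mean_increment_ge0.
  have cv : cvgn (fun n => (mean_increment n)%:E) by apply/cvg_ex; eexists; exact: h.
  rewrite -(cvg_lim _ h)// ge0_fin_numE.
    by apply: le_lt_trans (ltry (beta o [::])); apply: lime_le => //; exact: nearW.
  by apply: lime_ge => //; exact: nearW.
split=> //.
move: h; rewrite -{1}(fineK fin) => /fine_cvgP[_].
by apply.
Qed.

Let c := fine (escape_constant adj S omega (PW o) P o).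

Lemma mean_increment_ge_escape n : c <= mean_increment n.
Proof.
have [h _] := mean_increment_cvg.
rewrite /c -(cvg_lim _ h)//; apply: nonincreasing_cvgn_ge.
  by move=> i j; exact: mean_increment_decr.
by apply/cvg_ex; eexists; exact: h.
Qed.

Lemma mean_total_split N n : (N <= n)%N ->
  \sum_(k < n) mean_increment k <=
  N%:R * beta o [::] + (n - N)%:R * mean_increment N.
Proof.
move=> Nn; rewrite -(big_mkord xpredT mean_increment) (@big_cat_nat _ _ _ N)//=.
rewrite big_mkord; apply: lerD.
  apply: le_trans (_ : \sum_(i < N) beta o [::] <= _).
    by apply: ler_sum => i _; exact: mean_increment_le.
  by rewrite sumr_const card_ord mulr_natl.
apply: le_trans (_ : \sum_(N <= i < n) mean_increment N <= _).
  rewrite !big_nat; apply: ler_sum => i /andP[Ni _].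
  exact: mean_increment_decr.
by rewrite sumr_const_nat mulr_natl.
Qed.

Lemma mean_total_average eps : 0 < eps -> exists n,
  (\sum_(k < n.+1) mean_increment k) / n.+1%:R <= c + eps.
Proof.
move=> eps0.
have [h _] := mean_increment_cvg.
have [N _ /(_ N (leqnn N)) /= hN] :
    \forall n \near \oo, mean_increment n <= c + eps / 2.
  have e2 : 0 < eps / 2 by rewrite divr_gt0.
  move: (h) => /cvgrPdist_le /(_ _ e2); apply: filterS => n.
  by rewrite distrC => /(le_trans (ler_norm _)); rewrite /c; lra.
have b0 : 0 <= beta o [::].
  exact: (beta_ge0 adj_sym perc G_transitive e_bij chi_fin).
(* [M] is so large that the first [N] increments, each at most [beta o [::]], weigh at most
   [eps / 2] for each of the remaining ones. *)
pose M := (N + Num.bound (N%:R * beta o [::] / (eps / 2)))%N.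
exists M; rewrite ler_pdivrMr//.
have MN : (N <= M.+1)%N by rewrite /M -addnS leq_addr.
apply: le_trans (mean_total_split MN) _.
have c0 : 0 <= c + eps.
  have := mean_increment_ge0 N; lra.
have h3 : N%:R * beta o [::] <= (M.+1 - N)%:R * (eps / 2).
  rewrite -ler_pdivrMr ?divr_gt0//.
  apply: le_trans (ltW (unstable.ltr_bound _)) _.
  by rewrite ler_nat /M -addnS addKn.
have h2 : (M.+1 - N)%:R * mean_increment N <= (M.+1 - N)%:R * (c + eps / 2).
  by apply: ler_wpM2l.
have -> : M.+1%:R = N%:R + (M.+1 - N)%:R :> R by rewrite -natrD subnKC.
have : 0 <= (c + eps) * N%:R by rewrite mulr_ge0.
by lra.
Qed.

Lemma Lambda_linear eps : 0 < eps -> exists2 delta, 0 < delta &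
  forall theta, 0 < theta -> theta < delta ->
    ((theta * c)%:E <= Lambda theta <= (theta * (c + eps))%:E)%E.
Proof.
move=> eps0.
have [a [t [a0 ht]]] := exp_moment q0 q1 adj_sym perc G_bounded G_transitive
  e_bij chi_fin.
have e2 : 0 < eps / 2 by rewrite divr_gt0.
have [n hn] := mean_total_average e2.
have n0 : 0 < n.+1%:R :> R by [].
have t0 : 0 <= t.
  rewrite -lee_fin; apply: le_trans (ht o).
  by apply: integral_ge0 => w _; exact: expeR_ge0.
pose D := 16 * n.+1%:R / a ^+ 2 * t.
have D0 : 0 <= D by rewrite /D mulr_ge0// divr_ge0 ?mulr_ge0 ?exprn_ge0// ltW.
(* [n] is fixed before [theta]. The first bound permits [Lambda_upper_mean]; the second makes the
   quadratic error at most [theta * (eps / 2)], and [D + 1] keeps the divisor positive. *)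
exists (Num.min (a / n.+1%:R / 2) (eps / 2 / (D + 1))).
  by rewrite lt_min !divr_gt0//= ltr_wpDl.
move=> theta th0; rewrite lt_min => /andP[th1 th2]; apply/andP; split.
  apply: Lambda_lower_mean => [|m]; first exact: ltW.
  rewrite mulr_natr -[X in _ *+ X]card_ord -sumr_const.
  by apply: ler_sum => i _; exact: mean_increment_ge_escape.
apply: le_trans (Lambda_upper_mean th0 a0 (ltW th1) ht) _.
rewrite lee_fin.
have -> : 16 * theta ^+ 2 * n.+1%:R / a ^+ 2 * t = theta * (theta * D).
  by rewrite /D; field; rewrite gt_eqF.
rewrite -mulrDr; apply: ler_wpM2l; first exact: ltW.
move: th2; rewrite ltr_pdivlMr ?ltr_wpDl// => th2.
have hD : theta * D <= eps / 2 by apply: le_trans (ltW th2); nra.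
apply: le_trans (lerD hn hD) _.
by rewrite -addrA -splitr.
Qed.

End mean_bounds.

(** * The transient case *)

Section ratio_limits.
Context {R : realType}.
Implicit Types (L : R -> \bar R) (eps delta theta : R).

Lemma ratio_cvg L1 L2 (l : R) :
  (forall eps, 0 < eps -> exists2 delta, 0 < delta &
     forall theta, 0 < theta -> theta < delta ->
       exists2 x : R, (L1 theta / L2 theta = x%:E)%E & `|l - x| <= eps) ->
  (L1 theta / L2 theta)%E @[theta --> 0^'+] --> l%:E.
Proof.
move=> h; apply/fine_cvgP; split.
  have [delta d0 hd] := h 1 ltr01.
  near=> theta; have [||x -> //] := hd theta.
    by near: theta; exact: nbhs_right_gt.
  by near: theta; exact: nbhs_right_lt.
apply/cvgrPdist_le => eps eps0; have [delta d0 hd] := h eps eps0.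
near=> theta; have [||x /= ->//] := hd theta.
  by near: theta; exact: nbhs_right_gt.
by near: theta; exact: nbhs_right_lt.
Unshelve. all: by end_near. Qed.

Lemma ratio_cvg_linear L1 L2 (c1 c2 : R) : 0 <= c1 -> 0 < c2 ->
  (forall eps, 0 < eps -> exists2 delta, 0 < delta &
    forall theta, 0 < theta -> theta < delta ->
      ((theta * c1)%:E <= L1 theta <= (theta * (c1 + eps))%:E)%E) ->
  (forall eps, 0 < eps -> exists2 delta, 0 < delta &
    forall theta, 0 < theta -> theta < delta ->
      ((theta * c2)%:E <= L2 theta <= (theta * (c2 + eps))%:E)%E) ->
  (L1 theta / L2 theta)%E @[theta --> 0^'+] --> (c1 / c2)%:E.
Proof.
move=> c10 c20 h1 h2; apply: ratio_cvg => eps eps0.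
pose r := c1 / c2; have r0 : 0 <= r by rewrite divr_ge0// ltW.
(* Errors [e] in the numerator and in the denominator move the ratio by at most
   [e * (1 + r) / c2]. *)
pose e := eps * c2 / (1 + r).
have e0 : 0 < e by rewrite divr_gt0 ?mulr_gt0// ltr_wpDr.
have [d1 d10 hd1] := h1 e e0; have [d2 d20 hd2] := h2 e e0.
exists (Num.min d1 d2); first by rewrite lt_min d10.
move=> th th0; rewrite lt_min => /andP[/(hd1 _ th0) {}hd1 /(hd2 _ th0) {}hd2].
have fin (L : R -> \bar R) (a b : R) : (a%:E <= L th <= b%:E)%E -> exists2 y : R,
    L th = y%:E & a <= y <= b.
  case: (L th) => [y| |].
  - by rewrite !lee_fin => ?; exists y.
  - by rewrite leye_eq andbF.
  - by rewrite leeNy_eq.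
have [y1 -> /andP[y1l y1u]] := fin _ _ _ hd1.
have [y2 -> /andP[y2l y2u]] := fin _ _ _ hd2.
have y20 : 0 < y2 by apply: lt_le_trans y2l; rewrite mulr_gt0.
exists (y1 / y2); first by rewrite inver gt_eqF.
have re : e * (1 + r) = eps * c2 by rewrite divfK// gt_eqF// ltr_wpDr.
have c1E : c1 = r * c2 by rewrite /r divfK// gt_eqF.
have rr : 0 <= e * r by rewrite mulr_ge0// ltW.
have ez : 0 <= e * th by rewrite mulr_ge0// ltW.
have epy : th * (eps * c2) <= eps * y2.
  by rewrite mulrCA; apply: ler_wpM2l => //; exact: ltW.
have m1 : r * y2 <= r * (th * (c2 + e)) by apply: ler_wpM2l.
have m2 : r * (th * c2) <= r * y2 by apply: ler_wpM2l.
have re' : th * e + th * (e * r) = th * (eps * c2) by rewrite -re; ring.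
have thr : 0 <= th * (e * r) by rewrite mulr_ge0// ltW.
have up : y1 / y2 <= r + eps.
  by rewrite ler_pdivrMr// mulrDl; move: y1u m2; rewrite c1E; lra.
have lo : r - eps <= y1 / y2.
  by rewrite ler_pdivlMr// mulrBl; move: y1l m1; rewrite c1E; lra.
by rewrite ler_norml -/r; apply/andP; split; lra.
Qed.

End ratio_limits.

Section transience.
Context {R : realType} {V : choiceType} {adj : rel V} {e : nat -> V}.
Hypotheses (adj_sym : symmetric adj)
  (V_infinite : infinite_set [set: V]) (G_connected : connected_graph adj)
  (G_transitive : vertex_transitive adj)
  (G_bounded : bounded_degrees adj) (e_bij : bijective e).
Context {dW : measure_display} {W : measurableType dW} {S : nat -> W -> V}
  {PW : V -> probability W R}.
Hypothesis S_walk : is_simple_random_walk adj S PW.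
Context {dX : measure_display} {X : measurableType dX}.
Context {omega : X -> {fset V} -> bool} {P : probability X R}.
Hypothesis perc : is_bernoulli_percolation adj omega (0 : R) P.
Variable o : V.
Local Notation C := (cluster_of adj omega).

Lemma chi0_fin : (\int[P]_w counting (C w [:: o]) < +oo)%E.
Proof. by rewrite (mean_size0 adj_sym perc e_bij) ltry. Qed.

Lemma beta0E x s : beta (adj := adj) (omega := omega) (P := P) x s = (x \notin s)%:R.
Proof.
rewrite /beta /mean_size !(mean_size0 adj_sym perc e_bij) /=.
by case: (x \in s) => /=; rewrite ?subrr// -natr1 addrC addKr.
Qed.

(** At parameter 0 the increment of index [n] is the probability of no return up to time [n], hence
    at least that of never returning. *)
Lemma mean_increment0_ge : transient S PW ->
  exists2 c : R, 0 < c & forall n, c <= mean_increment (adj := adj)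
    (omega := omega) (P := P) o n.
Proof.
move=> /(_ o) htr.
pose H := [set w | hitting_time R S [set o] w = +oo%E].
pose A n := [set w | o \notin trajectory (S := S) 1 n w].
have mA k : measurable (A k).
  rewrite -[X in measurable X]setTI.
  rewrite (_ : A k = (fun w => (o \notin behead (trajectory (S := S) 0 k.+1 w))%:R%:E
    : \bar R) @^-1` [set 1%E]).
    exact: (measurable_trajectory_fun e_bij S_walk 0 k.+1
      (fun s => (o \notin behead s)%:R%:E)).
  apply/seteqP; split=> w /=; rewrite /A /=; first by move=> ->.
  by case: (o \notin _) => // /eqP; rewrite eqe eq_sym oner_eq0.
have HA : H = \bigcap_n A n.
  apply/seteqP; split=> w.
    move=> /hitting_time_infinite h k _; apply/negP => /mapP[i].
    by rewrite mem_iota => /andP[i1 _] oE; apply: (h i i1).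
  move=> h; apply/hitting_time_infinite => k k1 /= Sk.
  have /negP := h k I; apply; rewrite -{1}Sk; apply: map_f.
  by rewrite mem_iota k1 add1n ltnS leqnn.
have mH : measurable H by rewrite HA; exact: bigcapT_measurable.
have HC : [set w | (hitting_time R S [set o] w < +oo)%E] = ~` H.
  by apply/seteqP; split=> w /=; rewrite /H /= ltey => /eqP.
have PH : (0 < PW o H)%E.
  rewrite lt_neqAle measure_ge0 andbT; apply/negP => /eqP PH0.
  move: htr; rewrite HC (_ : PW o (~` H) = 1 - PW o H)%E; last exact: probability_setC.
  by rewrite -PH0 sube0 ltxx.
have PHf : PW o H \is a fin_num by rewrite fin_num_measure.
exists (fine (PW o H)); first by rewrite fine_gt0// PH ltey_eq PHf.
move=> k; rewrite -lee_fin fineK//.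
have -> : (mean_increment (adj := adj) (omega := omega) (P := P) o k)%:E =
    (\int[PW o]_w ((o \notin behead (trajectory (S := S) 0 k.+1 w))%:R)%:E)%E.
  rewrite (walk_integral G_bounded e_bij S_walk k o
    (Phi := fun s => (o \notin behead s)%:R))//.
  by congr (walkE _ _ _ _ _)%:E; apply/funext => s; rewrite beta0E.
have -> : (\int[PW o]_w ((o \notin behead (trajectory (S := S) 0 k.+1 w))%:R)%:E)%E
    = PW o (A k).
  transitivity (\int[PW o]_w (\1_(A k) w)%:E)%E.
    by apply: eq_integral => w _; rewrite indicE mem_setE.
  by rewrite integral_indic ?setIT.
by apply: le_measure; rewrite ?inE// HA => w; exact.
Qed.

Lemma escape_constant0_gt0 : transient S PW ->
  0 < fine (escape_constant adj S omega (PW o) P o).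
Proof.
move=> tr; have [c c0 hc] := mean_increment0_ge tr.
have [h _] := mean_increment_cvg adj_sym V_infinite G_connected
  G_transitive G_bounded e_bij S_walk perc chi0_fin.
apply: lt_le_trans c0 _; rewrite -(cvg_lim _ h)//; apply: limr_ge.
  by apply/cvg_ex; eexists; exact: h.
exact: nearW.
Qed.

End transience.

(** * The line *)

Lemma exists_minimizer (V : eqType) (h : V -> int) (s : seq V) : (0 < size s)%N ->
  exists2 a, a \in s & forall v, v \in s -> h a <= h v.
Proof.
elim: s => // x [|y s] IH _.
  by exists x => [|v]; rewrite !inE// => /eqP ->.
have [//|a aS ha] := IH; have [xa|ax] := leP (h x) (h a).
  exists x => [|v]; first by rewrite inE eqxx.
  by rewrite inE => /predU1P[->//|/ha]; apply: le_trans.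
exists a => [|v]; first by rewrite inE aS orbT.
by rewrite inE => /predU1P[->|/ha//]; exact: ltW.
Qed.

Lemma countingU_le {R : realType} (V : choiceType) (e : nat -> V) (A B : set V) :
  bijective e -> (counting (A `|` B) <= counting A + counting B :> \bar R)%E.
Proof.
move=> eb; have -> : A `|` B = A `|` (B `\` A).
  apply/seteqP; split=> y; last by move=> [|[]]; [left|right].
  move=> [Ay|By]; first by left.
  by have [Ay|Ay] := pselect (A y); [left|right].
rewrite (countingU eb); last by rewrite -subset0 => y [Ay [_]].
by apply: leeD2l; apply: counting_le => y [].
Qed.

Definition cosh {R : realType} (x : R) : R := (expR x + expR (- x)) / 2.

Lemma cosh_gt1 {R : realType} (x : R) : 0 < x -> 1 < cosh x.
Proof.
move=> x0; rewrite /cosh ltr_pdivlMr// mul1r expRN.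
set y := expR x; have y1 : 1 < y by rewrite -expR0 ltr_expR.
have y0 : 0 < y by apply: lt_trans y1.
have yy : y * y^-1 = 1 by rewrite divff// gt_eqF.
have : 0 < y^-1 by rewrite invr_gt0.
have : (y - 1) * (y - 1) > 0 by rewrite mulr_gt0// subr_gt0.
move=> h v0; have : 0 < (y - 1) * (y - 1) * y^-1 by rewrite mulr_gt0.
have -> : (y - 1) * (y - 1) * y^-1 = y - 2 + y^-1.
  have -> : (y - 1) * (y - 1) * y^-1 = y * (y * y^-1) - 2 * (y * y^-1) + y^-1 by ring.
  by rewrite yy; ring.
lra.
Qed.

Section line.
Context {R : realType} {V : choiceType} {adj : rel V} {e : nat -> V}.
Variable h : V -> int.
Hypotheses (h_bij : bijective h)
  (adjE : forall x y, adj x y = (`|h x - h y| == 1)).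
Hypotheses (G_bounded : bounded_degrees adj) (e_bij : bijective e).
Local Notation K := (step_prob R adj).

Lemma line_nb x : exists y z, [/\ perm_eq (nb adj x) [:: y; z],
  h y = h x + 1 & h z = h x - 1].
Proof.
have [g hK gK] := h_bij; exists (g (h x + 1)), (g (h x - 1)); split=> //.
apply: uniq_perm; first exact: nb_uniq.
  by rewrite /= inE (can_eq gK) andbT; lia.
move=> v; rewrite mem_nb// adjE !inE -!(can2_eq hK gK).
by apply/idP/idP; lia.
Qed.

Lemma line_step x (F : V -> R) : exists y z,
  [/\ h y = h x + 1, h z = h x - 1 &
   \sum_(v <- nb adj x) K x v * F v = (F y + F z) / 2].
Proof.
have [y [z [xyz hy hz]]] := line_nb x; exists y, z; split=> //.
have deg : degree adj x = 2%N by rewrite /degree -/(size (nb adj x)) (perm_size xyz).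
have adjy : adj x y by rewrite -mem_nb// (perm_mem xyz) inE eqxx.
have adjz : adj x z by rewrite -mem_nb// (perm_mem xyz) !inE eqxx orbT.
rewrite (perm_big _ xyz)/= !big_cons big_nil /step_prob adjy adjz deg.
by field.
Qed.

(** A path cannot jump over an integer. *)
Lemma line_intermediate x s (k : nat) : path adj x s ->
  h x + k%:Z <= h (last x s) -> exists2 v, v \in x :: s & h v = h x + k%:Z.
Proof.
elim: s x k => [|y s IH] x k /=.
  by move=> _ xk; exists x; rewrite ?inE//; lia.
move=> /andP[]; rewrite adjE => xy ps hl.
have [k0|k0] := eqVneq k 0%N; first by exists x; rewrite ?inE ?eqxx// k0; lia.
have [k' hk'] : exists k' : nat, h x + k%:Z = h y + k'%:Z.
  have [yx|yx] := leP (h y) (h x); first by exists k.+1; lia.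
  by exists k.-1; lia.
rewrite hk' in hl *; have [v vs hv] := IH _ _ ps hl.
by exists v => //; rewrite inE vs orbT.
Qed.

Lemma line_range x s : path adj x s ->
  h (last x s) - h x + 1 <= (size (undup (x :: s)))%:Z.
Proof.
move=> ps; have [hl|hl] := leP (h x) (h (last x s)); last first.
  have : (0 < size (undup (x :: s)))%N by rewrite -has_predT; apply/hasP; exists x;
    rewrite // mem_undup inE eqxx.
  by lia.
have [g hK gK] := h_bij.
pose n := `|h (last x s) - h x|%N.
pose l := [seq g (h x + k%:Z) | k <- iota 0 n.+1].
have ul : uniq l.
  by rewrite map_inj_uniq ?iota_uniq// => i j /(can_inj gK); lia.
have : (size l <= size (undup (x :: s)))%N.
  apply: uniq_leq_size => // v /mapP[k]; rewrite mem_iota => kn ->.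
  have [|u us hu] := @line_intermediate x s k ps; first by rewrite /n in kn; lia.
  by rewrite mem_undup -hu hK.
by rewrite size_map size_iota /n; lia.
Qed.

Definition hr (v : V) : R := (h v)%:~R.

Lemma walkE_line_last theta n x :
  walkE adj K n x (fun s => expR (theta * (hr (last x s) - hr x))) = cosh theta ^+ n.
Proof.
elim: n x => [|n IH] x; first by rewrite /= subrr mulr0 expR0.
have step v : walkE adj K n v (fun s => expR (theta * (hr (last x (v :: s)) - hr x))) =
    expR (theta * (hr v - hr x)) * cosh theta ^+ n.
  rewrite -(IH v) -walkEZ; congr walkE; apply/funext => s.
  by rewrite /= -expRD; congr expR; ring.
have [y [z [hy hz hF]]] := line_step x (fun v => expR (theta * (hr v - hr x)) * cosh theta ^+ n).
transitivity (\sum_(v <- nb adj x) K x v *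
    (expR (theta * (hr v - hr x)) * cosh theta ^+ n)).
  by apply: eq_bigr => v _; congr (_ * _); exact: step.
rewrite hF /hr hy hz exprS /cosh rmorphD rmorphB /=.
have -> : (h x)%:~R + 1%:~R - (h x)%:~R = 1 :> R by ring.
have -> : (h x)%:~R - 1%:~R - (h x)%:~R = -1 :> R by ring.
by rewrite mulr1 mulrN1; field.
Qed.

(** It dominates the exponential of [theta] times the largest height, and with [- theta] that of
    [- theta] times the smallest one. The product of both dominates the exponential moment of the
    span at a polynomial cost. *)
Definition exp_sum theta (s : seq V) : R := \sum_(v <- s) expR (theta * hr v).

(** The exponential of [theta] times the height is an eigenfunction of the step operator, with
    eigenvalue [cosh theta]. *)
Let halfstep theta x (F : V -> R) (c : R) : (forall v, F v = c * expR (theta * hr v)) ->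
  \sum_(v <- nb adj x) K x v * F v = c * expR (theta * hr x) * cosh theta.
Proof.
move=> hF; have [y [z [hy hz ->]]] := line_step x F.
rewrite !hF /hr hy hz rmorphD rmorphB /= mulrDr mulrBr !expRD mulr1 /cosh.
by field.
Qed.

Lemma line_stochastic : stochastic adj K.
Proof.
split=> [x y xy|x]; first by rewrite /step_prob xy invr_ge0.
have [y [z [_ _ hF]]] := line_step x (fun=> 1).
under eq_bigr do rewrite -[K _ _]mulr1.
by rewrite hF -mulr2n divff.
Qed.

Lemma cosh_ge1 theta : 1 <= cosh theta :> R.
Proof.
wlog th0 : theta / 0 <= theta.
  move=> wl; have [/wl//|th0] := leP 0 theta.
  by have := wl (- theta); rewrite /cosh opprK addrC; apply; rewrite oppr_ge0 ltW.
have [->|thN] := eqVneq theta 0.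
  by rewrite /cosh oppr0 expR0 -mulr2n divff.
by apply/ltW/cosh_gt1; rewrite lt_def thN.
Qed.

Let D theta n : R := \sum_(j < n.+1) cosh theta ^+ j.

Let D_le theta n : D theta n <= n.+1%:R * cosh theta ^+ n.
Proof.
rewrite mulr_natl -[X in _ <= _ *+ X]card_ord -sumr_const.
by apply: ler_sum => j _; apply: ler_weXn2l; [exact: cosh_ge1|rewrite -ltnS].
Qed.

Let D_ge0 theta n : 0 <= D theta n.
Proof.
by apply: sumr_ge0 => j _; rewrite exprn_ge0// (le_trans _ (cosh_ge1 theta)).
Qed.

Let DS theta n : D theta n.+1 = 1 + D theta n * cosh theta.
Proof.
rewrite /D big_ord_recl expr0; congr (_ + _).
by rewrite mulr_suml; apply: eq_bigr => j _; rewrite /bump /= exprSr.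
Qed.

Lemma walkE_exp_sum theta n x :
  walkE adj K n x (fun s => exp_sum theta (x :: s)) = D theta n * expR (theta * hr x).
Proof.
elim: n x => [|n IH] x.
  by rewrite /= /exp_sum big_seq1 /D big_ord1 expr0 mul1r.
transitivity (\sum_(y <- nb adj x) (K x y * expR (theta * hr x) +
    K x y * (D theta n * expR (theta * hr y)))).
  apply: eq_bigr => y _; rewrite -mulrDr; congr (_ * _).
  rewrite -IH -[X in _ = X + _](walkE_cst n y _ line_stochastic) -walkED.
  by congr walkE; apply/funext => s; rewrite /exp_sum big_cons.
rewrite big_split /= -mulr_suml line_stochastic.2 mul1r.
by rewrite (@halfstep theta x _ (D theta n))// DS; ring.
Qed.

Lemma cosh_opp theta : cosh (- theta) = cosh theta :> R.
Proof. by rewrite /cosh opprK addrC. Qed.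

(** Both sums are split at the first vertex, whose weights [a] and [a'] are inverse to each other.
    Each cross term is a first moment and adds at most [n.+1%:R * c ^+ n * c]. The prefactor is
    polynomial, so it does not affect the growth rate. *)
Lemma walkE_exp_sum2 theta n x : walkE adj K n x
    (fun s => exp_sum theta (x :: s) * exp_sum (- theta) (x :: s)) <=
  n.+1%:R ^+ 2 * cosh theta ^+ n.
Proof.
elim: n x => [|n IH] x.
  by rewrite /= /exp_sum !big_seq1 -expRD mulNr subrr expR0 expr0 expr1n mulr1.
set c := cosh theta in IH *; have c1 : 1 <= c by exact: cosh_ge1.
pose a := expR (theta * hr x); pose a' := expR (- theta * hr x).
have aa' : a * a' = 1 by rewrite /a /a' -expRD mulNr subrr expR0.
have step y : walkE adj K n y (fun s => exp_sum theta [:: x, y & s] *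
      exp_sum (- theta) [:: x, y & s]) =
    1 + a * (D theta n * expR (- theta * hr y)) +
    a' * (D theta n * expR (theta * hr y)) +
    walkE adj K n y (fun s => exp_sum theta (y :: s) * exp_sum (- theta) (y :: s)).
  have DN : D (- theta) n = D theta n by rewrite /D cosh_opp.
  rewrite -{1}DN -!walkE_exp_sum -!walkEZ.
  rewrite -[X in X + _ + _ + _](walkE_cst n y _ line_stochastic) -!walkED.
  congr walkE; apply/funext => s; rewrite /exp_sum.
  rewrite [in LHS]big_cons [X in _ * X = _]big_cons -/a -/a'.
  set P := \sum_(v <- y :: s) expR (theta * hr v).
  set Q := \sum_(v <- y :: s) expR (- theta * hr v).
  by rewrite -{1}aa'; ring.
apply: le_trans (_ : \sum_(y <- nb adj x) (K x y * (1 + n.+1%:R ^+ 2 * c ^+ n) +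
   (K x y * ((a * D theta n) * expR (- theta * hr y)) +
   K x y * ((a' * D theta n) * expR (theta * hr y)))) <= _).
  rewrite /= !big_seq; apply: ler_sum => y; rewrite mem_nb// => xy.
  have Kxy : 0 <= K x y by exact: line_stochastic.1.
  rewrite -!mulrDr; apply: ler_wpM2l => //; rewrite step.
  have := IH y; rewrite -!mulrA; lra.
rewrite big_split /= -mulr_suml line_stochastic.2 mul1r big_split /=.
rewrite (@halfstep (- theta) x _ (a * D theta n))// (@halfstep theta x _ (a' * D theta n))//.
rewrite cosh_opp -/a -/a' -/c.
have -> : a * D theta n * a' * c = D theta n * c.
  by rewrite -[RHS]mul1r -aa'; ring.
have -> : a' * D theta n * a * c = D theta n * c.
  by rewrite -[RHS]mul1r -aa'; ring.
have hD : D theta n * c <= n.+1%:R * c ^+ n * c.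
  by apply: ler_wpM2r; [exact: le_trans c1|exact: D_le].
have cn : 1 <= c ^+ n by exact: exprn_ege1.
have n0 : 0 <= n.+1%:R :> R by [].
have cc : c ^+ n <= c ^+ n * c by rewrite ler_peMr// (le_trans _ cn).
have h1 : n.+1%:R ^+ 2 * c ^+ n <= n.+1%:R ^+ 2 * (c ^+ n * c).
  by apply: ler_wpM2l => //; exact: exprn_ge0.
have -> : n.+2%:R ^+ 2 * c ^+ n.+1 = (n.+1%:R + 1) ^+ 2 * (c ^+ n * c).
  by rewrite natr1 [c ^+ n.+1]exprSr.
have -> : (n.+1%:R + 1) ^+ 2 * (c ^+ n * c) = n.+1%:R ^+ 2 * (c ^+ n * c) +
    2 * (n.+1%:R * c ^+ n * c) + c ^+ n * c by ring.
lra.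
Qed.

(** * Percolation on the line *)

Section line_percolation.
Context {dX : measure_display} {X : measurableType dX}.
Context {omega : X -> {fset V} -> bool} {q : R} {P : probability X R}.
Hypotheses (q0 : 0 <= q) (q1 : q <= 1) (adj_sym : symmetric adj)
  (G_transitive : vertex_transitive adj)
  (perc : is_bernoulli_percolation adj omega q P).
Local Notation C := (cluster_of adj omega).

(* A cluster can only leave the interval spanned by the h-values of s through
   one of its two end vertices a and b. *)
Lemma line_cluster_sub w s a b : a \in s -> b \in s ->
  (forall v, v \in s -> h a <= h v <= h b) ->
  C w s `<=` [set y | h a <= h y <= h b] `|` (C w [:: a] `|` C w [:: b]).
Proof.
move=> aS bS hs y; elim=> [x /hs xs|x z _ IH xz]; first by left.
have /andP[] := xz; rewrite adjE => xz' _.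
case: IH => [xI|[ax|bx]]; last 2 first.
- by right; left; apply: reach_step xz.
- by right; right; apply: reach_step xz.
have [zI|zI] := boolP (h a <= h z <= h b); first by left.
have [za|za] := ltP (h z) (h a).
  have xa : x = a by apply: (bij_inj h_bij); move: xI => /=; lia.
  by right; left; apply: reach_step xz; rewrite xa; apply: reach_mem; rewrite inE.
have xb : x = b by apply: (bij_inj h_bij); move: xI => /=; lia.
by right; right; apply: reach_step xz; rewrite xb; apply: reach_mem; rewrite inE.
Qed.

Lemma line_counting_le s : (0 < size s)%N -> exists a b,
  [/\ a \in s, b \in s & forall w, (counting (C w s) <=
    (hr b - hr a + 1)%:E + (counting (C w [:: a]) + counting (C w [:: b])) :> \bar R)%E].
Proof.
move=> s0; have [a aS ha] := exists_minimizer h s0.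
have [b bS hb] := exists_minimizer (fun v => - h v) s0.
have hs v : v \in s -> h a <= h v <= h b.
  by move=> vs; rewrite ha//=; have := hb v vs; lia.
exists a, b; split=> // w.
apply: le_trans (counting_le (line_cluster_sub aS bS hs)) _.
apply: le_trans (countingU_le _ _ e_bij) _.
apply: leeD; last exact: (countingU_le _ _ e_bij).
have [g hK gK] := h_bij; have /andP[_ ab] := hs a aS.
pose n := `|h b - h a|%N.
pose l := [seq g (h a + k%:Z) | k <- iota 0 n.+1].
apply: le_trans (_ : (counting [set x | x \in l] <= _)%E).
  apply: counting_le => y /= hy.
  have -> : y = g (h a + `|h y - h a|%N%:Z) by apply: (bij_inj h_bij); rewrite gK; lia.
  by apply: map_f; rewrite mem_iota /n; lia.
rewrite (@counting_seq _ _ l)// lee_fin.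
apply: le_trans (_ : (size l)%:R <= _); first by rewrite ler_nat size_undup.
have hn : h b - h a = n%:Z by rewrite /n; lia.
by rewrite size_map size_iota -natr1 lerD2r /hr -rmorphB hn.
Qed.

Let mcount s := measurable_counting adj_sym perc e_bij s.

Lemma line_exp_counting_le (theta a t : R) s : 0 < theta -> 0 < a ->
  theta <= a / 2 -> (0 < size s)%N ->
  (forall x, (\int[P]_w expeR (a%:E * counting (C w [:: x])) <= t%:E)%E) ->
  (\int[P]_w expeR (theta%:E * counting (C w s)) <=
    (expR theta * t * (exp_sum theta s * exp_sum (- theta) s))%:E)%E.
Proof.
move=> th0 a0 tha s0 ht.
have [b [c [bS cS hbc]]] := line_counting_le s0.
have mexp s' :
    measurable_fun setT (fun w => expeR (a%:E * counting (C w s'))).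
  by apply: measurable_expeR; exact: measurable_funeM.
have e0 s' w : (0 <= expeR (a%:E * counting (C w s')))%E by exact: expeR_ge0.
have t0 : 0 <= t.
  by rewrite -lee_fin; apply: le_trans (ht b); apply: integral_ge0.
set r := expR (theta * (hr c - hr b + 1)).
have r0 : 0 < r by exact: expR_gt0.
have pw w : (expeR (theta%:E * counting (C w s)) <= (r / 2)%:E *
    (expeR (a%:E * counting (C w [:: b])) + expeR (a%:E * counting (C w [:: c]))))%E.
  have hw := hbc w.
  have b0 := counting_ge0 (R := R) (C w [:: b]).
  have c0 := counting_ge0 (R := R) (C w [:: c]).
  have rhs_y (x y : \bar R) : x = +oo%E -> (0 <= y)%E ->
      ((r / 2)%:E * (x + y) = +oo)%E.
    move=> -> y0; rewrite addye ?gt_eqF// ?(lt_le_trans (ltNyr 0))//.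
    by rewrite gt0_muley// lte_fin divr_gt0.
  have [Nb|Nb] := eqVneq (counting (C w [:: b])) (+oo%E : \bar R).
    by rewrite rhs_y ?leey// Nb gt0_muley ?lte_fin.
  have [Nc|Nc] := eqVneq (counting (C w [:: c])) (+oo%E : \bar R).
    by rewrite addeC rhs_y ?leey// Nc gt0_muley ?lte_fin.
  have fb : counting (C w [:: b]) \is a @fin_num R by rewrite ge0_fin_numE// ltey.
  have fc : counting (C w [:: c]) \is a @fin_num R by rewrite ge0_fin_numE// ltey.
  rewrite -(fineK fb) -(fineK fc) in b0 c0 hw *.
  set nb := fine _ in hw b0 *; set nc := fine _ in hw c0 *.
  apply: le_trans (_ : (_ <= expeR (theta%:E * (hr c - hr b + 1 + (nb + nc))%:E))%E) _.
    rewrite lee_expeR; apply: lee_wpmul2l; first by rewrite lee_fin ltW.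
    by rewrite EFinD EFinD.
  rewrite -!EFinM /= lee_fin mulrDr expRD -/r -mulrA.
  apply: ler_wpM2l; first exact: ltW.
  rewrite !lee_fin in b0 c0.
  (* The clusters of the two ends may be dependent or even equal. Convexity separates them at the
     price of doubling [theta], whence the condition [theta <= a / 2]. *)
  have h1 : expR (theta * (nb + nc)) <=
      2^-1 * (expR (2 * theta * nb) + expR (2 * theta * nc)).
    have := @expR_mean_le _ (2 * theta) [:: nb; nc] isT.
    rewrite /= !big_cons !big_nil !addr0.
    have -> // : 2 * theta / 2 = theta by field.
  apply: le_trans h1 _; apply: ler_wpM2l; first by rewrite invr_ge0.
  by apply: lerD; rewrite ler_expR; apply: ler_wpM2r => //; lra.
apply: le_trans (_ : (_ <= \int[P]_w ((r / 2)%:E *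
    (expeR (a%:E * counting (C w [:: b])) + expeR (a%:E * counting (C w [:: c])))))%E) _.
  apply: ge0_le_integral => //.
  - by move=> w _; exact: expeR_ge0.
  - by apply: measurable_expeR; exact: measurable_funeM.
  - by apply: measurable_funeM; exact: emeasurable_funD.
have r20 : 0 <= r / 2 by rewrite divr_ge0// ltW.
rewrite ge0_integralZl_EFin//; last 2 first.
- by move=> w _; rewrite adde_ge0.
- exact: emeasurable_funD.
rewrite ge0_integralD//.
apply: le_trans (lee_wpmul2l _ (leeD (ht b) (ht c))) _; first by rewrite lee_fin.
rewrite -EFinD -EFinM lee_fin.
have -> : r / 2 * (t + t) = expR theta * t * (expR (theta * hr c) * expR (- theta * hr b)).
  have -> : r = expR theta * (expR (theta * hr c) * expR (- theta * hr b)).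
    by rewrite /r -!expRD; congr expR; ring.
  by field.
apply: ler_wpM2l; first by rewrite mulr_ge0// expR_ge0.
have single (th : R) v : v \in s -> expR (th * hr v) <= exp_sum th s.
  move=> vs; rewrite /exp_sum (big_rem v)//= lerDl; apply: sumr_ge0 => u _.
  exact: expR_ge0.
by apply: ler_pM; rewrite ?expR_ge0// single.
Qed.

Context {dW : measure_display} {W : measurableType dW} {S : nat -> W -> V}
  {PW : V -> probability W R}.
Hypothesis S_walk : is_simple_random_walk adj S PW.
Variable o : V.
Hypothesis chi_fin : (\int[P]_w counting (C w [:: o]) < +oo)%E.
Local Notation Lambda := (Lambda adj S omega (PW o) P).

Lemma line_Lambda_ge theta : 0 < theta -> ((ln (cosh theta))%:E <= Lambda theta)%E.
Proof.
move=> th0; have c1 := cosh_ge1 theta.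
have c0 : 0 < cosh theta by apply: lt_le_trans c1.
apply: Lambda_ge => n.
apply: le_trans (partition_function_ge adj_sym G_bounded e_bij S_walk perc o
  (B := fun s => expR (theta * (size (undup s))%:R)) _ _); last 2 first.
- by move=> s; exact: expR_ge0.
- move=> s _; apply: le_trans (exp_counting_ge adj_sym perc G_transitive e_bij
    chi_fin s (ltW th0)).
  rewrite lee_fin ler_expR; apply: ler_wpM2l; first exact: ltW.
  exact: (mean_size_ge adj_sym perc G_transitive e_bij chi_fin).
rewrite lee_fin expRM_natl lnK ?posrE//.
(* A path visits at least one vertex more than its displacement. The resulting factor [expR theta],
   which is at least [cosh theta], makes up for the walk having only [n] steps. *)
apply: le_trans (_ : walkE adj K n o (fun s =>
    expR theta * expR (theta * (hr (last o s) - hr o))) <= _).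
  rewrite walkEZ walkE_line_last exprS; apply: ler_wpM2r; first by rewrite exprn_ge0// ltW.
  have : expR (- theta) <= expR theta by rewrite ler_expR; lra.
  by rewrite /cosh; lra.
apply: walkE_le; [exact: G_bounded|exact: line_stochastic.1|move=> s _ ps].
rewrite -expRD ler_expR -[X in X + _]mulr1 -mulrDr; apply: ler_wpM2l; first exact: ltW.
have := line_range ps; rewrite -(ler_int R) rmorphD rmorphB /= addrC.
by [].
Qed.

Lemma line_Lambda_le (theta a t : R) : 0 < theta -> 0 < a -> theta <= a / 2 ->
  (forall x, (\int[P]_w expeR (a%:E * counting (C w [:: x])) <= t%:E)%E) ->
  (Lambda theta <= (ln (cosh theta))%:E)%E.
Proof.
move=> th0 a0 tha ht.
have t1 : 1 <= t.
  rewrite -lee_fin; apply: le_trans (ht o).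
  rewrite -[leLHS](integral_probability_cst P); apply: ge0_le_integral => //.
  - by apply: measurable_expeR; exact: measurable_funeM.
  - move=> w _; rewrite -expeR0 lee_expeR mule_ge0 ?counting_ge0//.
    by rewrite lee_fin ltW.
have t0 : 0 < t by apply: lt_le_trans t1.
have c1 := cosh_ge1 theta.
have c0 : 0 < cosh theta by apply: lt_le_trans c1.
have lnc0 : 0 <= ln (cosh theta) by rewrite ln_ge0.
have bound n : (Lambda theta <=
    ((theta + ln t + 2 * ln n.+1%:R) / n.+1%:R + ln (cosh theta))%:E)%E.
  have n0 : 0 < n.+1%:R :> R by [].
  have B0 : 0 < expR theta * t * (n.+1%:R ^+ 2 * cosh theta ^+ n).
    by rewrite !mulr_gt0 ?expR_gt0 ?exprn_gt0.
  apply: le_trans (Lambda_le (n := n) B0 _) _.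
    apply: le_trans (partition_function_le adj_sym G_bounded e_bij S_walk perc o
      (B := fun s => expR theta * t * (exp_sum theta s * exp_sum (- theta) s)) _ _) _.
    - move=> s; rewrite !mulr_ge0 ?expR_ge0 ?(ltW t0)//;
        by apply: sumr_ge0 => *; exact: expR_ge0.
    - by move=> s sn; apply: (line_exp_counting_le th0 a0 tha) => //; rewrite sn.
    rewrite lee_fin walkEZ; apply: ler_wpM2l; last exact: walkE_exp_sum2.
    by rewrite mulr_ge0 ?expR_ge0// ltW.
  rewrite lee_fin ler_pdivrMr// mulrDl divfK ?gt_eqF//.
  have lnB (x : R) : 0 < x -> ln (expR theta * t * (n.+1%:R ^+ 2 * x ^+ n)) =
      theta + ln t + (ln n.+1%:R *+ 2 + ln x *+ n).
    move=> x0; have e0 := expR_gt0 theta.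
    have N2 : 0 < n.+1%:R ^+ 2 :> R by exact: exprn_gt0.
    have xn : 0 < x ^+ n by exact: exprn_gt0.
    rewrite lnM ?posrE ?mulr_gt0// lnM ?posrE// expRK lnM ?posrE//.
    by rewrite lnXn// lnXn.
  rewrite lnB// -mulr_natl -[ln (cosh theta) *+ n]mulr_natr.
  have : ln (cosh theta) * n%:R <= ln (cosh theta) * n.+1%:R.
    by apply: ler_wpM2l => //; rewrite ler_nat.
  lra.
apply/lee_addgt0Pr => eps eps0.
(* Taking n + 1 = k ^ 2 turns ln (n + 1) into 2 ln k <= 2 k. *)
pose A := theta + ln t + 4.
have A0 : 0 < A.
  by have : 0 <= ln t by [rewrite ln_ge0]; rewrite /A; lra.
pose k := (Num.bound (A / eps)).+1.
have k0 : 0 < k%:R :> R by [].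
have kA : A / eps <= k%:R.
  by apply: le_trans (ltW (unstable.ltr_bound _)) _; rewrite ler_nat.
have kk : (0 < k * k)%N by [].
have := bound (k * k).-1; rewrite prednK// => /le_trans; apply.
rewrite -EFinD lee_fin addrC lerD2l natrM ler_pdivrMr ?mulr_gt0//.
rewrite lnM ?posrE//.
have lnk : ln k%:R <= k%:R :> R.
  exact/ltW/ln_sublinear.
have k1 : 1 <= k%:R :> R by rewrite ler1n.
have h1 : theta + ln t <= (theta + ln t) * k%:R.
  rewrite ler_peMr//; have : 0 <= ln t by [rewrite ln_ge0]; lra.
have h2 : A <= eps * k%:R by rewrite mulrC -ler_pdivrMr.
have h3 : A * k%:R <= eps * k%:R * k%:R by apply: ler_wpM2r => //; exact: ltW.
move: h3; rewrite /A; lra.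
Qed.

End line_percolation.
End line.

(** * Green functions and recurrence *)

Section renewal.
Context {R : realType} {V : choiceType} {adj : rel V}.
Hypothesis G_bounded : bounded_degrees adj.
Variables (K : V -> V -> R) (o : V).
Hypothesis K_stoch : stochastic adj K.

Definition return_prob n : R := walkE adj K n o (fun s => (last o s == o)%:R).
Definition no_return_prob n : R := walkE adj K n o (fun s => (o \notin s)%:R).
Definition green n : R := \sum_(j < n.+1) return_prob j.

(** Decomposition at the last visit to [o] up to time [n]; there is one, as the walk starts at
    [o]. *)
Lemma renewal_equation n :
  \sum_(j < n.+1) return_prob j * no_return_prob (n - j) = 1.
Proof.
pose v (x : V) (s : seq V) : R := (o \in x :: s)%:R.
pose b (x : V) (s : seq V) : R := ((x == o) && (o \notin s))%:R.
have v_cons x y s : v x (y :: s) = v y s + b x (y :: s).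
  rewrite /v /b in_cons eq_sym; case: (x == o); case: (o \in y :: s) => /=;
    by rewrite ?addr0 ?add0r.
have v_nil x : v x [::] = b x [::] by rewrite /v /b inE eq_sym andbT.
have := walkE_last_exit (adj := adj) K v_cons v_nil n o.
rewrite (_ : v o = fun=> 1); last by apply/funext => s; rewrite /v inE eqxx.
rewrite walkE_cst// => ->; apply: eq_bigr => j _.
rewrite mulrC -walkEZ; congr walkE; apply/funext => s; rewrite /b.
have [->|ne] := eqVneq (last o s) o; first by rewrite mulr1.
by rewrite mulr0 walkE_cst.
Qed.

Lemma return_prob_ge0 n : 0 <= return_prob n.
Proof. by apply: walkE_ge0 => //; exact: K_stoch.1. Qed.

Lemma no_return_prob_ge0 n : 0 <= no_return_prob n.
Proof. by apply: walkE_ge0 => //; exact: K_stoch.1. Qed.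

Lemma no_return_prob_le1 n : no_return_prob n <= 1.
Proof.
rewrite -[leRHS](walkE_cst n o _ K_stoch); apply: walkE_le; [exact: G_bounded|exact: K_stoch.1|move=> s _ _].
by case: (o \notin s).
Qed.

Lemma no_return_prob_decr n n' : (n <= n')%N ->
  no_return_prob n' <= no_return_prob n.
Proof.
move=> nn'; rewrite -(subnKC nn') /no_return_prob walkE_split.
apply: walkE_le; [exact: G_bounded|exact: K_stoch.1|move=> s _ _].
rewrite -[leRHS](walkE_cst (n' - n) (last o s) _ K_stoch).
apply: walkE_le; [exact: G_bounded|exact: K_stoch.1|move=> s' _ _].
by rewrite mem_cat; case: (o \in s) => //=; case: (o \in s').
Qed.

Lemma green_ge1 n : 1 <= green n.
Proof.
rewrite /green big_ord_recl -[leLHS]addr0; apply: lerD.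
  by rewrite /return_prob /= eqxx.
by apply: sumr_ge0 => j _; exact: return_prob_ge0.
Qed.

Lemma no_return_green n : no_return_prob n * green n <= 1.
Proof.
rewrite -[leRHS](renewal_equation n) mulr_sumr; apply: ler_sum => j _.
rewrite mulrC; apply: ler_wpM2l; first exact: return_prob_ge0.
by apply: no_return_prob_decr; rewrite leq_subr.
Qed.

(** The renewal equation is taken with horizon [m + n]. A last visit up to time [m] leaves at least
    [n] steps without return, and a later one is bounded by its return probability alone. *)
Lemma no_return_prob_ge m n :
  1 <= no_return_prob n * green m + \sum_(m.+1 <= j < (m + n).+1) return_prob j.
Proof.
rewrite -[leLHS](renewal_equation (m + n)).
rewrite -(big_mkord xpredT (fun j => return_prob j * no_return_prob (m + n - j))).
rewrite (@big_cat_nat _ _ _ m.+1)//=; last by rewrite ltnS leq_addr.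
apply: lerD.
  rewrite /green mulr_sumr big_mkord; apply: ler_sum => j _.
  rewrite [leRHS]mulrC; apply: ler_wpM2l; first exact: return_prob_ge0.
  apply: no_return_prob_decr; have := ltn_ord j; lia.
apply: ler_sum => j _; rewrite -[leRHS]mulr1.
by apply: ler_wpM2l; [exact: return_prob_ge0|exact: no_return_prob_le1].
Qed.

End renewal.

Section green_differences.
Context {R : realType} {V : choiceType} {adj : rel V}.
Hypotheses (V_infinite : infinite_set [set: V])
  (G_connected : connected_graph adj) (G_bounded : bounded_degrees adj).
Variable o : V.
Local Notation K := (step_prob R adj).

Definition heat n x : R := walkE adj K n x (fun s => (last x s == o)%:R).
Definition green_at n x : R := \sum_(j < n.+1) heat j x.

Let K_stoch : stochastic adj K. Proof. exact: step_prob_stochastic. Qed.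

Lemma heat_ge0 n x : 0 <= heat n x.
Proof. by apply: walkE_ge0 => //; exact: K_stoch.1. Qed.

Lemma green_at_ge0 n x : 0 <= green_at n x.
Proof. by apply: sumr_ge0 => j _; exact: heat_ge0. Qed.

Lemma green_atS n x :
  green_at n.+1 x = (x == o)%:R + \sum_(y <- nb adj x) K x y * green_at n y.
Proof.
rewrite /green_at big_ord_recl; congr (_ + _).
under [RHS]eq_bigr do rewrite mulr_sumr.
by rewrite exchange_big.
Qed.

Lemma green_at_mono n x : green_at n x <= green_at n.+1 x.
Proof. by rewrite /green_at [leRHS]big_ord_recr /= lerDl heat_ge0. Qed.

(** A discrete maximum principle: away from [o] the value is an average of the values at the
    neighbours with one step less. *)
Lemma green_at_le n x : green_at n x <= green_at n o.
Proof.
elim: n x => [|n IH] x.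
  rewrite /green_at !big_ord1 /heat /= eqxx.
  by case: (x == o).
have [->//|xo] := eqVneq x o.
rewrite green_atS (negbTE xo) add0r; apply: le_trans (green_at_mono n o).
rewrite -[leRHS]mul1r -(K_stoch.2 x) mulr_suml !big_seq.
apply: ler_sum => y; rewrite mem_nb// => xy.
by apply: ler_wpM2l; [exact: K_stoch.1|exact: IH].
Qed.

(* Harmonicity away from o propagates the bound from a vertex to its
   neighbours. *)
Lemma green_difference_bounded x :
  exists c : R, forall n, green_at n o - green_at n x <= c.
Proof.
have [s ps <-] := G_connected o x.
elim/last_ind: s ps => [|s y IH]; first by exists 0 => n; rewrite subrr.
rewrite rcons_path last_rcons => /andP[/IH[c hc] zy].
set z := last o s in hc zy.
have d0 : 0 < (degree adj z)%:R :> R by rewrite ltr0n degree_gt0.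
exists ((degree adj z)%:R * (c + 1)) => n.
rewrite -ler_pdivrMl//; have := hc n.+1; rewrite (green_atS n z).
have := green_at_mono n o; set G := green_at n o; set G1 := green_at n.+1 o.
move=> GG.
have : K z y * (G - green_at n y) <= \sum_(v <- nb adj z) K z v * (G - green_at n v).
  have yz : y \in nb adj z by rewrite mem_nb.
  rewrite (big_rem y)//= lerDl big_seq; apply: sumr_ge0 => v /mem_rem.
  rewrite mem_nb// => zv; apply: mulr_ge0; first exact: K_stoch.1.
  by rewrite subr_ge0 green_at_le.
have -> : \sum_(v <- nb adj z) K z v * (G - green_at n v) =
    G - \sum_(v <- nb adj z) K z v * green_at n v.
  under eq_bigr do rewrite mulrBr.
  by rewrite sumrB -mulr_suml K_stoch.2 mul1r.
have -> : K z y = (degree adj z)%:R^-1 by rewrite /step_prob zy.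
have : (z == o)%:R <= 1 :> R by case: (z == o).
lra.
Qed.

End green_differences.

Lemma walkE_cvg {R : realType} {V : choiceType} {adj : rel V} (K : V -> V -> R) n x
    (F : nat -> seq V -> R) (G : seq V -> R) :
  (forall s, F N s @[N --> \oo] --> G s) ->
  walkE adj K n x (F N) @[N --> \oo] --> walkE adj K n x G.
Proof.
elim: n x F G => [|n IH] x F G FG; first exact: FG.
rewrite /=; elim: (nb adj x) => [|y l IHl].
  by rewrite big_nil; under eq_fun do rewrite big_nil; exact: cvg_cst.
rewrite big_cons; under eq_fun do rewrite big_cons.
apply: cvgD => //; apply: cvgMr.
by apply: (IH y (fun N s => F N (y :: s))) => s; exact: FG.
Qed.

(** * Last exit decomposition for clusters *)

Section regular_graph.
Context {R : realType} {V : choiceType} {adj : rel V} {e : nat -> V}.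
Hypotheses (adj_sym : symmetric adj)
  (V_infinite : infinite_set [set: V]) (G_connected : connected_graph adj)
  (G_transitive : vertex_transitive adj)
  (G_bounded : bounded_degrees adj) (e_bij : bijective e).
Context {dX : measure_display} {X : measurableType dX}.
Context {omega : X -> {fset V} -> bool} {q : R} {P : probability X R}.
Hypothesis perc : is_bernoulli_percolation adj omega q P.
Variable o : V.
Local Notation K := (step_prob R adj).
Local Notation C := (cluster_of adj omega).
Hypothesis chi_fin : (\int[P]_w counting (C w [:: o]) < +oo)%E.
Local Notation rho := (rho (adj := adj) (omega := omega) (P := P)).
Local Notation tau := (tau (adj := adj) (omega := omega) (P := P)).
Local Notation beta := (beta (adj := adj) (omega := omega) (P := P)).
Local Notation mean_increment :=
  (mean_increment (adj := adj) (omega := omega) (P := P) o).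
Local Notation green := (green (adj := adj) K o).
Local Notation green_at := (green_at (adj := adj) o).

(* A group law on V with unit o, acting on the graph by its translations t x;
   iota is the inversion. *)
Variables (t : V -> V -> V) (iota : V -> V).
Hypotheses (t_aut : forall x, graph_isomorphism adj adj (t x))
  (t_o : forall x, t x o = x) (t_iota : forall x, t x (iota x) = o)
  (iota_bij : bijective iota).

Let K_stoch : stochastic adj K. Proof. exact: step_prob_stochastic. Qed.
Let K_inv x a b : K (t x a) (t x b) = K a b. Proof. exact: step_prob_aut. Qed.

(** The probability that the cluster of the starting point [x] contains [o] and is avoided by the
    next [n] positions. A mass transport by the translations turns the sum over [x] into
    [mean_increment n]. *)
Definition psi n x : R := walkE adj K n x (fun s => rho x o s).

Lemma psi_translate n x : psi n x = walkE adj K n o (fun s => rho o (iota x) s).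
Proof.
rewrite /psi -{1}(t_o x) (walkE_aut G_bounded n o _ (t_aut x) (K_inv x)).
congr walkE; apply/funext => s.
have := rho_aut adj_sym perc e_bij o (iota x) s (t_aut x).
by rewrite t_o t_iota.
Qed.

Lemma rho_le_nil x y s : rho x y s <= tau x y.
Proof.
rewrite -rho_nil -lee_fin -!(rhoE adj_sym perc e_bij); apply: le_measure.
- by rewrite inE; exact: (measurable_fresh adj_sym perc e_bij).
- by rewrite inE; exact: (measurable_fresh adj_sym perc e_bij).
- by move=> w [xy _]; split=> // -[].
Qed.

Lemma rho_mem x y s : x \in s -> rho x y s = 0.
Proof.
move=> xs; rewrite /rho (_ : [set w | _] = set0) ?measure0//.
rewrite -subset0 => w [_]; apply; exists x => //.
by apply: reach_mem; rewrite inE.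
Qed.

Lemma rho_cat x y s s' : rho x y (s ++ s') <= rho x y s.
Proof.
rewrite -lee_fin -!(rhoE adj_sym perc e_bij); apply: le_measure.
- by rewrite inE; exact: (measurable_fresh adj_sym perc e_bij).
- by rewrite inE; exact: (measurable_fresh adj_sym perc e_bij).
- move=> w [xy nz]; split=> // -[z zs xz]; apply: nz; exists z => //.
  by rewrite mem_cat zs.
Qed.

Lemma tau_sym x y : tau x y = tau y x.
Proof.
rewrite /tau; congr (fine (P _)).
by apply/seteqP; split=> w /=; exact: cluster_sym.
Qed.

Lemma psi_ge0 n x : 0 <= psi n x.
Proof.
apply: walkE_ge0; [exact: G_bounded|exact: K_stoch.1|move=> s].
exact: rho_ge0.
Qed.

Lemma psi_le n x : psi n x <= tau o x * no_return_prob (adj := adj) K o n.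
Proof.
apply: (@le_trans _ _ (walkE adj K n x (fun s => tau x o * (x \notin s)%:R))).
  apply: walkE_le; [exact: G_bounded|exact: K_stoch.1|move=> s _ _].
  have [xs|xs] := boolP (x \in s); first by rewrite rho_mem// mulr0.
  by rewrite mulr1 rho_le_nil.
rewrite walkEZ tau_sym; apply: ler_wpM2l.
  exact: tau_ge0.
rewrite -{1}(t_o x) (walkE_aut G_bounded n o _ (t_aut x) (K_inv x)).
rewrite le_eqVlt; apply/orP; left; apply/eqP; congr walkE; apply/funext => s.
by rewrite -{1}(t_o x) mem_map//; exact: bij_inj (t_aut x).1.
Qed.

Lemma psi_decr n n' x : (n <= n')%N -> psi n' x <= psi n x.
Proof.
move=> nn'; rewrite -(subnKC nn') /psi walkE_split.
apply: walkE_le; [exact: G_bounded|exact: K_stoch.1|move=> s _ _].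
rewrite -[leRHS](walkE_cst (n' - n) (last x s) _ K_stoch).
apply: walkE_le; [exact: G_bounded|exact: K_stoch.1|move=> s' _ _].
exact: rho_cat.
Qed.

(** Decomposition at the last position whose cluster contains [o]; the starting point is such a
    position. *)
Lemma psi_last_exit n :
  \sum_(j < n.+1) walkE adj K j o (fun s => psi (n - j) (last o s)) = 1.
Proof.
pose v (x : V) (s : seq V) : R := fine (P [set w | C w (x :: s) o]).
have mC s : measurable [set w | C w s o].
  exact: (measurable_reach adj_sym perc e_bij).
have v_cons x y s : v x (y :: s) = v y s + rho x o (y :: s).
  rewrite /v; have -> : P [set w | C w [:: x, y & s] o] =
      (P [set w | C w (y :: s) o] + P [set w | fresh (adj := adj) (omega := omega) w x (y :: s) o])%E.
    rewrite -measureU//.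
    - congr (P _); apply/seteqP; split=> w /=.
        move=> /reach_cons[xo|yo]; last by left.
        have [[z zs xz]|nz] := pselect (exists2 z, z \in y :: s & C w [:: x] z).
          left; apply/cluster_mem; exists z => //.
          by apply: cluster_trans xo; exact: cluster_sym.
        by right.
      by move=> [yo|[xo _]]; apply/reach_cons; [right|left].
    - exact: (measurable_fresh adj_sym perc e_bij).
    - rewrite -subset0 => w [/= /cluster_mem[z zs zo] [xo]]; apply; exists z => //.
      by apply: cluster_trans xo _; exact: cluster_sym.
  rewrite fineD// ?fin_num_measure//.
  exact: (measurable_fresh adj_sym perc e_bij).
have v_nil x : v x [::] = rho x o [::].
  by rewrite rho_nil.
have := @walkE_last_exit R V adj K v (fun x s => rho x o s) v_cons v_nil n o.
rewrite (_ : v o = fun=> 1); first by rewrite walkE_cst// => ->.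
apply/funext => s; rewrite /v (_ : [set w | _] = setT) ?probability_setT//.
by apply/seteqP; split=> // w _; apply: reach_mem; rewrite inE eqxx.
Qed.

Lemma heat_translate j x :
  walkE adj K j o (fun s => (last o s == x)%:R) = heat (adj := adj) (R := R) o j (iota x).
Proof.
rewrite -{1}(t_iota x) (walkE_aut G_bounded j (iota x) _ (t_aut x) (K_inv x)).
congr walkE; apply/funext => s; congr (nat_of_bool _)%:R.
have -> : last o (map (t x) s) = t x (last (iota x) s).
  by rewrite -{1}(t_iota x) last_map.
by rewrite -[X in (_ == X) = _](t_o x) (inj_eq (bij_inj (t_aut x).1)).
Qed.

(** The Green function at [iota x] is the mean number of visits to [x] up to time [n], and each
    visit contributes at least [psi n x], since [psi] decreases in time. *)
Lemma psi_green n N :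
  \sum_(k < N) green_at n (iota (e k)) * psi n (e k) <= 1.
Proof.
rewrite -[leRHS](psi_last_exit n).
apply: (@le_trans _ _ (\sum_(j < n.+1) walkE adj K j o (fun s =>
    \sum_(k < N) psi n (e k) * (last o s == e k)%:R))).
  rewrite le_eqVlt; apply/orP; left; apply/eqP.
  under [RHS]eq_bigr do rewrite walkE_sum.
  rewrite exchange_big /=; apply: eq_bigr => k _.
  rewrite /green_at mulr_suml; apply: eq_bigr => j _.
  by rewrite walkEZ heat_translate mulrC.
apply: ler_sum => j _.
apply: walkE_le; [exact: G_bounded|exact: K_stoch.1|move=> s _ _].
apply: (@le_trans _ _ (psi n (last o s))); last first.
  by apply: psi_decr; rewrite leq_subr.
have [[k0 kE]|nk] := pselect (exists k : 'I_N, last o s = e k).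
  rewrite (bigD1 k0)//= kE eqxx mulr1 big1 ?addr0// => k kk0.
  case: eqP => [/(bij_inj e_bij)/val_inj k0k|_]; last by rewrite mulr0.
  by rewrite k0k eqxx in kk0.
rewrite big1 ?psi_ge0// => k _; case: eqP => [kE|_]; last by rewrite mulr0.
by exfalso; apply: nk; exists k.
Qed.

(** Replacing the Green function at [iota x] by its value [G] at [o] costs at most [tau o x] times
    the relative difference [d]. This difference is at most 1, which suffices off a box where [tau]
    has total mass at most [eta]; inside the box it is at most a constant over [G], whence the term
    with [A]. *)
Lemma psi_partial_sum eta : 0 < eta -> exists2 A : R, 0 <= A &
  forall n N, green n * \sum_(k < N) psi n (e k) <= 1 + eta + A / green n.
Proof.
move=> eta0.
have [M hM] := tau_tail adj_sym perc e_bij chi_fin eta0.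
have tau0 x y : 0 <= tau x y by exact: tau_ge0.
have /choice[c hc] : forall x, exists c : R, forall n,
    green_at n o - green_at n x <= c.
  by move=> x; exact: (green_difference_bounded V_infinite G_connected G_bounded).
have c0 x : 0 <= c x.
  apply: le_trans (hc x 0%N); rewrite subr_ge0.
  exact: (green_at_le V_infinite G_connected G_bounded).
exists (\sum_(x <- box e M) tau o x * c (iota x)).
  by apply: sumr_ge0 => x _; rewrite mulr_ge0.
move=> n N; set G := green n.
have G1 : 1 <= G by exact: (green_ge1 G_bounded).
have G0 : 0 < G by apply: lt_le_trans G1.
have bG : no_return_prob (adj := adj) K o n <= G^-1.
  by rewrite -[G^-1]mul1r ler_pdivlMr//; exact: (no_return_green G_bounded).
pose d k : R := (G - green_at n (iota (e k))) / G.
have d0 k : 0 <= d k.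
  rewrite divr_ge0 ?(ltW G0)// subr_ge0.
  exact: (green_at_le V_infinite G_connected G_bounded).
have d1 k : d k <= 1.
  rewrite ler_pdivrMr// mul1r lerBlDr lerDl.
  exact: (green_at_ge0 V_infinite G_connected G_bounded).
have h1 : G * \sum_(k < N) psi n (e k) <= 1 + \sum_(k < N) tau o (e k) * d k.
  apply: (@le_trans _ _ (\sum_(k < N) green_at n (iota (e k)) * psi n (e k) +
     \sum_(k < N) (G - green_at n (iota (e k))) * psi n (e k))).
    rewrite mulr_sumr -big_split /=; apply: ler_sum => k _.
    by rewrite -mulrDl addrC subrK.
  apply: lerD; first exact: psi_green.
  apply: ler_sum => k _; rewrite /d [leRHS]mulrCA.
  apply: ler_wpM2l.
    by rewrite subr_ge0; exact: (green_at_le V_infinite G_connected G_bounded).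
  apply: le_trans (psi_le n (e k)) _.
  by apply: ler_wpM2l.
apply: le_trans h1 _; rewrite -addrA lerD2l.
rewrite -(big_mkord xpredT (fun k => tau o (e k) * d k)).
rewrite (bigID (fun k => e k \in box e M))/= addrC; apply: lerD.
  apply: (@le_trans _ _ (\sum_(0 <= k < N | e k \notin box e M) tau o (e k))).
    by apply: ler_sum => k _; rewrite -[leRHS]mulr1; apply: ler_wpM2l.
  rewrite -big_filter -(big_map e xpredT (fun y => tau o y)).
  apply: hM.
    rewrite map_inj_uniq; last exact: bij_inj e_bij.
    by rewrite filter_uniq// iota_uniq.
  by move=> y /mapP[k]; rewrite mem_filter => /andP[kM _] ->.
rewrite mulr_suml.
apply: (@le_trans _ _ (\sum_(0 <= k < N | e k \in box e M)
    tau o (e k) * c (iota (e k)) / G)).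
  apply: ler_sum => k _; rewrite -mulrA; apply: ler_wpM2l => //.
  by apply: ler_wpM2r; [rewrite invr_ge0 ltW|exact: hc].
rewrite -big_filter -(big_map e xpredT (fun y => tau o y * c (iota y) / G)).
apply: ler_sum_uniq_sub.
- rewrite map_inj_uniq; last exact: bij_inj e_bij.
  by rewrite filter_uniq// iota_uniq.
- exact: box_uniq.
- by move=> y /mapP[k]; rewrite mem_filter => /andP[kM _] ->.
- by move=> y; rewrite divr_ge0 ?mulr_ge0// ltW.
Qed.

Lemma recurrent_mean_increment eta : 0 < eta -> exists2 A : R, 0 <= A &
  forall n, green n * mean_increment n <= 1 + eta + A / green n.
Proof.
move=> /psi_partial_sum[A A0 hA]; exists A => // n.
have G1 : 1 <= green n by exact: (green_ge1 G_bounded).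
have G0 : 0 < green n by apply: lt_le_trans G1.
rewrite mulrC -ler_pdivlMr//.
(* Enumerated through the inversion, the partial sums of [psi] become partial sums of the mean
   number of fresh vertices. *)
have e'_bij : bijective (iota \o e) by exact: bij_comp.
have cvb s : \sum_(k < N) rho o (iota (e k)) s @[N --> \oo] --> beta o s.
  have := integral_counting_fresh adj_sym perc e'_bij o s.
  rewrite (betaE adj_sym perc G_transitive e_bij chi_fin) => bE.
  have : (\sum_(0 <= k < N) (rho o ((iota \o e) k) s)%:E)%E @[N --> \oo] -->
      (beta o s)%:E.
    rewrite bE; apply: is_cvg_nneseries => k _ _.
    by rewrite lee_fin; exact: rho_ge0.
  move=> /fine_cvgP[_]; apply: cvg_trans; apply: near_eq_cvg.
  by apply: nearW => N /=; rewrite sumEFin big_mkord.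
have cva := @walkE_cvg R V adj K n o _ _ cvb.
have -> : mean_increment n = lim (walkE adj K n o
    (fun s => \sum_(k < N) rho o (iota (e k)) s) @[N --> \oo]).
  by rewrite (cvg_lim _ cva).
apply: limr_le; first by apply/cvg_ex; eexists; exact: cva.
apply: nearW => N; rewrite walkE_sum ler_pdivlMr// mulrC.
apply: le_trans (hA n N); rewrite le_eqVlt; apply/orP; left; apply/eqP.
by congr (_ * _); apply: eq_bigr => k _; rewrite psi_translate.
Qed.

End regular_graph.

(** * The square lattice *)

Section biased_line_walk.
Context {R : realType}.
Implicit Types (lam : R) (n : nat) (d : int).

(* The law of the position, after n steps, of the walk on the integers that
   jumps by +1 and -1 with probabilities (1 + lam) / 2 and (1 - lam) / 2. *)
Fixpoint line_law lam n d : R :=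
  if n is m.+1 then
    (1 + lam) / 2 * line_law lam m (d - 1) + (1 - lam) / 2 * line_law lam m (d + 1)
  else (d == 0)%:R.

Lemma line_law_out lam n d : d < - n%:Z -> line_law lam n d = 0.
Proof.
elim: n d => [|n IH] d dn /=; first by rewrite lt_eqF//; lia.
by rewrite !IH ?mulr0 ?addr0//; lia.
Qed.

Lemma line_law_parity lam n (k : int) : line_law lam n (2 * k - n%:Z + 1) = 0.
Proof.
elim: n k => [|n IH] k /=.
  by rewrite (_ : _ == 0 = false)//; apply/negP => /eqP; lia.
have -> : 2 * k - n.+1%:Z + 1 - 1 = 2 * (k - 1) - n%:Z + 1 by lia.
have -> : 2 * k - n.+1%:Z + 1 + 1 = 2 * k - n%:Z + 1 by lia.
by rewrite !IH !mulr0 addr0.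
Qed.

Lemma line_lawE lam n (j : nat) : line_law lam n (2 * j%:Z - n%:Z) =
  'C(n, j)%:R * ((1 + lam) / 2) ^+ j * ((1 - lam) / 2) ^+ (n - j).
Proof.
elim: n j => [|n IH] j /=.
  case: j => [|j]; first by rewrite subrr eqxx bin0 !expr0 !mulr1.
  by rewrite bin0n !mul0r (_ : _ == 0 = false)//; apply/negP => /eqP; lia.
case: j => [|j].
  rewrite [X in _ * X + _]line_law_out; last by lia.
  rewrite (_ : 2 * 0%:Z - n.+1%:Z + 1 = 2 * 0%:Z - n%:Z); last by lia.
  by rewrite IH !bin0 !subn0 !expr0 !mul1r exprS mulr0 add0r.
have -> : 2 * j.+1%:Z - n.+1%:Z - 1 = 2 * j%:Z - n%:Z by lia.
have -> : 2 * j.+1%:Z - n.+1%:Z + 1 = 2 * j.+1%:Z - n%:Z by lia.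
rewrite !IH binS subSS natrD [in RHS]exprS.
have [nj|jn] := leqP n j.
  by rewrite [in 'C(n, j.+1)]bin_small// !mul0r mulr0 addr0 add0r; ring.
have -> : ((1 - lam) / 2) ^+ (n - j) = (1 - lam) / 2 * ((1 - lam) / 2) ^+ (n - j.+1).
  by rewrite -exprS; congr (_ ^+ _); lia.
by rewrite exprS; ring.
Qed.

(** The return probability at time [2 k] of the simple random walk on the integers. Its square
    belongs to the square lattice, whose two diagonal coordinates are independent. *)
Definition central_prob k : R := 'C(k.*2, k)%:R / 4 ^+ k.

Lemma line_law_even lam k :
  line_law lam k.*2 0 = (1 - lam ^+ 2) ^+ k * central_prob k.
Proof.
transitivity (line_law lam k.*2 (2 * k%:Z - k.*2%:Z)).
  by congr line_law; lia.
rewrite line_lawE /central_prob (_ : (k.*2 - k = k)%N); last by lia.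
rewrite -mulrA -exprMn (_ : (1 + lam) / 2 * ((1 - lam) / 2) = (1 - lam ^+ 2) / 4); last by field.
by rewrite expr_div_n mulrA [in RHS]mulrA [_ * 'C(_, _)%:R]mulrC.
Qed.

Lemma line_law_odd lam k : line_law lam k.*2.+1 0 = 0.
Proof.
rewrite -(line_law_parity lam k.*2.+1 k); congr line_law; lia.
Qed.

Lemma central_probS k :
  central_prob k.+1 = central_prob k * (k.*2.+1%:R / k.*2.+2%:R).
Proof.
have f n : n`!%:R != 0 :> R by rewrite pnatr_eq0 -lt0n fact_gt0.
have h n : 'C(n.*2, n)%:R = n.*2`!%:R / (n`!%:R * n`!%:R) :> R.
  apply: (mulIf (mulf_neq0 (f n) (f n))); rewrite divfK ?mulf_neq0//.
  rewrite -!natrM; congr (_%:R); rewrite -(@bin_fact n.*2 n); last by lia.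
  by rewrite (_ : (n.*2 - n = n)%N)//; lia.
have E1 : k.*2.+1%:R = 2 * k%:R + 1 :> R by rewrite -natr1 -mul2n natrM.
have E2 : k.*2.+2%:R = 2 * k%:R + 1 + 1 :> R by rewrite -natr1 E1.
have E3 : k.+1%:R = k%:R + 1 :> R by rewrite natr1.
rewrite /central_prob !h doubleS !factS !natrM exprS E1 E2 E3.
have f1 := f k.
have k1 : k%:R + 1 != 0 :> R by rewrite natr1 pnatr_eq0.
have k2 : 2 * k%:R + 1 + 1 != 0 :> R by rewrite -E2 pnatr_eq0.
have e4 : 4 ^+ k != 0 :> R by rewrite expf_neq0.
by field; rewrite k1 k2 e4 f1.
Qed.

(** A bound of Wallis type; its induction step is [(2 k + 1) (2 k + 3) <= (2 k + 2) ^ 2]. *)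
Lemma central_prob_sqr_le k : central_prob k ^+ 2 <= k.*2.+1%:R^-1.
Proof.
elim: k => [|k IH]; first by rewrite /central_prob bin0 expr0 divr1 expr1n invr1.
rewrite central_probS exprMn.
have d1 : 0 < k.*2.+1%:R :> R by [].
have d2 : 0 < k.*2.+2%:R :> R by [].
apply: (@le_trans _ _ (k.*2.+1%:R^-1 * (k.*2.+1%:R / k.*2.+2%:R) ^+ 2)).
  by apply: ler_wpM2r => //; exact: sqr_ge0.
have -> : k.*2.+1%:R^-1 * (k.*2.+1%:R / k.*2.+2%:R) ^+ 2 =
    k.*2.+1%:R / k.*2.+2%:R ^+ 2 :> R by field; rewrite !gt_eqF.
rewrite ler_pdivrMr ?exprn_gt0// mulrC ler_pdivlMr// doubleS.
by rewrite -natrX -natrM ler_nat; lia.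
Qed.

Lemma central_prob_sqr_ge k : (4 * k.+1)%:R^-1 <= central_prob k.+1 ^+ 2.
Proof.
elim: k => [|k IH].
  rewrite central_probS /central_prob bin0 expr0 divr1 mul1r muln1 /=.
  by rewrite expr_div_n expr1n -natrX div1r.
rewrite central_probS exprMn.
have d1 : 0 < k.+1.*2.+1%:R :> R by [].
have d2 : 0 < k.+1.*2.+2%:R :> R by [].
apply: (@le_trans _ _ ((4 * k.+1)%:R^-1 * (k.+1.*2.+1%:R / k.+1.*2.+2%:R) ^+ 2)).
  rewrite expr_div_n mulrA ler_pdivlMr ?exprn_gt0// mulrC ler_pdivrMr ?ltr0n//.
  rewrite mulrAC [(4 * _)%:R^-1 * _]mulrC -mulrA -(mulrC _ (_^-1)).
  rewrite mulrA ler_pdivlMr ?ltr0n// -!natrX -!natrM ler_nat; lia.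
by apply: ler_wpM2r => //; exact: sqr_ge0.
Qed.

Definition central_sum n : R := \sum_(k < n.+1) central_prob k ^+ 2.

(** A block has [3 * 4 ^ i] terms, each at most [1 / (2 * 4 ^ i)]. In the converse bound each is at
    least [1 / (4 * 4 ^ i.+1)], whence [3 / 16]. So the Green function grows linearly in the
    exponent of 4, that is logarithmically in time. *)
Lemma central_sum_block_le i :
  central_sum (4 ^ i.+1) <= central_sum (4 ^ i) + 2.
Proof.
have h4 : (4 ^ i <= 4 ^ i.+1)%N by rewrite leq_exp2l.
rewrite /central_sum -!(big_mkord xpredT (fun k => central_prob k ^+ 2)).
rewrite (@big_cat_nat _ _ _ (4 ^ i).+1)//= lerD2l.
have p0 : 0 < (4 ^ i)%:R :> R by rewrite ltr0n expn_gt0.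
apply: (@le_trans _ _ (\sum_((4 ^ i).+1 <= k < (4 ^ i.+1).+1) (2 * (4 ^ i)%:R)^-1)).
  rewrite !big_nat; apply: ler_sum => k /andP[ik _].
  apply: le_trans (central_prob_sqr_le k) _.
  by rewrite lef_pV2 ?posrE ?mulr_gt0// -natrM ler_nat; lia.
rewrite sumr_const_nat subSS -[leLHS]mulr_natr ler_pdivrMl ?mulr_gt0//.
by rewrite -!natrM ler_nat expnS; lia.
Qed.

Lemma central_sum_block_ge i :
  central_sum (4 ^ i) + 3 / 16 <= central_sum (4 ^ i.+1).
Proof.
have h4 : (4 ^ i <= 4 ^ i.+1)%N by rewrite leq_exp2l.
rewrite /central_sum -!(big_mkord xpredT (fun k => central_prob k ^+ 2)).
rewrite [leRHS](@big_cat_nat _ _ _ (4 ^ i).+1)//= lerD2l.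
have p0 : (0 < 4 ^ i)%N by rewrite expn_gt0.
apply: (@le_trans _ _ (\sum_((4 ^ i).+1 <= k < (4 ^ i.+1).+1) (4 * 4 ^ i.+1)%:R^-1)).
  rewrite sumr_const_nat subSS -[leRHS]mulr_natr [leRHS]mulrC ler_pdivlMr ?ltr0n ?muln_gt0 ?expn_gt0//.
  rewrite mulrAC ler_pdivrMr// -!natrM ler_nat expnS; lia.
rewrite !big_nat; apply: ler_sum => k /andP[ik ki].
case: k ik ki => // k _ ki; apply: le_trans (central_prob_sqr_ge k).
by rewrite lef_pV2 ?posrE ?ltr0n ?muln_gt0 ?expn_gt0// ler_nat leq_mul2l.
Qed.

Lemma central_sum_le (L d : nat) :
  central_sum (4 ^ (L + d)) <= central_sum (4 ^ L) + 2 * d%:R.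
Proof.
elim: d => [|d IH]; first by rewrite addn0 mulr0 addr0.
rewrite addnS; apply: le_trans (central_sum_block_le _) _.
by rewrite -natr1; lra.
Qed.

Lemma central_sum_ge L : 3 / 16 * L%:R <= central_sum (4 ^ L).
Proof.
elim: L => [|L IH].
  by rewrite mulr0; apply: sumr_ge0 => k _; exact: sqr_ge0.
by apply: le_trans (central_sum_block_ge _); rewrite -natr1; lra.
Qed.

Lemma central_sum0_le : central_sum (4 ^ 0) <= 2.
Proof.
rewrite expn0 /central_sum big_ord_recl big_ord1 /=.
have := central_prob_sqr_le 0; have := central_prob_sqr_le 1.
rewrite invr1 => h1 h0; apply: le_trans (lerD h0 h1) _.
by rewrite -[leRHS]/(1 + 1) lerD2l invf_le1// ler1n.
Qed.

Lemma half_geometric_sum_le (x : R) M : 0 <= x -> x < 1 ->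
  \sum_(j < M) x ^+ j./2 <= 2 / (1 - x).
Proof.
move=> x0 x1; have x1' : 0 < 1 - x by rewrite subr_gt0.
have e n : (1 - x) * \sum_(j < n.*2) x ^+ j./2 = 2 * (1 - x ^+ n).
  elim: n => [|n IH]; first by rewrite big_ord0 expr0 subrr !mulr0.
  rewrite doubleS !big_ord_recr /= !mulrDr IH.
  by rewrite uphalf_double doubleK exprS; ring.
rewrite ler_pdivlMr// mulrC; apply: (@le_trans _ _ (2 * (1 - x ^+ M))).
  rewrite -e; apply: ler_wpM2l; first exact: ltW.
  rewrite -!(big_mkord xpredT (fun j => x ^+ j./2)).
  rewrite [leRHS](@big_cat_nat _ _ _ M)//=; last by lia.
  by rewrite lerDl; apply: sumr_ge0 => j _; exact: exprn_ge0.
by rewrite ler_piMr// lerBlDr lerDl exprn_ge0.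
Qed.

End biased_line_walk.

(** * Drifted walks on the square lattice *)

Section plane.
Context {R : realType} {V : choiceType} {adj : rel V} {e : nat -> V}.
Variables (u v : V -> int) (o : V) (t : V -> V -> V).
(* For the square lattice, u and v are the sum and the difference of the two
   coordinates: along a simple random walk they perform independent walks. *)
Hypotheses (uv_inj : forall x y, u x = u y -> v x = v y -> x = y)
  (plane_nb : forall x, exists y1 y2 y3 y4,
     [/\ perm_eq (nb adj x) [:: y1; y2; y3; y4],
       u y1 = u x + 1 /\ v y1 = v x + 1, u y2 = u x + 1 /\ v y2 = v x - 1,
       u y3 = u x - 1 /\ v y3 = v x + 1 & u y4 = u x - 1 /\ v y4 = v x - 1]).
Hypotheses (G_bounded : bounded_degrees adj) (e_bij : bijective e)
  (t_aut : forall x, graph_isomorphism adj adj (t x))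
  (t_o : forall x, t x o = x)
  (t_u : forall x a b, u (t x a) - u (t x b) = u a - u b).
Local Notation K := (step_prob R adj).
Implicit Types lam : R.

Definition du x y : R := (u y - u x)%:~R.

(** A drift [lam] along [u] only. As [du] is 1 or -1 along edges, the weights still sum to 1, and
    [v] remains unbiased and independent of [u]. *)
Definition tilt lam x y : R := K x y * (1 + lam * du x y).

Lemma tilt0 : tilt 0 = K.
Proof.
by apply/funext => x; apply/funext => y; rewrite /tilt mul0r addr0 mulr1.
Qed.

Lemma plane_step lam x : exists y1 y2 y3 y4,
  [/\ u y1 = u x + 1 /\ v y1 = v x + 1, u y2 = u x + 1 /\ v y2 = v x - 1,
      u y3 = u x - 1 /\ v y3 = v x + 1, u y4 = u x - 1 /\ v y4 = v x - 1 &
   forall F : V -> R, \sum_(y <- nb adj x) tilt lam x y * F y =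
     (1 + lam) / 4 * (F y1 + F y2) + (1 - lam) / 4 * (F y3 + F y4)].
Proof.
have [y1 [y2 [y3 [y4 [xy [u1 v1] [u2 v2] [u3 v3] [u4 v4]]]]]] := plane_nb x.
exists y1, y2, y3, y4; split=> // F.
have deg : degree adj x = 4%N by rewrite /degree -/(size (nb adj x)) (perm_size xy).
have a y : y \in [:: y1; y2; y3; y4] -> adj x y.
  by rewrite -(perm_mem xy) mem_nb.
rewrite (perm_big _ xy)/= !big_cons big_nil /tilt /step_prob /du deg.
rewrite !a ?inE ?eqxx ?orbT// u1 u2 u3 u4.
have -> : u x + 1 - u x = 1 by lia.
have -> : u x - 1 - u x = - 1 by lia.
by rewrite rmorphN rmorph1; field.
Qed.

Lemma tilt_stochastic lam : 0 <= lam -> lam <= 1 -> stochastic adj (tilt lam).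
Proof.
move=> l0 l1; split=> [x y xy|x].
  have [y1 [y2 [y3 [y4 [xy' [u1 _] [u2 _] [u3 _] [u4 _]]]]]] := plane_nb x.
  have : y \in [:: y1; y2; y3; y4] by rewrite -(perm_mem xy') mem_nb.
  rewrite /tilt /step_prob xy !inE => yy; apply: mulr_ge0; first by rewrite invr_ge0.
  have [->|->] : du x y = 1 \/ du x y = - 1.
  - rewrite /du; move: yy => /orP[/eqP ->|/orP[/eqP ->|/orP[/eqP ->|/eqP ->]]].
    + by left; rewrite u1 (_ : u x + 1 - u x = 1)//; lia.
    + by left; rewrite u2 (_ : u x + 1 - u x = 1)//; lia.
    + by right; rewrite u3 (_ : u x - 1 - u x = - 1) ?rmorphN ?rmorph1//; lia.
    + by right; rewrite u4 (_ : u x - 1 - u x = - 1) ?rmorphN ?rmorph1//; lia.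
  - lra.
  - lra.
have [y1 [y2 [y3 [y4 [_ _ _ _ hF]]]]] := plane_step lam x.
under eq_bigr do rewrite -[tilt _ _ _]mulr1.
by rewrite (hF (fun=> 1)); field.
Qed.

Lemma tilt_heat lam n x z :
  walkE adj (tilt lam) n x (fun s => (last x s == z)%:R) =
  line_law lam n (u z - u x) * line_law 0 n (v z - v x).
Proof.
elim: n x => [|n IH] x.
  rewrite /= !subr_eq0; have [->|xz] := eqVneq x z; first by rewrite !eqxx mulr1.
  have [uz|_] := eqVneq (u z) (u x); last by rewrite mul0r.
  have [vz|_] := eqVneq (v z) (v x); last by rewrite mulr0.
  by rewrite (uv_inj uz vz) eqxx in xz.
have [y1 [y2 [y3 [y4 [[u1 v1] [u2 v2] [u3 v3] [u4 v4] hF]]]]] := plane_step lam x.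
transitivity (\sum_(y <- nb adj x) tilt lam x y *
    (line_law lam n (u z - u y) * line_law 0 n (v z - v y))).
  by apply: eq_bigr => y _; congr (_ * _); exact: IH.
rewrite hF u1 u2 u3 u4 v1 v2 v3 v4 /=.
have -> : u z - (u x + 1) = u z - u x - 1 by lia.
have -> : u z - (u x - 1) = u z - u x + 1 by lia.
have -> : v z - (v x + 1) = v z - v x - 1 by lia.
have -> : v z - (v x - 1) = v z - v x + 1 by lia.
by field.
Qed.

Local Notation ret lam := (return_prob (adj := adj) (tilt lam) o).

Lemma tilt_return lam n : ret lam n = line_law lam n 0 * line_law 0 n 0.
Proof. by rewrite /return_prob tilt_heat !subrr. Qed.

Lemma tilt_return_even lam k :
  ret lam k.*2 = (1 - lam ^+ 2) ^+ k * central_prob k ^+ 2.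
Proof.
rewrite tilt_return !line_law_even [0 ^+ 2]expr2 mul0r subr0 expr1n mul1r.
by rewrite -mulrA -expr2.
Qed.

Lemma tilt_return_odd lam k : ret lam k.*2.+1 = 0.
Proof. by rewrite tilt_return line_law_odd mul0r. Qed.

Lemma parity_cases (n : nat) : exists k, n = k.*2 \/ n = k.*2.+1.
Proof.
exists n./2; have := odd_double_half n; case: (odd n) => /= h; [right|left]; lia.
Qed.

Lemma tilt_return_le lam n : 0 <= lam -> lam <= 1 -> ret lam n <= ret 0 n.
Proof.
move=> l0 l1; have [k [->|->]] := parity_cases n; last by rewrite !tilt_return_odd.
rewrite !tilt_return_even; apply: ler_wpM2r; first exact: sqr_ge0.
rewrite [0 ^+ 2]expr2 mul0r subr0 expr1n; apply: exprn_ile1.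
  by rewrite subr_ge0 exprn_ile1.
by rewrite lerBlDr lerDl sqr_ge0.
Qed.

Lemma tilt_return_decay lam n : 0 <= lam -> lam <= 1 ->
  ret lam n <= (1 - lam ^+ 2) ^+ n./2 * n.+1%:R^-1.
Proof.
move=> l0 l1; have x0 : 0 <= 1 - lam ^+ 2 by rewrite subr_ge0 exprn_ile1.
have [k [->|->]] := parity_cases n.
  rewrite tilt_return_even doubleK; apply: ler_wpM2l; first exact: exprn_ge0.
  exact: central_prob_sqr_le.
by rewrite tilt_return_odd mulr_ge0 ?exprn_ge0 ?invr_ge0.
Qed.

Lemma green_even n : green (adj := adj) K o n.*2 = central_sum n.
Proof.
rewrite -tilt0; elim: n => [|n IH].
  rewrite /green /central_sum !big_ord1 (tilt_return_even 0 0).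
  by rewrite expr0 mul1r.
rewrite /green doubleS 2!big_ord_recr /= -/(green (adj := adj) (tilt 0) o n.*2) IH.
rewrite -doubleS tilt_return_odd addr0 tilt_return_even [0 ^+ 2]expr2 mul0r subr0 expr1n mul1r.
by rewrite /central_sum [RHS]big_ord_recr.
Qed.

(** Up to time [m] the drift can only lower the return probabilities, so the Green function of the
    simple walk may be used. After [m] the factor [1 / (j + 1)] is at most [1 / (m + 1)], and the
    drift leaves a geometric series of sum at most [2 / lam ^+ 2]. *)
Lemma tilt_no_return_ge lam m n : 0 < lam -> lam <= 1 ->
  1 - 2 / (m.+1%:R * lam ^+ 2) <=
  no_return_prob (adj := adj) (tilt lam) o n * green (adj := adj) K o m.
Proof.
move=> l0 l1; have l0' := ltW l0.
have K_stoch := tilt_stochastic l0' l1.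
have l20 : 0 < lam ^+ 2 by exact: exprn_gt0.
have m0 : 0 < m.+1%:R :> R by [].
rewrite lerBlDr; apply: le_trans (no_return_prob_ge G_bounded o K_stoch m n) _.
apply: lerD.
  apply: ler_wpM2l; first exact: (no_return_prob_ge0 G_bounded o K_stoch).
  by rewrite -tilt0; apply: ler_sum => j _; exact: tilt_return_le.
set x := 1 - lam ^+ 2.
have x0 : 0 <= x by rewrite subr_ge0 exprn_ile1.
have x1 : x < 1 by rewrite ltrBlDr ltrDl.
apply: (@le_trans _ _ (\sum_(m.+1 <= j < (m + n).+1) x ^+ j./2 * m.+1%:R^-1)).
  rewrite !big_nat; apply: ler_sum => j /andP[mj _].
  apply: le_trans (tilt_return_decay j l0' l1) _.
  apply: ler_wpM2l; first exact: exprn_ge0.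
  by rewrite lef_pV2 ?posrE// ler_nat; lia.
rewrite -mulr_suml ler_pdivrMr//.
apply: (@le_trans _ _ (\sum_(j < (m + n).+1) x ^+ j./2)).
  rewrite -(big_mkord xpredT (fun j => x ^+ j./2)).
  rewrite [leRHS](@big_cat_nat _ _ _ m.+1)//=; last by lia.
  by rewrite lerDr; apply: sumr_ge0 => j _; exact: exprn_ge0.
apply: le_trans (half_geometric_sum_le _ x0 x1) _.
have -> : 1 - x = lam ^+ 2 by rewrite /x; ring.
rewrite le_eqVlt; apply/orP; left; apply/eqP; field.
by rewrite !gt_eqF.
Qed.

Lemma tilt_drift lam n x : 0 <= lam -> lam <= 1 ->
  walkE adj (tilt lam) n x (fun s => du x (last x s)) = n%:R * lam.
Proof.
move=> l0 l1; elim: n x => [|n IH] x; first by rewrite /= /du subrr mul0r.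
transitivity (\sum_(y <- nb adj x) tilt lam x y * (du x y + n%:R * lam)).
  apply: eq_bigr => y _; congr (_ * _).
  rewrite -(IH y) -[X in _ = X + _](walkE_cst n y _ (tilt_stochastic l0 l1)) -walkED.
  congr walkE; apply/funext => s /=; rewrite /du -rmorphD.
  by congr (_%:~R); lia.
have [y1 [y2 [y3 [y4 [[u1 _] [u2 _] [u3 _] [u4 _] hF]]]]] := plane_step lam x.
rewrite hF /du u1 u2 u3 u4.
have -> : u x + 1 - u x = 1 by lia.
have -> : u x - 1 - u x = - 1 by lia.
by rewrite rmorphN rmorph1 -natr1; field.
Qed.

(** Change of measure: the density of one step is [1 + lam * du], at most [expR (lam * du)], and the
    exponents telescope to the displacement. *)
Lemma tilt_le_exp lam n x (F : seq V -> R) : 0 <= lam -> lam <= 1 ->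
  (forall s, 0 <= F s) ->
  walkE adj (tilt lam) n x (fun s => F s * expR (- lam * du x (last x s))) <=
  walkE adj K n x F.
Proof.
move=> l0 l1; elim: n x F => [|n IH] x F F0.
  by rewrite /= /du subrr mulr0 expR0 mulr1.
rewrite /= !big_seq; apply: ler_sum => y; rewrite mem_nb// => xy.
have K0 : 0 <= K x y by rewrite /step_prob xy invr_ge0.
have -> : (fun s => F (y :: s) * expR (- lam * du x (last y s))) =
    (fun s => expR (- lam * du x y) * (F (y :: s) * expR (- lam * du y (last y s)))).
  apply/funext => s; rewrite mulrCA -expRD; congr (_ * expR _).
  rewrite -mulrDr; congr (_ * _); rewrite /du -rmorphD.
  by congr (_%:~R); lia.
rewrite walkEZ mulrA; apply: ler_pM.
- apply: mulr_ge0; last exact: expR_ge0.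
  exact: (tilt_stochastic l0 l1).1.
- apply: walkE_ge0; [exact: G_bounded|exact: (tilt_stochastic l0 l1).1|move=> s].
  by rewrite mulr_ge0 ?expR_ge0.
- rewrite /tilt -mulrA -[leRHS]mulr1; apply: ler_wpM2l => //.
  rewrite mulNr expRN ler_pdivrMr ?expR_gt0// mul1r.
  exact: expR_ge1Dx.
- by apply: IH => s; exact: F0.
Qed.

Lemma tilt_range lam n : 0 <= lam -> lam <= 1 ->
  walkE adj (tilt lam) n o (fun s => (size (undup (o :: s)))%:R) =
  \sum_(k < n.+1) no_return_prob (adj := adj) (tilt lam) o k.
Proof.
move=> l0 l1; pose m (s : seq V) : R := (size (undup s))%:R.
have K_hom x : exists f, [/\ graph_isomorphism adj adj f,
     forall a b, tilt lam (f a) (f b) = tilt lam a b,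
     forall s, m (map f s) = m s & f o = x].
  exists (t x); split=> // [a b|s].
    by rewrite /tilt step_prob_aut// /du t_u.
  by rewrite /m undup_map_inj ?size_map//; exact: bij_inj (t_aut x).1.
have m_nil : m [::] = 0 by [].
rewrite (walkE_total G_bounded (tilt_stochastic l0 l1) m_nil K_hom).
apply: eq_bigr => k _; congr walkE; apply/funext => s; rewrite /m /=.
by case: (o \in s) => /=; rewrite ?subrr// -natr1 addrC addKr.
Qed.

Section plane_Lambda.
Context {dX : measure_display} {X : measurableType dX}.
Context {omega : X -> {fset V} -> bool} {q : R} {P : probability X R}.
Hypotheses (adj_sym : symmetric adj) (G_transitive : vertex_transitive adj)
  (perc : is_bernoulli_percolation adj omega q P).
Local Notation C := (cluster_of adj omega).
Context {dW : measure_display} {W : measurableType dW} {S : nat -> W -> V}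
  {PW : V -> probability W R}.
Hypothesis S_walk : is_simple_random_walk adj S PW.
Hypothesis chi_fin : (\int[P]_w counting (C w [:: o]) < +oo)%E.
Local Notation Lambda := (Lambda adj S omega (PW o) P).

(* Jensen's inequality for the tilted walk, whose relative entropy per step
   with respect to the simple random walk is at most lam ^+ 2. *)
Lemma plane_Lambda_ge (theta lam b : R) : 0 < theta -> 0 <= lam -> lam <= 1 ->
  (forall n, b <= no_return_prob (adj := adj) (tilt lam) o n) ->
  ((theta * b - lam ^+ 2)%:E <= Lambda theta)%E.
Proof.
move=> th0 l0 l1 hb; have K_stoch := tilt_stochastic l0 l1.
apply: Lambda_ge => n.
apply: le_trans (partition_function_ge adj_sym G_bounded e_bij S_walk perc o
  (B := fun s => expR (theta * (size (undup s))%:R)) _ _); last 2 first.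
- by move=> s; exact: expR_ge0.
- move=> s _; apply: le_trans (exp_counting_ge adj_sym perc G_transitive e_bij
    chi_fin s (ltW th0)).
  rewrite lee_fin ler_expR; apply: ler_wpM2l; first exact: ltW.
  exact: (mean_size_ge adj_sym perc G_transitive e_bij chi_fin).
rewrite lee_fin.
apply: le_trans (tilt_le_exp n o (F := fun s =>
  expR (theta * (size (undup (o :: s)))%:R)) l0 l1 _); last first.
  by move=> s; exact: expR_ge0.
apply: (@le_trans _ _ (walkE adj (tilt lam) n o (fun s =>
    expR (theta * (size (undup (o :: s)))%:R + - lam * du o (last o s))))); last first.
  rewrite le_eqVlt; apply/orP; left; apply/eqP; congr walkE.
  by apply/funext => s; rewrite expRD.
apply: le_trans (walkE_jensen G_bounded n o _ K_stoch).
rewrite ler_expR walkED (walkEZ _ _ n o theta) (walkEZ _ _ n o (- lam)) tilt_range// tilt_drift//.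
have h1 : n.+1%:R * b <= \sum_(k < n.+1) no_return_prob (adj := adj) (tilt lam) o k.
  rewrite mulr_natl -[X in _ *+ X]card_ord -sumr_const.
  by apply: ler_sum => k _; exact: hb.
have h2 := ler_wpM2l (ltW th0) h1.
have h3 : n%:R * lam ^+ 2 <= n.+1%:R * lam ^+ 2.
  by apply: ler_wpM2r; rewrite ?sqr_ge0// ler_nat.
by move: h2 h3; rewrite expr2; lra.
Qed.

End plane_Lambda.
End plane.

(** * Time scales between which the Green function is almost constant *)

Section scales.
Context {R : realType}.

Lemma exp4_ge j : j.+1%:R <= 2 ^+ j :> R.
Proof. by rewrite -natrX ler_nat; exact: ltn_expl. Qed.

Lemma scales_exist (kappa xi A : R) : 0 < kappa -> 0 < xi -> exists K l0 : nat,
  (0 < K)%N /\ forall l, (l0 <= l)%N -> let j := (l %/ K)%N in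
   [/\ (1 <= j)%N, (2 * j <= l)%N,
     central_sum (4 ^ (l + 2 * j)) <= (1 + kappa) * central_sum (4 ^ (l - 2 * j)),
     4 ^- j * central_sum (4 ^ (l + 2 * j)) <= xi &
     A <= kappa * central_sum (4 ^ (l - 2 * j)) :> R].
Proof.
move=> k0 x0.
(* Between the scales [l - 2 * j] and [l + 2 * j] there are [4 * j] blocks, which add at most
   [8 * j]. At the lower scale the sum is at least [3 / 16 * (K - 2) * j], and [43 * 3 / 16 > 8]. *)
pose K := (Num.bound (43 / kappa)).+3.
have hK : 43 <= kappa * (K - 2)%:R.
  rewrite mulrC -ler_pdivrMr//; apply: le_trans (ltW (unstable.ltr_bound _)) _.
  by rewrite ler_nat /K !subSS subn0 leqnSn.
(* The sum at the upper scale is at most [(2 * K + 6) * j.+1]. As [j.+1 <= 2 ^+ j], half of the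
   factor [4 ^+ j] absorbs [j.+1], and the other half absorbs [(2 * K + 6) / xi]. *)
pose j0 := (Num.bound ((2 * K + 6)%:R / xi) + Num.bound A).+1.
exists K, (K * j0)%N; split=> // l hl j.
have Kj : (K * j <= l)%N by rewrite mulnC leq_trunc_div.
have lK : (l < K * j.+1)%N by rewrite mulnC ltn_ceil.
have jj0 : (j0 <= j)%N by rewrite /j leq_divRL// mulnC.
have j1 : (1 <= j)%N by apply: leq_trans jj0.
have K3 : (3 <= K)%N by [].
have jl : (2 * j <= l)%N by apply: leq_trans Kj; rewrite leq_mul2r; lia.
set GN := central_sum (4 ^ (l - 2 * j)).
set Gm := central_sum (4 ^ (l + 2 * j)).
have GN_ge : 8 * j%:R <= kappa * GN.
  have h : 3 / 16 * (l - 2 * j)%:R <= GN by exact: central_sum_ge.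
  have h' : (K - 2)%:R * j%:R <= (l - 2 * j)%:R :> R.
    by rewrite -natrM ler_nat mulnBl; lia.
  have h2 : kappa * (3 / 16 * ((K - 2)%:R * j%:R)) <= kappa * GN.
    apply: ler_wpM2l; first exact: ltW.
    by apply: le_trans h; apply: ler_wpM2l.
  have h3 : 43 * j%:R <= kappa * (K - 2)%:R * j%:R by apply: ler_wpM2r.
  have j00 : 0 <= j%:R :> R by [].
  lra.
have Gm_le : Gm <= GN + 8 * j%:R.
  have := @central_sum_le R (l - 2 * j) (4 * j).
  rewrite (_ : l - 2 * j + 4 * j = l + 2 * j)%N; last by lia.
  rewrite -/Gm -/GN natrM; lra.
split=> //.
- by rewrite mulrDl mul1r; lra.
- have Gm_le' : Gm <= (2 * K + 6)%:R * j.+1%:R.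
    have h1 := @central_sum_le R 0 (l + 2 * j); rewrite add0n -/Gm in h1.
    have h0 := @central_sum0_le R.
    have h2 : 2 + 2 * (l + 2 * j)%:R <= ((2 * K + 6) * j.+1)%:R :> R.
      by rewrite -[2]/(2%:R) -natrM -natrD ler_nat; nia.
    rewrite -natrM; lra.
  rewrite ler_pdivrMl ?exprn_gt0//.
  apply: le_trans Gm_le' _.
  have e4 : 4 ^+ j = 2 ^+ j * 2 ^+ j :> R by rewrite -exprMn -natrM.
  rewrite e4 -mulrA mulrC.
  apply: ler_pM => //; first exact: exp4_ge.
  rewrite -ler_pdivrMr//; apply: le_trans (exp4_ge j).
  apply: le_trans (ltW (unstable.ltr_bound _)) _.
  by rewrite ler_nat; apply: leq_trans (leq_trans jj0 (leqnSn j));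
    rewrite /j0; move: (Num.bound _) (Num.bound A) => b1 b2; lia.
- apply: le_trans GN_ge.
  apply: le_trans (ltW (unstable.ltr_bound _)) _.
  apply: (@le_trans _ _ j%:R); last by have : 0 <= j%:R :> R by []; lra.
  by rewrite ler_nat; apply: leq_trans jj0;
    rewrite /j0; move: (Num.bound _) (Num.bound A) => b1 b2; lia.
Qed.

Lemma dyadic_scale (theta : R) l0 : 0 < theta -> theta < 4 ^- l0 ->
  exists l, [/\ (l0 <= l)%N, 4 ^- l.+1 < theta & theta <= 4 ^- l].
Proof.
move=> th0 thl.
have ex : exists l, 4 ^- l.+1 < theta.
  exists (Num.bound theta^-1); rewrite -[ltRHS]invrK ltf_pV2 ?posrE ?exprn_gt0 ?invr_gt0//.
  apply: lt_le_trans (unstable.ltr_bound _) _.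
  by rewrite -natrX ler_nat; apply: ltnW; apply: ltn_trans (ltnSn _) (ltn_expl _ _).
case: (ex_minnP ex) => l hl lmin; exists l; split=> //.
  rewrite leqNgt; apply/negP => ll0.
  have : 4 ^- l0 <= 4 ^- l.+1 :> R.
    by rewrite lef_pV2 ?posrE ?exprn_gt0// ler_weXn2l// ler1n.
  by lra.
case: l hl lmin => [|l] hl lmin.
  rewrite expr0 invr1; apply: le_trans (ltW thl) _.
  by rewrite invf_le1 ?exprn_gt0// exprn_ege1// ler1n.
by rewrite leNgt; apply/negP => /lmin; rewrite ltnn.
Qed.

(* z stands for 4 ^- j, GN and Gm for the Green functions at the two time
   scales between which the logarithm is almost constant. *)
Lemma scale_arith (eps z GN Gm A D : R) : 0 < eps -> eps <= 1 ->
  0 <= z -> 1 <= GN -> 1 <= Gm -> 0 <= D ->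
  Gm <= (1 + eps / 16) * GN -> z * Gm <= eps / (40 * (D + 1)) ->
  A <= eps / 16 * GN ->
  [/\ 0 < (1 - z) / Gm - 4 * z &
    (1 + eps / 16 + A / GN) / GN + D * z <= (1 + eps) * ((1 - z) / Gm - 4 * z)].
Proof.
move=> e0 e1 z0 GN1 Gm1 D0 hG hz hA.
have GN0 : 0 < GN by lra.
have Gm0 : 0 < Gm by lra.
have D1 : 0 < D + 1 by lra.
have hz1 : z * Gm * (40 * (D + 1)) <= eps.
  by rewrite -ler_pdivlMr// mulr_gt0.
have zz : z <= z * Gm by rewrite ler_peMr.
have zD : 0 <= z * Gm * D by rewrite mulr_ge0// mulr_ge0// ltW.
(* As [z <= z * Gm], the loss is at most [5 * z * Gm], hence at most [eps / 8]; this accounts for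
   the constant 40. *)
have low : 1 - eps / 8 <= Gm * ((1 - z) / Gm - 4 * z).
  rewrite mulrBr mulrCA divff ?gt_eqF// mulr1; lra.
have up : Gm * ((1 + eps / 16 + A / GN) / GN + D * z) <= 1 + eps / 2.
  have hA' : A / GN <= eps / 16 by rewrite ler_pdivrMr.
  have h1 : Gm * ((1 + eps / 16 + A / GN) / GN) <= (1 + eps / 16) * (1 + eps / 8).
    apply: (@le_trans _ _ (Gm / GN * (1 + eps / 8))).
      rewrite mulrA mulrAC; apply: ler_wpM2l; last by lra.
      by rewrite divr_ge0// ltW.
    by apply: ler_wpM2r; [lra|rewrite ler_pdivrMr].
  have ee : eps * eps <= eps by rewrite ler_piMr// ltW.
  rewrite mulrDr; lra.
split.
  by rewrite -(pmulr_rgt0 _ Gm0); lra.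
rewrite -(ler_pM2l Gm0) mulrCA; apply: le_trans up _.
have ee : eps * eps <= eps by rewrite ler_piMr// ltW.
have : (1 + eps) * (1 - eps / 8) <= (1 + eps) * (Gm * ((1 - z) / Gm - 4 * z)).
  by apply: ler_wpM2l => //; lra.
by lra.
Qed.

End scales.

(** The ordering already makes the ratio at least 1, so it is enough to have a positive bound [B]
    below the denominator that the numerator exceeds by a factor at most [1 + eps]. *)
Lemma ratio_cvg_squeeze {R : realType} (L1 L2 : R -> \bar R) :
  (forall theta, 0 < theta -> (L2 theta <= L1 theta)%E) ->
  (forall eps, 0 < eps -> eps <= 1 -> exists2 delta, 0 < delta &
     forall theta, 0 < theta -> theta < delta -> exists2 B, 0 < B &
       (B%:E <= L2 theta)%E /\ (L1 theta <= ((1 + eps) * B)%:E)%E) ->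
  (L1 theta / L2 theta)%E @[theta --> 0^'+] --> 1%:E.
Proof.
move=> L21 h; apply: ratio_cvg => eps eps0.
have m0 : 0 < Num.min eps 1 by rewrite lt_min eps0 ltr01.
have m1 : Num.min eps 1 <= 1 by rewrite ge_min lexx orbT.
have [delta d0 hd] := h _ m0 m1; exists delta => // theta th0 thd.
have [B B0 [BL2 L1B]] := hd theta th0 thd; have L := L21 theta th0.
move: BL2 L L1B; case: (L2 theta) => [r2| |]; last 2 first.
- by move=> _; rewrite leye_eq => /eqP ->.
- by rewrite leeNy_eq.
case: (L1 theta) => [r1| |]; rewrite ?lee_fin// => Br2 r21 r1B.
have r20 : 0 < r2 by apply: lt_le_trans Br2.
exists (r1 / r2); first by rewrite inver gt_eqF.
have h1 : 1 <= r1 / r2 by rewrite ler_pdivlMr// mul1r.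
rewrite distrC ger0_norm ?subr_ge0// lerBlDl.
apply: (@le_trans _ _ (1 + Num.min eps 1)); last by rewrite lerD2l ge_min lexx.
rewrite ler_pdivrMr//; apply: le_trans r1B _; apply: ler_wpM2l => //.
by apply: addr_ge0 => //; exact: ltW.
Qed.

Section zero_parameter.
Context {R : realType} {V : choiceType} {adj : rel V} {e : nat -> V}.
Hypotheses (adj_sym : symmetric adj)
  (G_transitive : vertex_transitive adj)
  (G_bounded : bounded_degrees adj) (e_bij : bijective e).
Context {dW : measure_display} {W : measurableType dW} {S : nat -> W -> V}
  {PW : V -> probability W R}.
Hypothesis S_walk : is_simple_random_walk adj S PW.
Context {dX : measure_display} {X : measurableType dX}.
Context {omega : X -> {fset V} -> bool} {q : R} {P P0 : probability X R}.
Hypotheses (perc : is_bernoulli_percolation adj omega q P)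
  (perc0 : is_bernoulli_percolation adj omega (0 : R) P0).
Variable o : V.
Hypothesis chi_fin :
  (\int[P]_w counting (cluster_of adj omega w [:: o]) < +oo)%E.

(** The two laws are compared path by path through the number of distinct vertices: at parameter 0
    this number is the size of the clusters, and at parameter [q] it bounds their mean size from
    below. *)
Lemma Lambda_zero_le (theta : R) : 0 <= theta ->
  (Lambda adj S omega (PW o) P0 theta <= Lambda adj S omega (PW o) P theta)%E.
Proof.
move=> th0; apply: le_ereal_inf_tmp => _ [[//|n] _ <-].
apply: le_trans (_ : (_ <= lne (partition_function (adj := adj) (S := S)
   (PW := PW) (omega := omega) (P := P0) o theta n) / n.+1%:R%:E)%E) _.
  by apply: ereal_inf_lbound; exists n.+1.
have n0 : 0 < n.+1%:R :> R by [].
rewrite inver gt_eqF//; apply: lee_wpmul2r; first by rewrite lee_fin invr_ge0.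
rewrite lee_lne ?in_itv/= ?leey ?andbT.
- apply: le_trans (partition_function_le adj_sym G_bounded e_bij S_walk perc0 o
    (B := fun s => expR (theta * (size (undup s))%:R)) _ _) _.
  + by move=> s; exact: expR_ge0.
  + by move=> s _; exact: (exp_counting0_le adj_sym perc0 e_bij).
  apply: (partition_function_ge adj_sym G_bounded e_bij S_walk perc o
    (B := fun s => expR (theta * (size (undup s))%:R))).
  + by move=> s; exact: expR_ge0.
  + move=> s _; apply: le_trans (exp_counting_ge adj_sym perc G_transitive e_bij
      chi_fin s th0).
    rewrite lee_fin ler_expR; apply: ler_wpM2l => //.
    exact: (mean_size_ge adj_sym perc G_transitive e_bij chi_fin).
- by apply: integral_ge0 => z _; exact: expeR_ge0.
- by apply: integral_ge0 => z _; exact: expeR_ge0.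
Qed.

End zero_parameter.

(** * The ratio on the line and on the square lattice *)

Section ratios.
Context {R : realType} {V : choiceType} {adj : rel V} {e : nat -> V}.
Hypotheses (adj_sym : symmetric adj)
  (V_infinite : infinite_set [set: V]) (G_connected : connected_graph adj)
  (G_transitive : vertex_transitive adj)
  (G_bounded : bounded_degrees adj) (e_bij : bijective e).
Context {dW : measure_display} {W : measurableType dW} {S : nat -> W -> V}
  {PW : V -> probability W R}.
Hypothesis S_walk : is_simple_random_walk adj S PW.
Context {dX : measure_display} {X : measurableType dX}.
Context {omega : X -> {fset V} -> bool} {q : R} {P P0 : probability X R}.
Hypotheses (q0 : 0 <= q) (q1 : q <= 1)
  (perc : is_bernoulli_percolation adj omega q P)
  (perc0 : is_bernoulli_percolation adj omega (0 : R) P0).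
Variable o : V.
Local Notation C := (cluster_of adj omega).
Local Notation K := (step_prob R adj).
Hypothesis chi_fin : (\int[P]_w counting (C w [:: o]) < +oo)%E.
Local Notation beta := (beta (adj := adj) (omega := omega) (P := P)).
Local Notation Lambda := (Lambda adj S omega (PW o)).

Let K_stoch : stochastic adj K. Proof. exact: step_prob_stochastic. Qed.

Lemma line_ratio (h : V -> int) : bijective h ->
  (forall x y, adj x y = (`|h x - h y| == 1)) ->
  (Lambda P theta / Lambda P0 theta)%E @[theta --> 0^'+] --> 1%:E.
Proof.
move=> h_bij adjE; apply: ratio_cvg_squeeze => [theta th0|eps eps0 _].
  by apply: (Lambda_zero_le adj_sym G_transitive G_bounded e_bij S_walk perc perc0
    chi_fin); exact: ltW.
have [a [t [a0 ht]]] := exp_moment q0 q1 adj_sym perc G_bounded G_transitive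
  e_bij chi_fin.
exists (a / 2) => [|theta th0 tha]; first by rewrite divr_gt0.
have l0 : 0 < ln (cosh theta) by rewrite ln_gt0// cosh_gt1.
exists (ln (cosh theta)) => //; split.
  exact: (line_Lambda_ge h_bij adjE G_bounded e_bij adj_sym
    G_transitive perc0 S_walk (chi0_fin adj_sym e_bij perc0 o) th0).
apply: le_trans (line_Lambda_le h_bij adjE G_bounded e_bij q0 q1 adj_sym
    perc S_walk o th0 a0 (ltW tha) ht) _.
by rewrite lee_fin mulrDl mul1r lerDl mulr_ge0// ltW.
Qed.

Section plane.
Variables (u v : V -> int) (t : V -> V -> V) (iota : V -> V).
Hypotheses (uv_inj : forall x y, u x = u y -> v x = v y -> x = y)
  (plane_nb : forall x, exists y1 y2 y3 y4,
     [/\ perm_eq (nb adj x) [:: y1; y2; y3; y4],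
       u y1 = u x + 1 /\ v y1 = v x + 1, u y2 = u x + 1 /\ v y2 = v x - 1,
       u y3 = u x - 1 /\ v y3 = v x + 1 & u y4 = u x - 1 /\ v y4 = v x - 1]).
Hypotheses (t_aut : forall x, graph_isomorphism adj adj (t x))
  (t_o : forall x, t x o = x) (t_iota : forall x, t x (iota x) = o)
  (iota_bij : bijective iota)
  (t_u : forall x a b, u (t x a) - u (t x b) = u a - u b).

(* With theta of order 4 ^- l, the walk is stopped at time 4 ^ (l - j), the
   increments are estimated at time 2 * 4 ^ (l - 2 * j), and the tilt 2 ^- (l + j)
   makes the walk transient beyond time 4 ^ (l + 2 * j). *)
Lemma plane_lower_scale (theta : R) l j :
  (2 * j <= l)%N -> 4 ^- l.+1 < theta ->
  ((theta * ((1 - 4 ^- j) / central_sum (4 ^ (l + 2 * j)) - 4 * 4 ^- j))%:E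
    <= Lambda P0 theta)%E.
Proof.
move=> jl hl; have th0 : 0 < theta by apply: lt_trans hl; rewrite invr_gt0 exprn_gt0.
set z : R := 4 ^- j; set Gm := central_sum _; pose lam : R := 2 ^- (l + j).
have lam0 : 0 < lam by rewrite invr_gt0 exprn_gt0.
have lam1 : lam <= 1 by rewrite invf_le1 ?exprn_gt0// exprn_ege1// ler1n.
have lamE : lam ^+ 2 = 4 ^- l * z.
  by rewrite /lam /z -invfM -exprD exprVn -exprM mulnC exprM -natrX.
pose m := ((4 ^ (l + 2 * j)).*2)%N.
have GmE : green (adj := adj) K o m = Gm by apply: (green_even o uv_inj plane_nb G_bounded).
have Gm1 : 1 <= Gm by rewrite -GmE; exact: (green_ge1 G_bounded o K_stoch).
have Gm0 : 0 < Gm by apply: lt_le_trans Gm1.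
have z0 : 0 < z by rewrite invr_gt0 exprn_gt0.
(* Here [m] is [2 * 4 ^ (l + 2 * j)] and [lam ^+ 2] is [4 ^- (l + j)], so their product is
   [2 * 4 ^+ j]. *)
have tail : 2 / (m.+1%:R * lam ^+ 2) <= z.
  rewrite ler_pdivrMr ?mulr_gt0 ?exprn_gt0//.
  have h1 : 2 * 4 ^+ (l + 2 * j) <= m.+1%:R :> R.
    by rewrite -natrX -[2]/(2%:R) -natrM ler_nat /m -mul2n.
  have e1 : 2 * 4 ^+ (l + 2 * j) * (lam ^+ 2 * z) = 2.
    rewrite lamE /z exprD.
    have e2 : 4 ^+ (2 * j) = 4 ^+ j * 4 ^+ j :> R by rewrite mul2n -addnn exprD.
    by rewrite e2; field; rewrite !expf_neq0// pnatr_eq0.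
  rewrite (_ : z * _ = m.+1%:R * (lam ^+ 2 * z)); last by ring.
  rewrite -[leLHS]e1; apply: ler_wpM2r => //.
  by rewrite mulr_ge0 ?sqr_ge0// ltW.
apply: le_trans (plane_Lambda_ge plane_nb G_bounded e_bij t_aut t_o t_u
  adj_sym G_transitive perc0 S_walk (chi0_fin adj_sym e_bij perc0 o) th0
  (ltW lam0) lam1 (b := (1 - z) / Gm) _); last first.
  move=> n; rewrite ler_pdivrMr//.
  have := tilt_no_return_ge o uv_inj plane_nb G_bounded m n lam0 lam1.
  by rewrite GmE; apply: le_trans; rewrite lerD2l lerN2.
(* The entropy cost is [lam ^+ 2 = 4 ^- l * z], at most [4 * theta * z] because
   [4 ^- l.+1 < theta]. *)
rewrite lee_fin mulrBr lerB// lamE mulrA; apply: ler_wpM2r; first exact: ltW.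
move: hl; rewrite exprS invfM; lra.
Qed.

Lemma plane_upper_scale (theta eta a T A : R) l j :
  (2 * j <= l)%N -> (1 <= j)%N -> 0 < theta -> theta <= 4 ^- l ->
  0 < a -> 4 ^- j <= a / 2 ->
  (forall x, (\int[P]_w expeR (a%:E * counting (C w [:: x])) <= T%:E)%E) ->
  (forall n, green (adj := adj) K o n *
     mean_increment (adj := adj) (omega := omega) (P := P) o n <=
     1 + eta + A / green (adj := adj) K o n) ->
  (Lambda P theta <= (theta * ((1 + eta + A / central_sum (4 ^ (l - 2 * j))) /
     central_sum (4 ^ (l - 2 * j)) + (2 * beta o [::] + 16 * T / a ^+ 2) * 4 ^- j))%:E)%E.
Proof.
move=> jl j1 th0 thl a0 za hT hA; set G := central_sum _; set z : R := 4 ^- j in za *.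
have z0 : 0 < z by rewrite invr_gt0 exprn_gt0.
have T0 : 0 <= T.
  rewrite -lee_fin; apply: le_trans (hT o).
  by apply: integral_ge0 => w _; exact: expeR_ge0.
(* This [n] gives [theta * n.+1 <= 4 ^- j], which controls the quadratic error. The first [N]
   increments, bounded crudely, are a fraction [2 * 4 ^- j] of all; the later ones are bounded
   through the Green function at time [N]. *)
pose n := (4 ^ (l - j)).-1; pose N := ((4 ^ (l - 2 * j)).*2)%N.
have nE : n.+1 = (4 ^ (l - j))%N by rewrite prednK// expn_gt0.
have Nn : (N <= n.+1)%N.
  rewrite nE /N -muln2; apply: (@leq_trans (4 ^ (l - 2 * j) * 4 ^ j)).
    rewrite leq_mul2l; apply/orP; right.
    by rewrite -(prednK j1) expnS; move: (expn_gt0 4 j.-1) => /=; lia.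
  by rewrite -expnD leq_exp2l//; lia.
have n0 : 0 < n.+1%:R :> R by [].
have tn : theta * n.+1%:R <= z.
  rewrite -ler_pdivlMr// nE natrX; apply: le_trans thl _.
  rewrite /z -invfM -exprD lef_pV2 ?posrE ?exprn_gt0// ler_weXn2l ?ler1n//; lia.
have Nz : N%:R = 2 * z * n.+1%:R.
  rewrite nE /N -mul2n natrM !natrX -mulrA; congr (_ * _).
  rewrite (_ : (l - j = j + (l - 2 * j))%N); last by lia.
  by rewrite exprD mulKf// expf_neq0// pnatr_eq0.
have GE : green (adj := adj) K o N = G by apply: (green_even o uv_inj plane_nb G_bounded).
have G1 : 1 <= G by rewrite -GE; exact: (green_ge1 G_bounded o K_stoch).
have G0 : 0 < G by apply: lt_le_trans G1.
have chi0 : 0 <= beta o [::] by exact: (beta_ge0 adj_sym perc G_transitive e_bij chi_fin).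
have hN := hA N; rewrite GE in hN.
have h := mean_total_split adj_sym V_infinite G_connected G_transitive G_bounded
  e_bij perc chi_fin Nn.
have i0 := mean_increment_ge0 adj_sym V_infinite G_connected G_transitive
  G_bounded e_bij perc chi_fin N.
apply: le_trans (Lambda_upper_mean adj_sym V_infinite G_connected G_transitive
  G_bounded e_bij S_walk perc chi_fin (n := n) th0 a0 _ hT) _.
  rewrite ler_pdivlMr// ler_pdivlMr//; lra.
set Q := (1 + eta + A / G) / G.
have miQ : mean_increment (adj := adj) (omega := omega) (P := P) o N <= Q.
  by rewrite /Q ler_pdivlMr// mulrC.
have hS : (\sum_(k < n.+1) mean_increment (adj := adj) (omega := omega) (P := P) o k) /
    n.+1%:R <= Q + 2 * beta o [::] * z.
  rewrite ler_pdivrMr//; apply: le_trans h _.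
  rewrite [leRHS]mulrDl addrC; apply: lerD.
    rewrite mulrC; apply: ler_pM => //; rewrite ler_nat; exact: leq_subr.
  by rewrite Nz le_eqVlt; apply/orP; left; apply/eqP; ring.
have hT' : 16 * theta ^+ 2 * n.+1%:R / a ^+ 2 * T <= theta * (16 * T / a ^+ 2 * z).
  rewrite (_ : 16 * _ * _ / _ * _ = theta * (16 * T / a ^+ 2 * (theta * n.+1%:R))).
    apply: ler_wpM2l; first exact: ltW.
    by apply: ler_wpM2l => //; rewrite divr_ge0 ?sqr_ge0// mulr_ge0.
  by rewrite expr2; field; rewrite gt_eqF.
rewrite lee_fin; apply: le_trans (lerD (ler_wpM2l (ltW th0) hS) hT') _.
by rewrite -mulrDr -addrA -mulrDl.
Qed.

Lemma plane_ratio :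
  (Lambda P theta / Lambda P0 theta)%E @[theta --> 0^'+] --> 1%:E.
Proof.
apply: ratio_cvg_squeeze => [theta th0|eps eps0 eps1].
  by apply: (Lambda_zero_le adj_sym G_transitive G_bounded e_bij S_walk perc perc0
    chi_fin); exact: ltW.
have [a [T [a0 hT]]] := exp_moment q0 q1 adj_sym perc G_bounded G_transitive
  e_bij chi_fin.
have T0 : 0 <= T.
  rewrite -lee_fin; apply: le_trans (hT o).
  by apply: integral_ge0 => w _; exact: expeR_ge0.
have chi0 : 0 <= beta o [::] by exact: (beta_ge0 adj_sym perc G_transitive e_bij chi_fin).
pose D := 2 * beta o [::] + 16 * T / a ^+ 2.
have D0 : 0 <= D.
  by apply: addr_ge0; [exact: mulr_ge0|rewrite divr_ge0 ?sqr_ge0// mulr_ge0].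
have eps16 : 0 < eps / 16 by rewrite divr_gt0.
have [A A0 hA] := recurrent_mean_increment adj_sym V_infinite G_connected
  G_transitive G_bounded e_bij perc chi_fin t_aut t_o t_iota iota_bij eps16.
(* The first bound is the one that [scale_arith] asks for; the second keeps the stopped time within
   the range of [plane_upper_scale]. *)
have xi0 : 0 < Num.min (eps / (40 * (D + 1))) (a / 2).
  by rewrite lt_min !divr_gt0// mulr_gt0// ltr_wpDl.
have [k [l0 [_ hl]]] := scales_exist A eps16 xi0.
exists (4 ^- l0) => [|theta th0 thl0]; first by rewrite invr_gt0 exprn_gt0.
have [l [ll0 l1 l2]] := dyadic_scale th0 thl0.
have [j1 jl hG hz hAG] := hl l ll0; set j := (l %/ k)%N in j1 jl hG hz hAG.
have G_ge1 i : 1 <= central_sum (4 ^ i) :> R.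
  by rewrite -(green_even o uv_inj plane_nb G_bounded); exact: (green_ge1 G_bounded o K_stoch).
have z0 : 0 < 4 ^- j :> R by rewrite invr_gt0 exprn_gt0.
have [hz1 hz2] : 4 ^- j * central_sum (4 ^ (l + 2 * j)) <= eps / (40 * (D + 1)) /\
    4 ^- j <= a / 2.
  move: hz; rewrite le_min => /andP[h1 h2]; split=> //.
  by apply: le_trans h2; rewrite ler_peMr// ltW.
have [B0 hB] := scale_arith eps0 eps1 (ltW z0) (G_ge1 _) (G_ge1 _) D0 hG hz1 hAG.
exists (theta * ((1 - 4 ^- j) / central_sum (4 ^ (l + 2 * j)) - 4 * 4 ^- j)).
  exact: mulr_gt0.
split; first exact: plane_lower_scale.
apply: le_trans (plane_upper_scale jl j1 th0 l2 a0 hz2 hT hA) _.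
by rewrite lee_fin mulrCA; apply: ler_wpM2l => //; exact: ltW.
Qed.

End plane.
(** In the rotated coordinates [h + k] and [h - k] every step moves both by 1 or -1, independently.
    The translations [t] make [V] a group with unit [o]. *)
Lemma square_ratio (h k : V -> int) (pt : int -> int -> V) :
  (forall a b, h (pt a b) = a) -> (forall a b, k (pt a b) = b) ->
  (forall x, pt (h x) (k x) = x) ->
  (forall x y, adj x y = (`|h x - h y| + `|k x - k y| == 1)) ->
  (Lambda P theta / Lambda P0 theta)%E @[theta --> 0^'+] --> 1%:E.
Proof.
move=> hE kE ptE adjE.
have eq_pt y a b : (y == pt a b) = (h y == a) && (k y == b).
  apply/eqP/andP => [->|[/eqP <- /eqP <-]]; first by rewrite hE kE !eqxx.
  by rewrite ptE.
pose t x y := pt (h x + h y - h o) (k x + k y - k o).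
pose iota x := pt (h o + h o - h x) (k o + k o - k x).
apply: (@plane_ratio (fun x => h x + k x) (fun x => h x - k x) t iota).
- move=> x y uxy vxy; apply/eqP; rewrite -[y]ptE eq_pt.
  by apply/andP; split; apply/eqP; lia.
- move=> x; exists (pt (h x + 1) (k x)), (pt (h x) (k x + 1)),
    (pt (h x) (k x - 1)), (pt (h x - 1) (k x)).
  rewrite !hE !kE; split; try (by split; lia).
  apply: uniq_perm; first exact: nb_uniq.
    by rewrite /= !inE !eq_pt !hE !kE; lia.
  move=> y; rewrite mem_nb// adjE !inE !eq_pt.
  by apply/idP/idP; lia.
- move=> x; split; last by move=> a b; rewrite !adjE !hE !kE; apply/idP/idP; lia.
  exists (fun y => pt (h y - h x + h o) (k y - k x + k o)) => y;
    by apply/eqP; rewrite eq_sym eq_pt !hE !kE; lia.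
- by move=> x; rewrite /t !addrK ptE.
- by move=> x; apply/eqP; rewrite eq_sym eq_pt /iota !hE !kE; lia.
- by exists iota => x; apply/eqP; rewrite eq_sym eq_pt /iota !hE !kE; lia.
- by move=> x a b /=; rewrite !hE !kE; lia.
Qed.

Lemma Zd_ratio d : d = 1%N \/ d = 2%N -> graph_isomorphic adj (@Zd_adj d) ->
  (Lambda P theta / Lambda P0 theta)%E @[theta --> 0^'+] --> 1%:E.
Proof.
move=> d12 [f [[g fK gK] fadj]]; case: d12 => dE; subst d.
  apply: (@line_ratio (fun x => f x ord0 ord0)) => [|x y].
    exists (fun a => g (\row_(i < 1) a)) => [x|a]; last by rewrite gK mxE.
    apply: (can_inj fK); rewrite gK; apply/rowP => i.
    by rewrite mxE (ord1 i).
  by rewrite -fadj /Zd_adj big_ord1.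
pose i1 : 'I_2 := lift ord0 ord0.
apply: (@square_ratio (fun x => f x ord0 ord0) (fun x => f x ord0 i1)
  (fun a b => g (\row_(i < 2) if i == ord0 then a else b))) => [a b|a b|x|x y].
- by rewrite gK mxE.
- by rewrite gK mxE.
- apply: (can_inj fK); rewrite gK; apply/rowP => i; rewrite mxE.
  case: (unliftP ord0 i) => [j ->|->]; last by rewrite eqxx.
  by rewrite (ord1 j).
- by rewrite -fadj /Zd_adj big_ord_recl big_ord1.
Qed.

End ratios.

Theorem theorem1p10 (R : realType) (V : choiceType) (adj : rel V)
  (dW : measure_display) (W : measurableType dW)
  (S : nat -> W -> V) (PW : V -> probability W R)
  (dX : measure_display) (X : measurableType dX)
  (omega : X -> {fset V} -> bool) (PX : R -> probability X R)
  (o : V) (p : R)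
  (adj_sym : symmetric adj) (adj_irr : irreflexive adj)
  (V_infinite : infinite_set [set: V])
  (G_connected : connected_graph adj)
  (G_transitive : vertex_transitive adj)
  (G_bounded : bounded_degrees adj)
  (S_walk : is_simple_random_walk adj S PW)
  (omega_perc : forall q : R, 0 <= q <= 1 ->
     is_bernoulli_percolation adj omega q (PX q))
  (p_ge0 : 0 <= p) (p_lt : p < p_T adj omega PX o) :
  (transient S PW ->
     (Lambda adj S omega (PW o) (PX p) theta /
      Lambda adj S omega (PW o) (PX 0%R) theta)%E @[theta --> 0^'+] -->
     (escape_constant adj S omega (PW o) (PX p) o /
      escape_constant adj S omega (PW o) (PX 0%R) o)%E)
  /\
  (forall d : nat, d = 1%N \/ d = 2%N -> graph_isomorphic adj (@Zd_adj d) ->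
     (Lambda adj S omega (PW o) (PX p) theta /
      Lambda adj S omega (PW o) (PX 0%R) theta)%E @[theta --> 0^'+] -->
     (1%:E : \bar R)).
Proof.
have [e e_bij] := exists_enumeration V_infinite G_connected G_bounded.
have p_T_lb q : 0 <= q <= 1 -> mean_cluster_size adj omega (PX q) o = +oo%E ->
    p_T adj omega PX o <= q.
  by move=> q01 hq; apply: ge_inf; [exists 0 => r [/andP[]]|split].
(* The infimum of the empty set is 0 by convention, so [0 <= p < p_T] forces the set that defines
   [p_T] to contain some [q <= 1], and then [p < q]. *)
have p1 : p <= 1.
  have [pT0|/set0P[q [q01 hq]]] :=
    eqVneq [set q | 0 <= q <= 1 /\ mean_cluster_size adj omega (PX q) o = +oo%E] set0.
    by have := le_lt_trans p_ge0 p_lt; rewrite /p_T pT0 inf0 ltxx.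
  have /andP[_ q1] := q01.
  exact: le_trans (ltW (lt_le_trans p_lt (p_T_lb q q01 hq))) q1.
have p01 : 0 <= p <= 1 by rewrite p_ge0.
have perc := omega_perc p p01.
have perc0 : is_bernoulli_percolation adj omega (0 : R) (PX 0).
  by apply: omega_perc; rewrite lexx ler01.
have clusterE w : cluster_of adj omega w [:: o] = Defs.cluster adj omega w o.
  by apply/seteqP; split=> y /reach_path.
(* An infinite mean at [p] would put [p] into the set whose infimum is [p_T]. *)
have chi_fin : (\int[PX p]_w counting (cluster_of adj omega w [:: o]) < +oo)%E.
  rewrite ltey; apply/eqP => hinf; have := p_T_lb p p01.
  rewrite /mean_cluster_size; under eq_integral do rewrite -clusterE.
  by move=> /(_ hinf); rewrite leNgt p_lt.
split=> [tr|d d12 iso]; last first.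
  exact: (Zd_ratio adj_sym V_infinite G_connected G_transitive G_bounded e_bij
    S_walk p_ge0 p1 perc perc0 chi_fin d12 iso).
have chi0 := chi0_fin adj_sym e_bij perc0 o.
have c0 := escape_constant0_gt0 adj_sym V_infinite G_connected G_transitive
  G_bounded e_bij S_walk perc0 o tr.
have [_ fin0] := mean_increment_cvg adj_sym V_infinite G_connected G_transitive
  G_bounded e_bij S_walk perc0 chi0.
have [_ finp] := mean_increment_cvg adj_sym V_infinite G_connected G_transitive
  G_bounded e_bij S_walk perc chi_fin.
rewrite -(fineK fin0) -(fineK finp) inver gt_eqF//.
apply: ratio_cvg_linear => //.
- apply: fine_ge0; apply: integral_ge0 => w _; apply: mule_ge0 => //.
  exact: counting_ge0.
- exact: (Lambda_linear adj_sym V_infinite G_connected G_transitive G_bounded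
    e_bij S_walk p_ge0 p1 perc chi_fin).
- exact: (Lambda_linear adj_sym V_infinite G_connected G_transitive G_bounded
    e_bij S_walk (lexx 0) ler01 perc0 chi0).
Qed.
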